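(* The following equivalences hold: (i) $\mathrm{FO}(\approx,\mathrm{dep}(\cdots))\equiv\mathrm{L\text{-}ESO}_{[0,1]}[=,+,0,1]$; (ii) $\mathrm{FO}(\approx)$ is equivalent ($\equiv$) to the class of almost conjunctive $\ddot\exists^*\forall^*$-formulae of $\mathrm{L\text{-}ESO}_{[0,1]}[=,\mathrm{SUM},0,1]$.
   Context: Conventions on structures and $\mathrm{ESO}_{\mathbb R}$. Let $\tau$ be a finite relational vocabulary and $\sigma$ a finite functional vocabulary. An $\mathbb R$-structure of vocabulary $\tau\cup\sigma$ is a tuple $\mathfrak A=(A,\mathbb R,(R^{\mathfrak A})_{R\in\tau},(g^{\mathfrak A})_{g\in\sigma})$ where $A$ is a finite set with at least two elements, each $R^{\mathfrak A}\subseteq A^{\mathrm{ar}(R)}$ and each $g^{\mathfrak A}\colon A^{\mathrm{ar}(g)}\to\mathbb R$. For $S\subseteq\mathbb R$, $\mathfrak A$ is an $S$-structure if every $g^{\mathfrak A}$ takes values in $S$, and a $d[0,1]$-structure if every $g^{\mathfrak A}$ is a probability distribution on $A^{\mathrm{ar}(g)}$. If $\sigma=\emptyset$, $\mathfrak A$ is a finite structure. Numerical terms are built by $i::=c\mid f(\vec x)\mid i+i\mid i\times i\mid \mathrm{SUM}_{\vec y}\,i$, where $c\in\mathbb R$ is a constant, $f$ is a function symbol or function variable, and $\vec x,\vec y$ are tuples of first-order variables; under an assignment $s$, $f(\vec x)$ denotes $f^{\mathfrak A}(s(\vec x))$, $+,\times$ are real addition and multiplication, and $\mathrm{SUM}_{\vec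 y}\,i$ denotes $\sum_{\vec a\in A^{|\vec y|}}[i]_{s[\vec a/\vec y]}$ (the variables $\vec y$ become bound). For $O\subseteq\{+,\times,\mathrm{SUM}\}$, $E\subseteq\{=,<,\le\}$, $C\subseteq\mathbb R$, the formulae of $\mathrm{ESO}_{\mathbb R}[O,E,C]$ are given by $\phi::= x=y\mid\neg x=y\mid i\,e\,j\mid\neg\, i\,e\,j\mid R(\vec x)\mid\neg R(\vec x)\mid\phi\wedge\phi\mid\phi\vee\phi\mid\exists x\phi\mid\forall x\phi\mid\exists f\phi$, where $i,j$ are numerical terms using only operations in $O$ and constants in $C$, $e\in E$, $R\in\tau$, and $f$ is a function variable. Semantics is Tarskian: first-order variables range over $A$ and $\exists f$ ranges over all functions $A^{\mathrm{ar}(f)}\to\mathbb R$. For $S\subseteq\mathbb R$, $\mathrm{ESO}_S[O,E,C]$ has the same syntax but $\exists f$ ranges over functions $A^{\mathrm{ar}(f)}\to S$; in $\mathrm{ESO}_{d[0,1]}[O,E,C]$, $\exists f$ ranges over probability distributions on $A^{\mathrm{ar}(f)}$. Free function variables are interpreted like symbols of $\sigma$. We list the elements of $O,E,C$ together in brackets, e.g. $\mathrm{ESO}_{\mathbb R}[\le,+,\mathrm{SUM},0,1]$ means $O=\{+,\mathrm{SUM}\}$, $E=\{\le\}$, $C=\{0,1\}$. Fragments. The loose fragment $\mathrm{L\text{-}ESO}_S[O,E,C]$ of $\mathrm{ESO}_S[O,E,C]$ ($S$ a set of reals or $d[0,1]$) consists of the formulae containing no negated numerical atom $\neg\, i\,e\,j$.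 A formula is almost conjunctive if for every subformula $(\psi_1\vee\psi_2)$, at least one of $\psi_1,\psi_2$ contains no numerical term. For a regular expression $L$ over $\{\ddot\exists,\exists,\forall\}$, the $L$-formulae of a logic are those in prenex form whose quantifier prefix belongs to $L$, where $\ddot\exists$ stands for an existential function quantifier and $\exists,\forall$ for first-order quantifiers (e.g. $\ddot\exists^*\forall^*$). Teams and probabilistic team semantics. A team $X$ is a finite set of assignments $s\colon D\to A$ for a finite set $D$ of first-order variables (its variable domain) and a finite set $A$. A probabilistic team is a function $\mathbb X\colon X\to[0,1]$ with $\sum_{s\in X}\mathbb X(s)=1$ (the empty function is also a probabilistic team). Write $\mathrm{supp}(\mathbb X)=\{s:\mathbb X(s)>0\}$, $|\mathbb X|=\sum_s\mathbb X(s)$, and for a first-order formula $\alpha$, $\mathbb X_\alpha$ is the restriction of $\mathbb X$ to assignments satisfying $\alpha$; e.g. $|\mathbb X_{\vec x=\vec a}|$ is the total weight of assignments mapping $\vec x$ to $\vec a$. Sums and scalar multiples of teams are pointwise. The marginal of $\mathbb X$ on a variable set $V$ is $s\mapsto\sum_{t\upharpoonright V=s}\mathbb X(t)$. For a variable $x$ and finite set $A$, $\mathbb X[A/x]$ is the team on all assignments $s$ over $\mathrm{Dom}(\mathbb X)\cup\{x\}$ with $s(x)\in A$ whose restriction to $\mathrm{Dom}(\mathbb X)\setminus\{x\}$ lies in the support of the marginal $\mathbb X'$ of $\mathbb X$ on $\mathrm{Dom}(\mathbb X)\setminus\{x\}$, given by $s\mapsto\mathbb X'(s\upharpoonright(\mathrm{Dom}(\mathbb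 X)\setminus\{x\}))/|A|$. Formulae are in negation normal form; for first-order $\alpha$, $\alpha^\bot$ is the negation normal form of $\neg\alpha$, and $\alpha\to\psi$ abbreviates $\alpha^\bot\vee(\alpha\wedge\psi)$. For a $\tau$-structure $\mathfrak A$ with domain $A$: $\mathfrak A\models_{\mathbb X}l$ for a first-order literal $l$ iff $\mathfrak A\models_s l$ for all $s\in\mathrm{supp}(\mathbb X)$; $\mathfrak A\models_{\mathbb X}\psi\wedge\theta$ iff both hold; $\mathfrak A\models_{\mathbb X}\psi\vee\theta$ iff there are probabilistic teams $\mathbb Y,\mathbb Z$ and $\alpha\in[0,1]$ with $\alpha\mathbb Y+(1-\alpha)\mathbb Z=\mathbb X$, $\mathfrak A\models_{\mathbb Y}\psi$ and $\mathfrak A\models_{\mathbb Z}\theta$; $\mathfrak A\models_{\mathbb X}\forall x\psi$ iff $\mathfrak A\models_{\mathbb X[A/x]}\psi$; $\mathfrak A\models_{\mathbb X}\exists x\psi$ iff $\mathfrak A\models_{\mathbb Y}\psi$ for some probabilistic team $\mathbb Y$ over $\mathrm{Dom}(\mathbb X)\cup\{x\}$ with $x$-values in $A$ whose marginal on $\mathrm{Dom}(\mathbb X)\setminus\{x\}$ equals that of $\mathbb X$. A sentence $\phi$ holds in $\mathfrak A$ iff $\mathfrak A\models_{\mathbb X_\emptyset}\phi$, where $\mathbb X_\emptyset$ gives the empty assignment weight $1$. Atoms. Marginal identity $\vec x\approx\vec y$ ($\vec x,\vec y$ of equal length $k$): $|\mathbb X_{\vec x=\vec a}|=|\mathbb X_{\vec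 y=\vec a}|$ for all $\vec a\in A^k$. Inclusion $\vec x\subseteq\vec y$: for every $s\in\mathrm{supp}(\mathbb X)$ there is $s'\in\mathrm{supp}(\mathbb X)$ with $s(\vec x)=s'(\vec y)$. Dependence $\mathrm{dep}(\vec x,y)$: all $s,s'\in\mathrm{supp}(\mathbb X)$ with $s(\vec x)=s'(\vec x)$ satisfy $s(y)=s'(y)$ (for empty $\vec x$, written $\mathrm{dep}(y)$: $y$ is constant on the support). Marginal independence $\vec y\perp\!\!\!\perp\vec z$: $|\mathbb X_{\vec y=\vec b}|\cdot|\mathbb X_{\vec z=\vec c}|=|\mathbb X_{\vec y\vec z=\vec b\vec c}|\cdot|\mathbb X|$ for all tuples $\vec b,\vec c$. $\mathrm{FO}(\mathcal C)$ is first-order logic extended with the atoms in $\mathcal C$; $\mathrm{FO}(\approx)$ is probabilistic inclusion logic, $\mathrm{FO}(\subseteq)$ is inclusion logic, $\mathrm{FO}(\approx,\mathrm{dep}(\cdots))$ adds both marginal identity and dependence atoms, $\mathrm{FO}(\perp\!\!\!\perp)$ adds marginal independence atoms. Comparing team logics with ESO. For a probabilistic team $\mathbb X$ with variable domain $\{x_1,\dots,x_n\}$ and values in $A$, $f_{\mathbb X}\colon A^n\to[0,1]$ is given by $f_{\mathbb X}(s(x_1),\dots,s(x_n))=\mathbb X(s)$ for $s$ in the team and $0$ elsewhere. For $\phi\in\mathrm{FO}(\mathcal C)$ of vocabulary $\tau$ with free variables $x_1,\dots,x_n$, $\mathrm{Struc}_{d[0,1]}(\phi)$ is the class of $d[0,1]$-structures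 $\mathfrak A$ of vocabulary $\tau\cup\{f\}$ ($f$ $n$-ary) such that the $\tau$-reduct of $\mathfrak A$ satisfies $\phi$ under the probabilistic team $\mathbb X$ with $f_{\mathbb X}=f^{\mathfrak A}$. For an ESO-type formula with one free $n$-ary function variable $f$ and no free first-order variables, $\mathrm{Struc}_{d[0,1]}$ is the class of $d[0,1]$-structures of vocabulary $\tau\cup\{f\}$ satisfying it. For logics $\mathcal L,\mathcal L'$, $\mathcal L\le\mathcal L'$ means every $\phi\in\mathcal L$ has some $\phi'\in\mathcal L'$ with $\mathrm{Struc}_{d[0,1]}(\phi)=\mathrm{Struc}_{d[0,1]}(\phi')$; $\equiv$ means $\le$ in both directions; $<$ means $\le$ but not $\ge$. *)

(* Defs.v *)
From HB Require Import structures.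
From mathcomp Require Import all_boot all_order all_algebra.
From mathcomp Require Import Rstruct.
From Stdlib Require Rdefinitions.

Set Implicit Arguments.
Unset Strict Implicit.
Unset Printing Implicit Defensive.

Import Order.TTheory GRing.Theory Num.Theory.
Local Open Scope ring_scope.

Notation R := Rdefinitions.R.

(* A finite relational vocabulary tau: relation symbol r (r < size tau)
   has arity nth 0 tau r. *)
Definition vocab := seq nat.

Definition is_tau_struct (tau : vocab) (A : finType) (rel : nat -> seq A -> bool) :=
  forall r s, rel r s -> (r < size tau)%N /\ size s = nth 0%N tau r.

Definition is_distr (A : finType) (n : nat) (f : n.-tuple A -> R) :=
  (forall t, 0 <= f t) /\ \sum_(t : n.-tuple A) f t = 1.

Inductive tform :=
| TEq   of nat & nat
| TNeq  of nat & nat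
| TRel  of nat & seq nat
| TNRel of nat & seq nat
| TApprox of seq nat & seq nat
| TDep  of seq nat & nat
| TAnd  of tform & tform
| TOr   of tform & tform
| TEx   of nat & tform
| TAll  of nat & tform.

Fixpoint tscope (tau : vocab) (vs : seq nat) (p : tform) : bool :=
  match p with
  | TEq x y | TNeq x y => (x \in vs) && (y \in vs)
  | TRel r xs | TNRel r xs =>
      [&& (r < size tau)%N, size xs == nth 0%N tau r & all (mem vs) xs]
  | TApprox xs ys => [&& size xs == size ys, all (mem vs) xs & all (mem vs) ys]
  | TDep xs y => all (mem vs) xs && (y \in vs)
  | TAnd p q | TOr p q => tscope tau vs p && tscope tau vs q
  | TEx x p | TAll x p => tscope tau (x :: vs) p
  end.

Fixpoint no_dep (p : tform) : bool :=
  match p with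
  | TDep _ _ => false
  | TAnd p q | TOr p q => no_dep p && no_dep q
  | TEx _ p | TAll _ p => no_dep p
  | _ => true
  end.

Fixpoint tmaxv (p : tform) : nat :=
  match p with
  | TEq x y | TNeq x y => maxn x y
  | TRel _ xs | TNRel _ xs => \max_(x <- xs) x
  | TApprox xs ys => maxn (\max_(x <- xs) x) (\max_(x <- ys) x)
  | TDep xs y => maxn (\max_(x <- xs) x) y
  | TAnd p q | TOr p q => maxn (tmaxv p) (tmaxv q)
  | TEx x p | TAll x p => maxn x (tmaxv p)
  end.

Section TeamSemantics.
Variables (A : finType) (rel : nat -> seq A -> bool) (N : nat).

(* assignments with variable domain a subset of {0,...,N-1}:
   s i = None means i is not in the domain of s *)
Definition asg := {ffun 'I_N -> option A}.
Definition dom (s : asg) : {set 'I_N} := [set i | s i != None].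
Definition vl (s : asg) (x : nat) : option A :=
  if (insub x : option 'I_N) is Some i then s i else None.
Definition vls (s : asg) (xs : seq nat) : seq (option A) := map (vl s) xs.
Definition vset (x : nat) : {set 'I_N} :=
  if (insub x : option 'I_N) is Some i then [set i] else set0.
Definition restr (V : {set 'I_N}) (s : asg) : asg :=
  [ffun i => if i \in V then s i else None].

(* a (weighted) team is a function asg -> R; it is a probabilistic team over
   variable domain D if it is nonnegative, only charges assignments with
   domain D, and has total weight 1 or 0 (0 = the empty probabilistic team) *)
Definition pteam (D : {set 'I_N}) (Y : asg -> R) :=
  [/\ (forall s, 0 <= Y s), (forall s, Y s != 0 -> dom s = D)
    & (\sum_(s : asg) Y s = 0 \/ \sum_(s : asg) Y s = 1)].

Definition marg (V : {set 'I_N}) (X : asg -> R) (t : asg) : R :=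
  \sum_(s : asg | restr V s == t) X s.

Definition dupl (D : {set 'I_N}) (x : nat) (X : asg -> R) (s : asg) : R :=
  if dom s == D :|: vset x then
    marg (D :\: vset x) X (restr (D :\: vset x) s) / (#|A|%:R)
  else 0.

Fixpoint tsat (D : {set 'I_N}) (p : tform) (X : asg -> R) : Prop :=
  match p with
  | TEq x y => forall s, 0 < X s -> vl s x = vl s y
  | TNeq x y => forall s, 0 < X s -> vl s x <> vl s y
  | TRel r xs => forall s, 0 < X s -> rel r (pmap id (vls s xs))
  | TNRel r xs => forall s, 0 < X s -> ~~ rel r (pmap id (vls s xs))
  | TApprox xs ys => forall a : seq A, size a = size xs ->
      \sum_(s : asg | vls s xs == map Some a) X s =
      \sum_(s : asg | vls s ys == map Some a) X s
  | TDep xs y => forall s s', 0 < X s -> 0 < X s' ->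
      vls s xs = vls s' xs -> vl s y = vl s' y
  | TAnd p q => tsat D p X /\ tsat D q X
  | TOr p q => exists (Y Z : asg -> R) (al : R),
      [/\ pteam D Y, pteam D Z, (0 <= al <= 1),
          (forall s, X s = al * Y s + (1 - al) * Z s)
        & tsat D p Y /\ tsat D q Z]
  | TEx x p => exists Y : asg -> R,
      [/\ pteam (D :|: vset x) Y,
          (forall t, marg (D :\: vset x) Y t = marg (D :\: vset x) X t)
        & tsat (D :|: vset x) p Y]
  | TAll x p => tsat (D :|: vset x) p (dupl D x X)
  end.

End TeamSemantics.

(* Satisfaction of a team formula with free variables x_0,...,x_(n-1) under the
   probabilistic team X with f_X = f (the team over domain {x_0..x_(n-1)}). *)
Definition tbound (n : nat) (p : tform) : nat := maxn n (tmaxv p).+1.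

Definition team_of (A : finType) (N n : nat) (f : n.-tuple A -> R)
  (s : asg A N) : R :=
  \sum_(t : n.-tuple A | (dom s == [set i : 'I_N | (i < n)%N]) &&
        [forall i : 'I_n, vl s i == Some (tnth t i)]) f t.

Definition tsat_struct (A : finType) (rel : nat -> seq A -> bool) (n : nat)
  (f : n.-tuple A -> R) (p : tform) : Prop :=
  let N := tbound n p in
  tsat rel [set i : 'I_N | (i < n)%N] p (team_of f).

Inductive nterm :=
| NConst of R
| NSym of seq nat               (* f(xs), f the free function symbol *)
| NVar of nat & seq nat
| NAdd of nterm & nterm
| NMul of nterm & nterm
| NSum of seq nat & nterm.

Inductive cmp := CEq | CLt | CLe.

Inductive eform :=
| EEq of nat & nat
| ENeq of nat & nat
| ECmp of cmp & nterm & nterm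
| ENCmp of cmp & nterm & nterm
| ERel of nat & seq nat
| ENRel of nat & seq nat
| EAnd of eform & eform
| EOr of eform & eform
| EEx of nat & eform
| EAll of nat & eform
| EFEx of nat & nat & eform.         (* EFEx g k p : exists k-ary function g, p *)

Fixpoint flook (fs : seq (nat * nat)) (g : nat) : option nat :=
  if fs is (g', k) :: fs' then if g' == g then Some k else flook fs' g else None.

Fixpoint ntwf (n : nat) (fs : seq (nat * nat)) (vs : seq nat) (i : nterm) : bool :=
  match i with
  | NConst _ => true
  | NSym xs => (size xs == n) && all (mem vs) xs
  | NVar g xs => (flook fs g == Some (size xs)) && all (mem vs) xs
  | NAdd i j | NMul i j => ntwf n fs vs i && ntwf n fs vs j
  | NSum ys i => uniq ys && ntwf n fs (ys ++ vs) i
  end.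

Fixpoint ewf (tau : vocab) (n : nat) (fs : seq (nat * nat)) (vs : seq nat)
  (p : eform) : bool :=
  match p with
  | EEq x y | ENeq x y => (x \in vs) && (y \in vs)
  | ECmp _ i j | ENCmp _ i j => ntwf n fs vs i && ntwf n fs vs j
  | ERel r xs | ENRel r xs =>
      [&& (r < size tau)%N, size xs == nth 0%N tau r & all (mem vs) xs]
  | EAnd p q | EOr p q => ewf tau n fs vs p && ewf tau n fs vs q
  | EEx x p | EAll x p => ewf tau n fs (x :: vs) p
  | EFEx g k p => ewf tau n ((g, k) :: fs) vs p
  end.

Definition eso_sentence (tau : vocab) (n : nat) (p : eform) : bool :=
  ewf tau n [::] [::] p.

Section ESOSemantics.
Variables (A : finType) (rel : nat -> seq A -> bool) (n : nat)
  (f : n.-tuple A -> R).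

Definition updl (s : nat -> A) (ys : seq nat) (a : seq A) : nat -> A :=
  fun v => if v \in ys then nth (s v) a (index v ys) else s v.

Fixpoint nval (fe : nat -> seq A -> R) (s : nat -> A) (i : nterm) : R :=
  match i with
  | NConst c => c
  | NSym xs => if (insub (map s xs) : option (n.-tuple A)) is Some t then f t else 0
  | NVar g xs => fe g (map s xs)
  | NAdd i j => nval fe s i + nval fe s j
  | NMul i j => nval fe s i * nval fe s j
  | NSum ys i => \sum_(a : (size ys).-tuple A) nval fe (updl s ys a) i
  end.

Definition cmpR (e : cmp) (a b : R) : Prop :=
  match e with CEq => a = b | CLt => a < b | CLe => a <= b end.

Definition upd (s : nat -> A) (x : nat) (a : A) : nat -> A :=
  fun v => if v == x then a else s v.

Definition fext (k : nat) (h : k.-tuple A -> R) : seq A -> R :=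
  fun a => if (insub a : option (k.-tuple A)) is Some t then h t else 0.

Fixpoint esat (fe : nat -> seq A -> R) (s : nat -> A) (p : eform) : Prop :=
  match p with
  | EEq x y => s x = s y
  | ENeq x y => s x <> s y
  | ECmp e i j => cmpR e (nval fe s i) (nval fe s j)
  | ENCmp e i j => ~ cmpR e (nval fe s i) (nval fe s j)
  | ERel r xs => rel r (map s xs)
  | ENRel r xs => ~~ rel r (map s xs)
  | EAnd p q => esat fe s p /\ esat fe s q
  | EOr p q => esat fe s p \/ esat fe s q
  | EEx x p => exists a : A, esat fe (upd s x a) p
  | EAll x p => forall a : A, esat fe (upd s x a) p
  | EFEx g k p => exists h : k.-tuple A -> R, (forall t, 0 <= h t <= 1) /\
      esat (fun g' => if g' == g then fext h else fe g') s p
  end.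

(* for sentences the assignment is irrelevant; we quantify over all of them *)
Definition esat_struct (p : eform) : Prop :=
  forall s : nat -> A, esat (fun _ _ => 0) s p.

End ESOSemantics.

Fixpoint nt_in (oadd omul osum : bool) (C : R -> Prop) (i : nterm) : Prop :=
  match i with
  | NConst c => C c
  | NSym _ | NVar _ _ => True
  | NAdd i j => oadd /\ nt_in oadd omul osum C i /\ nt_in oadd omul osum C j
  | NMul i j => omul /\ nt_in oadd omul osum C i /\ nt_in oadd omul osum C j
  | NSum _ i => osum /\ nt_in oadd omul osum C i
  end.

Fixpoint ef_in (oadd omul osum : bool) (E : cmp -> bool) (C : R -> Prop)
  (p : eform) : Prop :=
  match p with
  | ECmp e i j | ENCmp e i j =>
      E e /\ nt_in oadd omul osum C i /\ nt_in oadd omul osum C j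
  | EAnd p q | EOr p q => ef_in oadd omul osum E C p /\ ef_in oadd omul osum E C q
  | EEx _ p | EAll _ p | EFEx _ _ p => ef_in oadd omul osum E C p
  | _ => True
  end.

Fixpoint loose (p : eform) : bool :=
  match p with
  | ENCmp _ _ _ => false
  | EAnd p q | EOr p q => loose p && loose q
  | EEx _ p | EAll _ p | EFEx _ _ p => loose p
  | _ => true
  end.

Fixpoint has_num (p : eform) : bool :=
  match p with
  | ECmp _ _ _ | ENCmp _ _ _ => true
  | EAnd p q | EOr p q => has_num p || has_num q
  | EEx _ p | EAll _ p | EFEx _ _ p => has_num p
  | _ => false
  end.

Fixpoint almost_conj (p : eform) : bool :=
  match p with
  | EOr p q => [&& ~~ has_num p || ~~ has_num q, almost_conj p & almost_conj q]
  | EAnd p q => almost_conj p && almost_conj q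
  | EEx _ p | EAll _ p | EFEx _ _ p => almost_conj p
  | _ => true
  end.

Fixpoint qfree (p : eform) : bool :=
  match p with
  | EEx _ _ | EAll _ _ | EFEx _ _ _ => false
  | EAnd p q | EOr p q => qfree p && qfree q
  | _ => true
  end.

Fixpoint prefA (p : eform) : bool :=
  if p is EAll _ q then prefA q else qfree p.

Fixpoint prefFA (p : eform) : bool :=
  if p is EFEx _ _ q then prefFA q else prefA p.

Definition C01 (c : R) : Prop := c = 0 \/ c = 1.
Definition onlyEq (e : cmp) : bool := if e is CEq then true else false.

Definition LESO_eq_add_01 (p : eform) : Prop :=
  loose p /\ ef_in true false false onlyEq C01 p.

Definition LESO_eq_sum_01_acEA (p : eform) : Prop :=
  [/\ loose p, ef_in false false true onlyEq C01 p, almost_conj p & prefFA p].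

Definition same_struc (tau : vocab) (n : nat) (p : tform) (q : eform) : Prop :=
  forall (A : finType) (rel : nat -> seq A -> bool) (f : n.-tuple A -> R),
    (1 < #|A|)%N -> is_tau_struct tau rel -> is_distr f ->
    (tsat_struct rel f p <-> esat_struct rel f q).

Definition team_le_eso (Lt : tform -> Prop) (Le : eform -> Prop) : Prop :=
  forall (tau : vocab) (n : nat) (p : tform),
    tscope tau (iota 0 n) p -> Lt p ->
    exists q : eform, [/\ eso_sentence tau n q, Le q & same_struc tau n p q].

Definition eso_le_team (Le : eform -> Prop) (Lt : tform -> Prop) : Prop :=
  forall (tau : vocab) (n : nat) (q : eform),
    eso_sentence tau n q -> Le q ->
    exists p : tform, [/\ tscope tau (iota 0 n) p, Lt p & same_struc tau n p q].

Definition equiv_logics (Lt : tform -> Prop) (Le : eform -> Prop) : Prop :=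
  team_le_eso Lt Le /\ eso_le_team Le Lt.

(* Main.v *)
(* Team semantics is local, so a team may be replaced by an unnormalised weight on
   total assignments of the variables 0..M, with disjunction splitting the weight.

   From teams to ESO: every subformula gets its own weight, an existentially quantified
   function; the team connectives become linear conditions on marginals.  The two parts
   of a disjunction are marked by u = v and u <> v in two spare coordinates, and a
   marginal identity is tested after copying its tuples into spare coordinates.  With
   SUM, equality of marginals is an atom; with + alone, sum F = sum G is expressed by an
   injection sigma and a potential H with F a + H a = G a + H (sigma a).

   From ESO to teams: two distinct values c, d are fixed, and a function g is stored as
   the conditional probability that a variable b equals c given uniform variables z.  A
   numerical term becomes an event of conditional probability proportional to its value,
   and i = j becomes a marginal identity between two flags.  Dependence atoms are needed
   only to make the choices for first-order existentials and for disjunctions of two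
   numerical formulae depend on the assignment alone. *)
Require Import Defs.
From mathcomp Require Import all_boot all_order all_algebra.
From mathcomp Require Import Rstruct.
From mathcomp Require Import ring lra zify.
From Stdlib Require Import ClassicalEpsilon FunctionalExtensionality.

Set Implicit Arguments.
Unset Strict Implicit.
Unset Printing Implicit Defensive.
Import Order.TTheory GRing.Theory Num.Theory.
Local Open Scope ring_scope.

(** Two obstacles shape the way into ESO. Quantified functions take values in $[0,1]$, so every
    weight keeps total mass at most 1, and the potential $H$, which may exceed 1, becomes a sum of
    two functions. ESO has no names for elements, while the initial weight needs a filler for the
    coordinates off the domain; the filler is an extra argument of every function, and the
    constraints are stated for each of its values.

    In the other direction, a choice made by a team may depend on values that the ESO formula cannot
    see, such as the variables of other blocks. Hence every assertion concerns masses over fixed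
    values of a list of context variables, and a step is harmless when it multiplies the masses over
    each context by one factor. A flag chosen for a function may depend on hidden values, yet only
    its average over them counts, and this average is again a function into $[0,1]$; so function
    quantifiers work without dependence atoms. Since $\times$ is absent, an event reads at most one
    block along each branch, and the invariant can treat the blocks one at a time. *)

Ltac nlia := repeat match goal with
  | H : context [Rdefinitions.R] |- _ => clear H
  | H : context [@Order.le] |- _ => clear H
  | H : context [@GRing.add] |- _ => clear H
  | H : context [@bigop.body] |- _ => clear H
  | H : context [#|_|] |- _ => clear H end; lia.

(** * Weights on assignments *)

Section Teams.
Variables (A : finType) (M : nat).
Notation T := {ffun 'I_M.+1 -> A}.

(** [inord] sends every number above [M] to 0, so such variables would all read coordinate 0. This
    is the origin of the bounds [x <= M] in what follows. *)
Definition gv (t : T) (x : nat) : A := t (inord x).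
Definition ups (t : T) (x : nat) (a : A) : T :=
  [ffun i => if i == inord x then a else t i].

Lemma gv_ups t x a : gv (ups t x a) x = a.
Proof. by rewrite /gv ffunE eqxx. Qed.

Lemma gv_ups_ne t x a y : (x <= M)%N -> (y <= M)%N -> y != x ->
  gv (ups t x a) y = gv t y.
Proof.
move=> xM yM yx; rewrite /gv ffunE; case: eqP => // /(congr1 val).
by rewrite /= !inordK // => /eqP; rewrite (negbTE yx).
Qed.

Lemma ups_ups t x a b : ups (ups t x a) x b = ups t x b.
Proof. by apply/ffunP => i; rewrite !ffunE; case: eqP. Qed.

Lemma ups_id t x : ups t x (gv t x) = t.
Proof. by apply/ffunP => i; rewrite !ffunE; case: eqP => // ->. Qed.

Lemma map_ups t x a ys : (x <= M)%N -> all (fun y => (y <= M)%N) ys ->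
  x \notin ys -> map (gv (ups t x a)) ys = map (gv t) ys.
Proof.
move=> xM; elim: ys => //= y ys IH /andP[yM ysM]; rewrite inE negb_or => /andP[xy xys].
by rewrite IH // gv_ups_ne // eq_sym.
Qed.

(** The marginal away from [x], kept as a function on all of [T] that ignores coordinate [x]. Each
    marginal value thus occurs [#|A|] times, whence the factor in [sum_mg]; division by it gives the
    universal quantifier [dup]. *)
Definition mg (x : nat) (G : T -> R) (t : T) : R := \sum_(a : A) G (ups t x a).
Definition dup (x : nat) (G : T -> R) (t : T) : R := mg x G t / #|A|%:R.
Definition nn (G : T -> R) := forall t, 0 <= G t.
Definition indep (B : Type) (x : nat) (P : T -> B) := forall t a, P (ups t x a) = P t.

(** Exchanging coordinate [x] with the outside value is an involution on pairs. *)
Lemma sum_swap x (H : T -> A -> R) :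
  \sum_t \sum_a H t a = \sum_t \sum_a H (ups t x a) (gv t x).
Proof.
rewrite !pair_big /=.
pose h (p : T * A) := (ups p.1 x p.2, gv p.1 x).
have hK : involutive h.
  by case=> t a; rewrite /h /= ups_ups gv_ups ups_id.
rewrite (reindex_inj (inv_inj hK)) /=.
by apply: eq_bigr => -[t a] _ /=.
Qed.

Lemma mg_ups x (G : T -> R) t a : mg x G (ups t x a) = mg x G t.
Proof. by apply: eq_bigr => b _; rewrite ups_ups. Qed.

Lemma mg_nn x G : nn G -> nn (mg x G).
Proof. by move=> G0 t; apply: sumr_ge0. Qed.

Lemma nn_eq0 (G : T -> R) t : nn G -> ~ 0 < G t -> G t = 0.
Proof. by move=> G0 /negP; rewrite -leNgt => h; apply/eqP; rewrite eq_le h G0. Qed.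

Lemma dup_nn x G : nn G -> nn (dup x G).
Proof. by move=> G0 t; apply: divr_ge0 => //; apply: mg_nn. Qed.

Lemma dup_indep x G : indep x (dup x G).
Proof. by move=> t a; rewrite /dup mg_ups. Qed.

(** Each line in direction [x] meets the slice [gv t x == b] in exactly one point, so the line sums
    over the slice count the whole weight once. *)
Lemma sum_mg_at x (P : pred T) G b : indep x P ->
  \sum_(t | (gv t x == b) && P t) mg x G t = \sum_(t | P t) G t.
Proof.
move=> iP; rewrite big_mkcond /=.
transitivity (\sum_t \sum_a (if (gv t x == b) && P t then G (ups t x a) else 0)).
  by apply: eq_bigr => t _; case: ifP => // _; rewrite big1.
rewrite (sum_swap x) [RHS]big_mkcond /=; apply: eq_bigr => t _.
rewrite (bigD1 b) //= big1 => [|a ab].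
  by rewrite gv_ups eqxx iP ups_ups ups_id addr0.
by rewrite gv_ups (negbTE ab).
Qed.

Lemma sum_mg x (P : pred T) G : indep x P ->
  \sum_(t | P t) mg x G t = #|A|%:R * \sum_(t | P t) G t.
Proof.
move=> iP; rewrite (partition_big (fun t => gv t x) predT) //=.
transitivity (\sum_(b : A) \sum_(t | P t) G t).
  by apply: eq_bigr => b _; rewrite -(sum_mg_at G b iP); apply: eq_bigl => t; rewrite andbC.
by rewrite big_const iter_addr addr0 mulr_natl.
Qed.

Hypothesis A0 : (0 < #|A|)%N.

Lemma cardA_neq0 : #|A|%:R != 0 :> R.
Proof. by rewrite pnatr_eq0 -lt0n. Qed.

Lemma sum_mg_eq x (P : pred T) Y G : indep x P -> mg x Y =1 mg x G ->
  \sum_(t | P t) Y t = \sum_(t | P t) G t.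
Proof.
move=> iP e; apply: (mulfI cardA_neq0).
by rewrite -!(sum_mg _ iP); apply: eq_bigr.
Qed.

Lemma sum_dup x (P : pred T) G : indep x P ->
  \sum_(t | P t) dup x G t = \sum_(t | P t) G t.
Proof. by move=> iP; rewrite -mulr_suml sum_mg // mulrAC mulfV ?mul1r // cardA_neq0. Qed.

Lemma sum_dup_at x (P : pred T) G b : indep x P ->
  \sum_(t | (gv t x == b) && P t) dup x G t = (\sum_(t | P t) G t) / #|A|%:R.
Proof. by move=> iP; rewrite -mulr_suml sum_mg_at. Qed.

Lemma mg_dup x G : mg x (dup x G) =1 mg x G.
Proof.
move=> t; rewrite {1}/mg (eq_bigr (fun _ => dup x G t)); last by move=> a _; rewrite dup_indep.
by rewrite big_const iter_addr addr0 -mulr_natr /dup mulfVK // cardA_neq0.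
Qed.

End Teams.

(** * Team semantics of unnormalised weights *)

Section WSat.
Variables (A : finType) (rel : nat -> seq A -> bool) (M : nat).
Notation T := {ffun 'I_M.+1 -> A}.

(* Team semantics without variable domains and without normalisation: teams are
   arbitrary nonnegative weights on assignments of all the variables 0..M. *)
Fixpoint wsat (p : tform) (G : T -> R) : Prop :=
  match p with
  | TEq x y => forall t, 0 < G t -> gv t x = gv t y
  | TNeq x y => forall t, 0 < G t -> gv t x <> gv t y
  | TRel r xs => forall t, 0 < G t -> rel r (map (gv t) xs)
  | TNRel r xs => forall t, 0 < G t -> ~~ rel r (map (gv t) xs)
  | TApprox xs ys => forall a : seq A, size a = size xs ->
      \sum_(t | map (gv t) xs == a) G t = \sum_(t | map (gv t) ys == a) G t
  | TDep xs y => forall t t', 0 < G t -> 0 < G t' ->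
      map (gv t) xs = map (gv t') xs -> gv t y = gv t' y
  | TAnd p q => wsat p G /\ wsat q G
  | TOr p q => exists Y Z : T -> R,
      [/\ nn Y, nn Z, (forall t, G t = Y t + Z t), wsat p Y & wsat q Z]
  | TEx x p => exists Y : T -> R,
      [/\ nn Y, (forall t, mg x Y t = mg x G t) & wsat p Y]
  | TAll x p => wsat p (dup x G)
  end.

Lemma wsat_ext p (G G' : T -> R) : G =1 G' -> wsat p G -> wsat p G'.
Proof. by move=> e; have -> : G = G' by apply: functional_extensionality. Qed.

(** The empty team property. It handles a part of a disjunction whose coefficient is 0: its team
    leaves no trace in the weight. *)
Lemma wsat0 p (G : T -> R) : (forall t, G t = 0) -> wsat p G.
Proof.
elim: p G => [x y|x y|r xs|r xs|xs ys|xs y|p IHp q IHq|p IHp q IHq|x p IHp|x p IHp] G G0 /=;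
  try by move=> t; rewrite G0 ltxx.
- by move=> a _; rewrite !big1.
- by split; [apply: IHp | apply: IHq].
- exists (fun _ => 0), (fun _ => 0); split=> //; try by [apply: IHp|apply: IHq|move=> t].
  by move=> t; rewrite G0 addr0.
- by exists G; split=> //; [move=> t; rewrite G0 | apply: IHp].
- by apply: IHp => t; rewrite /dup /mg big1 ?mul0r.
Qed.

End WSat.

(** * Agreement of weights with probabilistic teams *)

Section Bridge.
Variables (A : finType) (rel : nat -> seq A -> bool) (N M : nat).
Hypotheses (NM : (N <= M.+1)%N) (A0 : (0 < #|A|)%N).
Notation T := {ffun 'I_M.+1 -> A}.

Definition rst (D : {set 'I_N}) (g : T) : asg A N :=
  [ffun i : 'I_N => if i \in D then Some (gv g i) else None].

Definition dset (vs : seq nat) : {set 'I_N} := [set i : 'I_N | (i : nat) \in vs].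

Lemma vl_rst vs g x : (x < N)%N -> x \in vs -> vl (rst (dset vs) g) x = Some (gv g x).
Proof.
by move=> xN xvs; rewrite /vl insubT /= ffunE inE /= xvs.
Qed.

Lemma vls_rst vs g xs : (forall x, x \in vs -> (x < N)%N) -> all (mem vs) xs ->
  vls (rst (dset vs) g) xs = map Some (map (gv g) xs).
Proof.
move=> vsN; elim: xs => //= x xs IH /andP[xvs xsvs].
by rewrite vl_rst ?vsN // -[LHS]/(_ :: vls _ xs) IH.
Qed.

Lemma dom_rst D g : dom (rst D g) = D.
Proof. by apply/setP => i; rewrite inE ffunE; case: (i \in D). Qed.

Lemma restr_rst (V D : {set 'I_N}) g : V \subset D -> restr V (rst D g) = rst V g.
Proof.
move=> /subsetP VD; apply/ffunP => i; rewrite !ffunE; case: ifP => // iV.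
by rewrite VD.
Qed.

Lemma dset_cons x vs : dset (x :: vs) = dset vs :|: vset N x.
Proof.
apply/setP => i; rewrite !inE orbC; congr orb; rewrite /vset.
case: insubP => [j _ jx|]; first by rewrite inE -jx.
by rewrite inE => xN; apply/eqP => ix; move: xN; rewrite -ix ltn_ord.
Qed.

Lemma in_vset x (i : 'I_N) : (i \in vset N x) = (i == x :> nat).
Proof.
rewrite /vset; case: insubP => [j _ jx|]; first by rewrite inE -jx.
by rewrite inE => xN; apply/esym/eqP => ix; move: xN; rewrite -ix ltn_ord.
Qed.

Lemma rst_indep (V : {set 'I_N}) x : (x < N)%N -> indep x (rst (V :\: vset N x)).
Proof.
move=> xN g a; apply/ffunP => i; rewrite !ffunE inE in_vset.
case: eqP => //= ix; case: ifP => // _; rewrite gv_ups_ne //.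
- by rewrite -ltnS; apply: leq_trans xN NM.
- by rewrite -ltnS; apply: leq_trans (ltn_ord i) NM.
- exact/eqP.
Qed.

Definition push (D : {set 'I_N}) (G : T -> R) (s : asg A N) : R :=
  \sum_(g | rst D g == s) G g.

Lemma sum_push D G (P : pred (asg A N)) :
  \sum_(s | P s) push D G s = \sum_(g | P (rst D g)) G g.
Proof.
rewrite (partition_big (rst D) P) //=; apply: eq_bigr => s Ps.
by apply: eq_bigl => g; case: eqP => [->|]; rewrite ?Ps ?andbF.
Qed.

Lemma push_nn D G s : nn G -> 0 <= push D G s.
Proof. by move=> G0; apply: sumr_ge0. Qed.

Lemma push_dom D G s : push D G s != 0 -> dom s = D.
Proof.
move=> ne; apply/eqP; apply: contraNT ne => ds; rewrite /push big_pred0 // => g.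
by apply: contraNF ds => /eqP <-; rewrite dom_rst.
Qed.

Lemma push_gt0 D G s : nn G -> 0 < push D G s -> exists2 g, rst D g = s & 0 < G g.
Proof.
by move=> G0 /lt0r_neq0/eqP/(psumr_neq0P (fun g _ => G0 g)) [g /andP[/eqP rg Gg]]; exists g.
Qed.

Lemma push_gt0' D G g : nn G -> 0 < G g -> 0 < push D G (rst D g).
Proof.
move=> G0 Gg; rewrite /push (bigD1 g) //=.
by apply: ltr_pwDl => //; apply: sumr_ge0.
Qed.

(** The map sending [a] to the restriction of [ups g x a] is injective, and its image contains every
    assignment charged by [Y] that agrees with [g] off [x]. Removing [x] from [D] first also covers
    requantification of a variable already in the domain. *)
Lemma sum_rst_D1 (D : {set 'I_N}) x (g : T) (Y : asg A N -> R) : (x < N)%N ->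
  (forall s, Y s != 0 -> dom s = D :|: vset N x) ->
  \sum_(a : A) Y (rst (D :|: vset N x) (ups g x a)) =
  marg (D :\: vset N x) Y (rst (D :\: vset N x) g).
Proof.
move=> xN Yd; rewrite /marg.
have xM : (x <= M)%N by rewrite -ltnS; apply: leq_trans xN NM.
pose E := D :|: vset N x.
pose f a := rst E (ups g x a).
have finj : injective f.
  move=> a b /ffunP /(_ (Ordinal xN)).
  by rewrite !ffunE !inE in_vset eqxx orbT !gv_ups => -[].
pose B := [set f a | a in [set: A]].
rewrite [RHS](bigID (mem B)) /= [X in _ = _ + X]big1 ?addr0; last first.
  move=> s /andP[/eqP rs sB]; apply: contraNeq sB => Ys; have ds := Yd _ Ys.
  have: Ordinal xN \in dom s by rewrite ds inE in_vset eqxx orbT.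
  rewrite inE; case sx: (s (Ordinal xN)) => [a|] // _.
  apply/imsetP; exists a => //; apply/ffunP => i; rewrite !ffunE.
  have [iE|iE] := boolP (i \in E); last first.
    by move: iE; rewrite /E -ds inE negbK => /eqP.
  have [ix|ix] := eqVneq (i : nat) x.
    have -> : i = Ordinal xN by apply: val_inj.
    by rewrite sx gv_ups.
  rewrite gv_ups_ne //; last by rewrite -ltnS; apply: leq_trans (ltn_ord i) NM.
  move: iE; rewrite !inE in_vset (negbTE ix) orbF => iD.
  by move/ffunP: rs => /(_ i); rewrite !ffunE inE in_vset ix iD.
rewrite (eq_bigl (mem B)).
  rewrite big_imset /=; last by move=> a b _ _; apply: finj.
  by apply: eq_bigl => a; rewrite inE.
move=> s; rewrite andb_idl // => /imsetP[a _ ->].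
rewrite /f restr_rst; last by rewrite /E; apply/subsetP => i; rewrite !inE => /andP[_ ->].
by rewrite rst_indep.
Qed.

Lemma rst_eq_at (D : {set 'I_N}) x (s : asg A N) a : (x < N)%N ->
  dom s = D :|: vset N x -> vl s x = Some a ->
  forall g, (rst (D :|: vset N x) g == s) =
    (gv g x == a) && (rst (D :\: vset N x) g == restr (D :\: vset N x) s).
Proof.
move=> xN ds sx g; apply/eqP/andP => [rs|[/eqP gx /eqP rs]].
  split; last first.
    rewrite -rs restr_rst //; apply/subsetP => i; rewrite !inE => /andP[_ ->] //.
  move: sx; rewrite -rs /vl insubT /= ffunE inE in_vset eqxx orbT => -[->] //.
apply/ffunP => i; rewrite ffunE.
have [iE|iE] := boolP (i \in D :|: vset N x); last first.
  by move: iE; rewrite -ds inE negbK => /eqP ->.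
have [ix|ix] := eqVneq (i : nat) x.
  have ie : i = Ordinal xN by apply: val_inj.
  by move: sx; rewrite /vl insubT ie => sx; rewrite /= gx -sx.
move: iE; rewrite !inE in_vset (negbTE ix) orbF => iD.
by move/ffunP: rs => /(_ i); rewrite !ffunE inE in_vset ix iD.
Qed.

Lemma dom_vl (D : {set 'I_N}) x (s : asg A N) : (x < N)%N ->
  dom s = D :|: vset N x -> exists a, vl s x = Some a.
Proof.
move=> xN ds.
have: Ordinal xN \in dom s by rewrite ds inE in_vset eqxx orbT.
by rewrite inE /vl insubT /=; case: (s _) => // a _; exists a.
Qed.

Lemma marg_push (D V : {set 'I_N}) G t : V \subset D ->
  marg V (push D G) t = push V G t.
Proof.
move=> VD; rewrite /marg sum_push; apply: eq_bigl => g.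
by rewrite restr_rst.
Qed.

Lemma subD1 (D : {set 'I_N}) x : D :\: vset N x \subset D :|: vset N x.
Proof. by apply/subsetP => i; rewrite !inE => /andP[_ ->]. Qed.

Lemma pteam_push (D : {set 'I_N}) G c : nn G -> 0 < c ->
  \sum_g G g = 0 \/ \sum_g G g = c -> pteam D (fun s => push D G s / c).
Proof.
move=> G0 c0 tot; split.
- by move=> s; rewrite divr_ge0 ?push_nn ?ltW.
- by move=> s; rewrite mulf_eq0 negb_or => /andP[/push_dom].
- rewrite -mulr_suml sum_push; case: tot => ->; first by left; rewrite mul0r.
  by right; rewrite divff // gt_eqF.
Qed.

Lemma pushZ (D : {set 'I_N}) (G : T -> R) (F : asg A N -> R) s :
  push D (fun g => G g * F (rst D g)) s = push D G s * F s.
Proof.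
by rewrite /push mulr_suml; apply: eq_bigr => g /eqP ->.
Qed.

(** [G] represents the team [X] up to scale. The factor [c] is positive even for the empty team, so
    it can always be cancelled. *)
Definition tok (vs : seq nat) (X : asg A N -> R) (G : T -> R) (c : R) :=
  [/\ pteam (dset vs) X, nn G, 0 < c & forall s, push (dset vs) G s = c * X s].

Lemma tok_total vs X G c : tok vs X G c -> \sum_g G g = c * \sum_s X s.
Proof.
case=> _ _ _ e; rewrite mulr_sumr -(eq_bigr _ (fun s _ => e s)) sum_push //.
Qed.

Lemma tok_total' vs X G c : tok vs X G c -> \sum_g G g = 0 \/ \sum_g G g = c.
Proof.
move=> tk; rewrite (tok_total tk); case: tk => -[_ _ [|] ->] _ _ _; rewrite ?mulr0 ?mulr1; auto.
Qed.

Lemma tok_marg vs X G c x s : tok vs X G c ->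
  push (dset vs :\: vset N x) G s = c * marg (dset vs :\: vset N x) X s.
Proof.
case=> _ _ _ e; rewrite -(@marg_push (dset vs)) ?subsetDl // /marg mulr_sumr.
exact: eq_bigr.
Qed.

Lemma tok_norm vs G : nn G ->
  exists2 c, \sum_g G g = 0 \/ \sum_g G g = c & tok vs (fun s => push (dset vs) G s / c) G c.
Proof.
move=> G0; have [c c0 tot] : exists2 c, 0 < c & \sum_g G g = 0 \/ \sum_g G g = c.
  have [z|n] := eqVneq (\sum_g G g) 0; first by exists 1 => //; left.
  by exists (\sum_g G g); [rewrite lt0r n sumr_ge0 | right].
exists c => //; split=> //; first exact: pteam_push.
by move=> s; rewrite mulrCA mulfV ?mulr1 // gt_eqF.
Qed.

(** A split of the team lifts to the weight by giving each total assignment the proportion of its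
    restriction. Conversely the two parts of the weight are normalised separately, and the
    coefficient is the share of the first part in the total. *)
Lemma tok_or vs X G c p q :
  (forall X G c, tok vs X G c -> tsat rel (dset vs) p X <-> wsat rel p G) ->
  (forall X G c, tok vs X G c -> tsat rel (dset vs) q X <-> wsat rel q G) ->
  tok vs X G c -> tsat rel (dset vs) (TOr p q) X <-> wsat rel (TOr p q) G.
Proof.
move=> IHp IHq tk; have [[X0 Xd Xt] G0 c0 e] := tk; set D := dset vs in X0 Xd e *.
split=> /=.
  case=> Y [Z [al [tY tZ /andP[al0 al1] XE [sY sZ]]]].
  have [Y0 Yd _] := tY; have [Z0 Zd _] := tZ.
  have aux (B : asg A N -> R) (be : R) r : pteam D B -> 0 <= be ->
      (forall s, be * B s <= X s) -> tsat rel D r B ->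
      (forall X G c, tok vs X G c -> tsat rel D r X <-> wsat rel r G) ->
      let F := fun g => G g * (be * B (rst D g) / X (rst D g)) in nn F /\ wsat rel r F.
    move=> tB be0 leB sB IH F.
    have F0 : nn F.
      move=> g; rewrite mulr_ge0 // divr_ge0 // mulr_ge0 //; first by case: tB => h _ _; apply: h.
    split=> //.
    have [bez|ben] := eqVneq be 0.
      by apply: wsat0 => g; rewrite /F bez mul0r mul0r mulr0.
    apply: (proj1 (IH B F (c * be) _)) => //; split => //.
      by rewrite mulr_gt0 // lt0r ben.
    move=> s; rewrite (@pushZ D G (fun s => be * B s / X s)) e.
    have [Xz|Xn] := eqVneq (X s) 0; last by field.
    have : be * B s <= 0 by rewrite -Xz.
    rewrite pmulr_rle0 ?lt0r ?ben // => Bs.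
    have -> : B s = 0 by apply/eqP; rewrite eq_le Bs; case: tB => -> _ _.
    by rewrite Xz !(mulr0, mul0r).
  have al1' : 0 <= 1 - al by rewrite subr_ge0.
  have leY s : al * Y s <= X s by rewrite XE lerDl mulr_ge0.
  have leZ s : (1 - al) * Z s <= X s by rewrite XE lerDr mulr_ge0.
  have [FY0 wY] := aux Y al p tY al0 leY sY IHp.
  have [FZ0 wZ] := aux Z (1 - al) q tZ al1' leZ sZ IHq.
  eexists; eexists; split; [exact: FY0 | exact: FZ0 | | exact: wY | exact: wZ].
  move=> t /=; rewrite -mulrDr -mulrDl -XE.
  have [Xz|Xn] := eqVneq (X (rst D t)) 0; last by rewrite mulfV // mulr1.
  rewrite Xz mul0r mulr0; apply: nn_eq0 => // Gt.
  by have := push_gt0' D G0 Gt; rewrite e Xz mulr0 ltxx.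
case=> Y [Z [Y0 Z0 GE wY wZ]].
have aux (B : T -> R) r : nn B -> wsat rel r B ->
   (forall X G c, tok vs X G c -> tsat rel D r X <-> wsat rel r G) ->
   exists2 c, \sum_g B g = 0 \/ \sum_g B g = c &
     pteam D (fun s => push D B s / c) /\ tsat rel D r (fun s => push D B s / c).
  move=> B0 wB IH; have [c' tot tB] := tok_norm vs B0; exists c' => //.
  by split; [case: tB | apply: (proj2 (IH _ _ _ tB))].
have [cy ty [tY sY]] := aux Y p Y0 wY IHp.
have [cz tz [tZ sZ]] := aux Z q Z0 wZ IHq.
set my := \sum_g Y g in ty; set mz := \sum_g Z g in tz.
have my0 : 0 <= my by apply: sumr_ge0.
have mz0 : 0 <= mz by apply: sumr_ge0.
have tot : \sum_g G g = my + mz by rewrite -big_split; apply: eq_bigr.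
have pE s : push D G s = push D Y s + push D Z s by rewrite -big_split; apply: eq_bigr.
have zero (B : T -> R) : nn B -> \sum_g B g = 0 -> forall s, push D B s = 0.
  move=> B0 /eqP; rewrite psumr_eq0 // => /allP h s; rewrite /push big1 // => g _.
  by apply/eqP; apply: h; rewrite mem_index_enum.
eexists; eexists; exists (my / (my + mz)); split; [exact: tY | exact: tZ | | | by split].
  (* For the zero weight the quotient is 0 by convention, which is still an admissible
     coefficient. *)
  have [z|n] := eqVneq (my + mz) 0; first by rewrite z invr0 mulr0 lexx ler01.
  have p0 : 0 < my + mz by rewrite lt0r n addr_ge0.
  by rewrite divr_ge0 ?addr_ge0 // ler_pdivrMr // mul1r lerDl.
move=> s /=.
have cne : c != 0 by rewrite gt_eqF.
apply: (mulfI cne); rewrite -e pE.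
case: (tok_total' tk); rewrite tot => tt.
  have y0 : my = 0 by apply/eqP; move/eqP: tt; rewrite paddr_eq0 // => /andP[].
  have z0 : mz = 0 by apply/eqP; move/eqP: tt; rewrite paddr_eq0 // => /andP[].
  by rewrite (zero Y) // (zero Z) // !mul0r !(mulr0, addr0).
rewrite tt.
have -> : 1 - my / c = mz / c by have -> : mz = c - my by [rewrite -tt addrAC subrr add0r]; field.
have h (B : T -> R) c' : nn B -> \sum_g B g = 0 \/ \sum_g B g = c' ->
    c * ((\sum_g B g) / c * (push D B s / c')) = push D B s.
  move=> B0 mE; have [mz'|mn] := eqVneq (\sum_g B g) 0.
    by rewrite mz' mul0r mul0r mulr0 zero.
  case: mE => mE; first by rewrite mE eqxx in mn.
  by move: mn; rewrite mE => mn; field; rewrite mn.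
by rewrite mulrDr !h.
Qed.

Lemma tok_ex vs x X G c p : (x < N)%N ->
  (forall X G c, tok (x :: vs) X G c -> tsat rel (dset (x :: vs)) p X <-> wsat rel p G) ->
  tok vs X G c -> tsat rel (dset vs) (TEx x p) X <-> wsat rel (TEx x p) G.
Proof.
rewrite dset_cons => xN IH tk; have [[X0 Xd Xt] G0 c0 e] := tk.
have tot := tok_total' tk; rewrite /tok dset_cons in IH; set D := dset vs in X0 Xd e IH *.
have margX s := tok_marg x s tk; rewrite -/D in margX.
split=> /=.
  case=> Y [tY mY sY]; have [Y0 Yd _] := tY.
  pose m s := marg (D :\: vset N x) X s.
  (* The extra coordinates are distributed as in [G], while [x] receives the conditional
     distribution that [Y] prescribes given the other variables of the domain. *)
  pose F g := mg x G g * (Y (rst (D :|: vset N x) g) / m (rst (D :\: vset N x) g)).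
  have m0 s : 0 <= m s by apply: sumr_ge0.
  have mG g : m (rst (D :\: vset N x) g) = 0 -> mg x G g = 0.
    move=> mz; have := margX (rst (D :\: vset N x) g); rewrite -/(m _) mz mulr0 /push => /eqP.
    rewrite psumr_eq0 // => /allP h; apply: big1 => a _; apply/eqP.
    by have := h (ups g x a); rewrite mem_index_enum rst_indep // eqxx; apply.
  exists F; split.
  - by move=> g; rewrite mulr_ge0 ?mg_nn // divr_ge0.
  - move=> g; rewrite {1}/mg /F.
    under eq_bigr => a _ do rewrite mg_ups rst_indep //.
    rewrite -mulr_sumr -mulr_suml sum_rst_D1 // mY -/(m _).
    have [mz|mn] := eqVneq (m (rst (D :\: vset N x) g)) 0; last by rewrite mulfV // mulr1.
    by rewrite mG // mul0r.
  - apply: (proj1 (IH Y F c _)) => //; split=> //.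
      by move=> g; rewrite mulr_ge0 ?mg_nn // divr_ge0.
    move=> s; have [ds|ds] := eqVneq (dom s) (D :|: vset N x); last first.
      transitivity (0 : R).
        by apply/eqP; apply: contraNT ds => /push_dom/eqP.
      apply/esym/eqP; rewrite mulf_eq0; apply/orP; right; apply: contraNT ds => /Yd/eqP //.
    have [a sx] := dom_vl xN ds.
    rewrite /push.
    set rs := restr (D :\: vset N x) s.
    transitivity (\sum_(g | (gv g x == a) && (rst (D :\: vset N x) g == rs)) mg x G g * (Y s / m rs)).
      rewrite (eq_bigl _ _ (rst_eq_at xN ds sx)); apply: eq_bigr => g /andP[ga gr].
      rewrite /F (eqP gr); congr (_ * (Y _ / _)); apply/eqP.
      by rewrite (rst_eq_at xN ds sx) ga.
    rewrite -mulr_suml sum_mg_at; last by move=> g b; rewrite rst_indep.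
    rewrite -/(push _ _ _) margX -/(m _).
    have [mz|mn] := eqVneq (m rs) 0; last by field.
    rewrite mz mulr0 mul0r; apply/esym/eqP; rewrite mulf_eq0; apply/orP; right.
    have : marg (D :\: vset N x) Y rs = 0 by rewrite mY.
    move/eqP; rewrite psumr_eq0 // => /allP /(_ s); rewrite mem_index_enum => /(_ isT).
    by move/implyP; apply; rewrite eqxx.
case=> Y [Y0 mY wY].
have tY : \sum_g Y g = \sum_g G g by apply: (@sum_mg_eq _ _ A0 x xpredT).
exists (fun s => push (D :|: vset N x) Y s / c); split.
- by apply: pteam_push; rewrite ?tY.
- move=> t; rewrite {1}/marg -mulr_suml -/(marg _ _ _) marg_push ?subD1 //.
  have -> : push (D :\: vset N x) Y t = push (D :\: vset N x) G t.
    by apply: (sum_mg_eq A0 (P := fun g => rst (D :\: vset N x) g == t)) mY => g a; rewrite rst_indep.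
  by rewrite margX mulrAC mulfV ?mul1r // gt_eqF.
- apply: (proj2 (IH _ Y c _)) => //; split=> //.
    by apply: pteam_push; rewrite ?tY.
  by move=> s; rewrite mulrCA mulfV ?mulr1 // gt_eqF.
Qed.

(** Duplication commutes with restriction to the domain; this is [key]. *)
Lemma tok_all vs x X G c p : (x < N)%N ->
  (forall X G c, tok (x :: vs) X G c -> tsat rel (dset (x :: vs)) p X <-> wsat rel p G) ->
  tok vs X G c -> tsat rel (dset vs) (TAll x p) X <-> wsat rel (TAll x p) G.
Proof.
rewrite dset_cons => xN IH tk; have [[X0 Xd Xt] G0 c0 e] := tk.
have tot := tok_total' tk; rewrite /tok dset_cons in IH; set D := dset vs in X0 Xd e IH *.
have margX s := tok_marg x s tk; rewrite -/D in margX.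
have key s : push (D :|: vset N x) (dup x G) s = c * dupl D x X s.
  have [ds|ds] := eqVneq (dom s) (D :|: vset N x); last first.
    rewrite /dupl (negbTE ds) mulr0.
    by apply/eqP; apply: contraNT ds => /push_dom/eqP.
  have [a sx] := dom_vl xN ds.
  rewrite /push (eq_bigl _ _ (rst_eq_at xN ds sx)) sum_dup_at //.
    by rewrite -/(push _ _ _) margX /dupl ds eqxx mulrA.
  by move=> g b; rewrite rst_indep.
apply: (IH _ _ c); split=> //; last exact: dup_nn.
have td : \sum_g dup x G g = \sum_g G g by apply: (@sum_dup _ _ A0 x xpredT).
have -> : dupl D x X = fun s => push (D :|: vset N x) (dup x G) s / c.
  by apply: functional_extensionality => s; rewrite key mulrAC mulfV ?mul1r // gt_eqF.
by apply: pteam_push; rewrite ?td //; apply: dup_nn.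
Qed.

Lemma pmap_id_some (s : seq A) : pmap id (map Some s) = s.
Proof. by elim: s => //= a s ->. Qed.

(** The support of the team is the image of the support of the weight. *)
Lemma tok_supp vs X G c (P : asg A N -> Prop) : tok vs X G c ->
  (forall s, 0 < X s -> P s) <-> (forall g, 0 < G g -> P (rst (dset vs) g)).
Proof.
case=> _ G0 c0 e; split=> h.
  by move=> g Gg; apply: h; have := push_gt0' (dset vs) G0 Gg; rewrite e pmulr_rgt0.
move=> s Xs; have : 0 < push (dset vs) G s by rewrite e mulr_gt0.
by case/(push_gt0 G0) => g <- Gg; apply: h.
Qed.

(** [M] may exceed the variables of the formula and of its domain; this freedom supplies the spare
    coordinates used later. *)
Theorem tsat_wsat tau p vs X G c : tscope tau vs p -> (tmaxv p < N)%N ->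
  (forall x, x \in vs -> (x < N)%N) -> tok vs X G c ->
  tsat rel (dset vs) p X <-> wsat rel p G.
Proof.
elim: p vs X G c => [x y|x y|r xs|r xs|xs ys|xs y|p IHp q IHq|p IHp q IHq|x p IHp|x p IHp]
  vs X G c sc mx vsN tk.
- move: sc => /= /andP[xv yv]; rewrite (tok_supp _ tk).
  split=> h g Gg; have := h g Gg; rewrite !vl_rst ?vsN //; first by case.
  by move=> ->.
- move: sc => /= /andP[xv yv]; rewrite (tok_supp _ tk).
  split=> h g Gg; have := h g Gg; rewrite !vl_rst ?vsN //; first by move=> n e; apply: n; rewrite e.
  by move=> n [].
- move: sc => /= /and3P[_ _ xv]; rewrite (tok_supp _ tk).
  by split=> h g Gg; have := h g Gg; rewrite !vls_rst // pmap_id_some.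
- move: sc => /= /and3P[_ _ xv]; rewrite (tok_supp _ tk).
  by split=> h g Gg; have := h g Gg; rewrite !vls_rst // pmap_id_some.
- move: sc => /= /and3P[_ xv yv]; case: tk => _ _ c0 e.
  have cne : c != 0 by rewrite gt_eqF.
  have key zs a : all (mem vs) zs -> c * (\sum_(s : asg A N | vls s zs == map Some a) X s) =
     \sum_(t | map (gv t) zs == a) G t.
    move=> zv; rewrite mulr_sumr (eq_bigr _ (fun s _ => esym (e s))) sum_push.
    apply: eq_bigl => g; rewrite vls_rst // (inj_eq (inj_map _)) //.
    by move=> ? ? [].
  split=> h a sa; first by rewrite -!key // h.
  by apply: (mulfI cne); rewrite !key // h.
- move: sc => /= /andP[xv yv].
  transitivity (forall s, 0 < X s -> forall s', 0 < X s' -> vls s xs = vls s' xs -> vl s y = vl s' y).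
    by split=> h; [move=> s Xs s' | move=> s s' Xs]; apply: h.
  rewrite (tok_supp _ tk); split=> h.
    move=> t t' Gt Gt' e; have := proj1 (tok_supp _ tk) (h t Gt) t' Gt'.
    by rewrite !vls_rst // e !vl_rst ?vsN // => /(_ erefl) [].
  move=> g Gg; apply: (proj2 (tok_supp _ tk)) => g' Gg'.
  rewrite !vls_rst // !vl_rst ?vsN // => e'; congr Some; apply: h => //.
  by apply: (inj_map _ e') => ? ? [].
- move: sc mx => /= /andP[sp sq]; rewrite gtn_max => /andP[mp mq].
  by rewrite (IHp vs X G c) // (IHq vs X G c).
- move: sc mx => /= /andP[sp sq]; rewrite gtn_max => /andP[mp mq].
  by apply: tok_or tk => X' G' c' tk'; [apply: IHp tk' | apply: IHq tk'].
- move: sc mx => /= sp; rewrite gtn_max => /andP[xN mp].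
  apply: tok_ex tk => // X' G' c'; apply: IHp => // y; rewrite inE => /orP[/eqP->|/vsN] //.
- move: sc mx => /= sp; rewrite gtn_max => /andP[xN mp].
  apply: tok_all tk => // X' G' c'; apply: IHp => // y; rewrite inE => /orP[/eqP->|/vsN] //.
Qed.

End Bridge.

Lemma tscope_sub tau vs vs' p : {subset vs <= vs'} -> tscope tau vs p -> tscope tau vs' p.
Proof.
have sub_all' (vs1 vs2 xs : seq nat) : {subset vs1 <= vs2} -> all (mem vs1) xs -> all (mem vs2) xs.
  by move=> h; apply: sub_all => x; apply: h.
elim: p vs vs' => [x y|x y|r xs|r xs|xs ys|xs y|p IHp q IHq|p IHp q IHq|x p IHp|x p IHp] vs vs' h /=.
- by case/andP => /h -> /h ->.
- by case/andP => /h -> /h ->.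
- by case/and3P => -> -> /(sub_all' _ _ _ h) ->.
- by case/and3P => -> -> /(sub_all' _ _ _ h) ->.
- by case/and3P => -> /(sub_all' _ _ _ h) -> /(sub_all' _ _ _ h) ->.
- by case/andP => /(sub_all' _ _ _ h) -> /h ->.
- by case/andP => /(IHp _ _ h) -> /(IHq _ _ h) ->.
- by case/andP => /(IHp _ _ h) -> /(IHq _ _ h) ->.
- by apply: IHp => y; rewrite !inE => /orP[->//|/h ->]; rewrite orbT.
- by apply: IHp => y; rewrite !inE => /orP[->//|/h ->]; rewrite orbT.
Qed.

Lemma tscope_iota tau N x p : (x < N)%N -> tscope tau (x :: iota 0 N) p -> tscope tau (iota 0 N) p.
Proof. by move=> xN; apply: tscope_sub => y; rewrite inE => /orP[/eqP->|//]; rewrite mem_iota. Qed.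

(** * Locality, and marginals over several variables *)

Section Local.
Variables (A : finType) (rel : nat -> seq A -> bool) (M : nat).
Hypothesis A0 : (0 < #|A|)%N.
Notation T := {ffun 'I_M.+1 -> A}.

Lemma gv_ord (t : T) (i : 'I_M.+1) : gv t i = t i.
Proof. by rewrite /gv inord_val. Qed.

(** Both weights have the same image on the assignments over [vs], hence represent one and the same
    team, and satisfaction is decided by the team alone. *)
Lemma wsat_local tau vs p (G G' : T -> R) :
  tscope tau vs p -> (tmaxv p <= M)%N -> (forall x, x \in vs -> (x <= M)%N) ->
  nn G -> nn G' ->
  (forall P : pred T, (forall t t', {in vs, gv t =1 gv t'} -> P t = P t') ->
     \sum_(t | P t) G t = \sum_(t | P t) G' t) ->
  wsat rel p G -> wsat rel p G'.
Proof.
move=> sc mx vsM G0 G0' e.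
pose D := @dset M.+1 vs.
have pE s : push D G s = push D G' s.
  apply: e => t t' tt'; congr (_ == s); apply/ffunP => i; rewrite !ffunE inE.
  by case: ifP => // /tt' ->.
have [c _ tk] := @tok_norm _ M.+1 M vs G G0.
have tk' : tok vs (fun s => push D G s / c) G' c.
  by case: tk => h1 _ h2 h3; split => // s; rewrite -pE.
have NM : (M.+1 <= M.+1)%N by [].
by rewrite -(tsat_wsat rel NM A0 sc mx vsM tk) (tsat_wsat rel NM A0 sc mx vsM tk').
Qed.

Definition eqoff (vs : seq nat) (t t' : T) : bool :=
  [forall i : 'I_M.+1, ((i : nat) \in vs) || (t i == t' i)].

Lemma eqoffP vs t t' : reflect (forall x, (x <= M)%N -> x \notin vs -> gv t x = gv t' x) (eqoff vs t t').
Proof.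
apply: (iffP forallP) => h x.
  move=> xM xvs; have := h (inord x); rewrite inordK ?ltnS // (negbTE xvs) => /eqP //.
have [//|xvs /=] := boolP ((x : nat) \in vs); apply/eqP.
by rewrite -!gv_ord; apply: h => //; rewrite -ltnS.
Qed.

Lemma eqoff_sym vs t t' : eqoff vs t t' = eqoff vs t' t.
Proof. by apply/eqoffP/eqoffP => h x xM xv; rewrite h. Qed.

Lemma eqoff_trans vs t t' t'' : eqoff vs t t' -> eqoff vs t' t'' = eqoff vs t t''.
Proof.
move=> /eqoffP h; apply/eqoffP/eqoffP => h' x xM xv; first by rewrite h // h'.
by rewrite -h // h'.
Qed.

Definition msum (vs : seq nat) (F : T -> R) (t : T) : R := \sum_(t' | eqoff vs t t') F t'.

Lemma eqoff_ups vs t x a : x \in vs -> (x <= M)%N -> eqoff vs t (ups t x a).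
Proof.
move=> xv xM; apply/eqoffP => y yM yv; rewrite gv_ups_ne //.
by apply: contraNneq yv => ->.
Qed.

Lemma eqoff1 x t t' : (x <= M)%N -> eqoff [:: x] t t' = (t' == ups t x (gv t' x)).
Proof.
move=> xM; apply/idP/eqP => [/eqoffP h|->]; last by apply: eqoff_ups; rewrite ?inE.
apply/ffunP => i; rewrite ffunE; case: eqP => [->//|ix].
rewrite -!gv_ord h // -1?ltnS // inE; apply/eqP => e; apply: ix.
by apply: val_inj; rewrite /= inordK ?ltnS // -e.
Qed.

Lemma msum1 x F t : (x <= M)%N -> msum [:: x] F t = mg x F t.
Proof.
move=> xM; rewrite /msum /mg (reindex_onto (fun a => ups t x a) (fun t' => gv t' x)) /=.
  by apply: eq_bigl => a; rewrite eqoff_ups ?inE ?eqxx // gv_ups eqxx.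
by move=> t'; rewrite eqoff1 // => /eqP <-.
Qed.

(** Every class of assignments equal off [vs] contains exactly one with the default value [a0] on
    [vs]. Summing over these representatives expresses both sides through [msum]. *)
Lemma msum_sum vs Y G (P : pred T) : msum vs Y =1 msum vs G ->
  (forall t t', eqoff vs t t' -> P t = P t') ->
  \sum_(t | P t) Y t = \sum_(t | P t) G t.
Proof.
move=> e iP; have /card_gt0P[a0 _] := A0.
pose rep (t : T) : T := [ffun i : 'I_M.+1 => if (i : nat) \in vs then a0 else t i].
have repE t r : rep r = r -> (rep t == r) = eqoff vs r t.
  move=> rr; apply/eqP/eqoffP => [<- x xM xv|h].
    by rewrite /gv ffunE inordK ?ltnS // (negbTE xv).
  rewrite -rr; apply/ffunP => i; rewrite !ffunE; case: ifPn => // iv.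
  by rewrite -!gv_ord h // -ltnS.
have repr t : rep (rep t) = rep t.
  by apply/ffunP => i; rewrite /rep !ffunE; case: (_ \in vs).
have aux F : \sum_(t | P t) F t = \sum_(r | (rep r == r) && P r) msum vs F r.
  rewrite (partition_big rep (fun r => (rep r == r) && P r)) /=; last first.
    move=> t Pt; rewrite repr eqxx /= -(iP t) // eqoff_sym -repE ?repr //.
  apply: eq_bigr => r /andP[/eqP rr Pr]; apply: eq_bigl => t.
  rewrite repE //; case: (boolP (eqoff vs r t)) => [o|]; last by rewrite andbF.
  by rewrite -(iP r t) // Pr.
by rewrite !aux; apply: eq_bigr.
Qed.

Definition pushT (h : T -> T) (G : T -> R) (t : T) : R := \sum_(t' | h t' == t) G t'.

Lemma sum_pushT h G (P : pred T) : \sum_(t | P t) pushT h G t = \sum_(t | P (h t)) G t.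
Proof.
rewrite [RHS](partition_big h P) //=; apply: eq_bigr => t Pt.
by apply: eq_bigl => t'; case: eqP => [->|]; rewrite ?Pt ?andbF.
Qed.

Lemma pushT_nn h G : nn G -> nn (pushT h G).
Proof. by move=> G0 t; apply: sumr_ge0. Qed.

Lemma pushT_eq0 h G t : (forall t', h t' != t) -> pushT h G t = 0.
Proof. by move=> n; apply: big1 => t' e; move: (n t'); rewrite e. Qed.

Lemma pushT_gt0 h G t : nn G -> 0 < pushT h G t -> exists2 t', h t' = t & 0 < G t'.
Proof.
by move=> G0 /lt0r_neq0/eqP/(psumr_neq0P (fun t _ => G0 t)) [t' /andP[/eqP ht Gt]]; exists t'.
Qed.

Lemma msum_pushT vs h G t : (forall t', eqoff vs t' (h t')) ->
  msum vs (pushT h G) t = msum vs G t.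
Proof.
move=> hh; rewrite /msum (sum_pushT h G (eqoff vs t)); apply: eq_bigl => t'.
by rewrite ![eqoff vs t _]eqoff_sym (eqoff_trans t (hh t')).
Qed.

Lemma sum_ge_term (G : T -> R) t : nn G -> G t <= \sum_t' G t'.
Proof. by move=> G0; rewrite (bigD1 t) //= lerDl; apply: sumr_ge0. Qed.

End Local.

Section FoVal.
Variables (A : finType) (rel : nat -> seq A -> bool).

Fixpoint foval (s : nat -> A) (p : eform) : bool :=
  match p with
  | EEq x y => s x == s y
  | ENeq x y => s x != s y
  | ERel r xs => rel r (map s xs)
  | ENRel r xs => ~~ rel r (map s xs)
  | EAnd p q => foval s p && foval s q
  | EOr p q => foval s p || foval s q
  | _ => false
  end.

Definition fo (p : eform) := qfree p && ~~ has_num p.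

Lemma fo_esat n (f : n.-tuple A -> R) fe s p : fo p -> esat rel f fe s p <-> foval s p.
Proof.
rewrite /fo; elim: p fe s => [x y|x y|e i j|e i j|r xs|r xs|p IHp q IHq|p IHp q IHq|x p IHp|x p IHp|g k p IHp] fe s //=;
  rewrite ?andbF //.
- by move=> _; split=> [->|/eqP].
- by move=> _; split=> [/eqP|/eqP].
- rewrite negb_or => /andP[/andP[p1 p2] /andP[p3 p4]].
  by rewrite IHp ?p1 // IHq ?p2 //; split=> [[-> ->]|/andP].
- rewrite negb_or => /andP[/andP[p1 p2] /andP[p3 p4]].
  by rewrite IHp ?p1 // IHq ?p2 //; split=> /orP.
Qed.

End FoVal.

(** The syntax has no constant for truth; the empty conjunction is [EEq 0 0], so well-formedness
    asks for variable 0 in scope. *)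
Fixpoint econj (ps : seq eform) : eform :=
  if ps is p :: ps' then EAnd p (econj ps') else EEq 0 0.

Definition eeqs (xs ys : seq nat) : eform :=
  econj [seq EEq p.1 p.2 | p <- zip xs ys].

Lemma foval_eeqs (A : finType) rel (s : nat -> A) xs ys : size xs = size ys ->
  foval rel s (eeqs xs ys) = (map s xs == map s ys).
Proof.
rewrite /eeqs; elim: xs ys => [|x xs IH] [|y ys] //=; first by rewrite eqxx.
by move=> [e]; rewrite IH // eqseq_cons.
Qed.

Lemma fo_eeqs xs ys : fo (eeqs xs ys).
Proof. by rewrite /eeqs /fo; elim: (zip xs ys) => //= p ps /andP[-> ->]. Qed.

(** * From teams to ESO *)

(** An intermediate language between teams and ESO; the numbers index a family of weights. Only
    [CSum] is expressed differently in the two target logics. [CEqv] and [CZero] become disjunctions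
    with a first-order side, so only [CDep] leads out of the almost conjunctive formulae when [SUM]
    is available. *)
Inductive constr :=
| CSum of seq nat & nat & nat
| CEqv of eform & nat & nat
| CZero of eform & nat
| CInd of nat & nat
| CDep of seq nat & nat & nat.

Section Compile.
Variables (N M : nat).

Fixpoint compile (p : tform) (j c : nat) : seq constr * nat :=
  match p with
  | TEq x y => ([:: CZero (EEq x y) j], c)
  | TNeq x y => ([:: CZero (ENeq x y) j], c)
  | TRel r xs => ([:: CZero (ERel r xs) j], c)
  | TNRel r xs => ([:: CZero (ENRel r xs) j], c)
  | TApprox xs ys =>
      let a := iota N (size xs) in
      ([:: CSum a j c; CZero (eeqs a xs) c; CSum a j c.+1; CZero (eeqs a ys) c.+1;
          CSum [seq x <- iota 0 M.+1 | x \notin a] c c.+1], c.+2)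
  | TDep xs y => ([:: CDep xs y j], c)
  | TAnd p q =>
      let r1 := compile p j c in
      let r2 := compile q j r1.2 in (r1.1 ++ r2.1, r2.2)
  | TOr p q =>
      let r1 := compile p c.+1 c.+3 in
      let r2 := compile q c.+2 r1.2 in
      ([:: CSum [:: N; N.+1] j c;
          CEqv (ENeq N N.+1) c.+1 c; CZero (EEq N N.+1) c.+1;
          CEqv (EEq N N.+1) c.+2 c; CZero (ENeq N N.+1) c.+2] ++ (r1.1 ++ r2.1), r2.2)
  | TEx x p => let r := compile p c c.+1 in (CSum [:: x] j c :: r.1, r.2)
  | TAll x p => let r := compile p c c.+1 in (CSum [:: x] j c :: CInd x c :: r.1, r.2)
  end.

Definition cidx (m : nat) (k : constr) : bool :=
  match k with
  | CSum _ i j | CEqv _ i j => (i < m)%N && (j < m)%N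
  | CZero _ i | CInd _ i | CDep _ _ i => (i < m)%N
  end.

Lemma cidx_le m m' k : (m <= m')%N -> cidx m k -> cidx m' k.
Proof. by move=> mm'; case: k => /=; nlia. Qed.

Lemma compile_idx p j c : (j < c)%N -> (c <= (compile p j c).2)%N /\ all (cidx (compile p j c).2) (compile p j c).1.
Proof.
elim: p j c => [x y|x y|r xs|r xs|xs ys|xs y|p IHp q IHq|p IHp q IHq|x p IHp|x p IHp] j c jc /=;
  try by split; nlia.
- have [h1 h2] := IHp j c jc; have [h3 h4] := IHq j (compile p j c).2 (leq_trans jc h1).
  split; first nlia; rewrite all_cat h4 andbT; apply: sub_all h2 => k; exact: cidx_le.
- have [h1 h2] := IHp c.+1 c.+3 (ltnW (ltnSn _)).
  have [|h3 h4] := IHq c.+2 (compile p c.+1 c.+3).2; first nlia.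
  split; first nlia; rewrite all_cat h4 andbT.
  have -> : all (cidx (compile q c.+2 (compile p c.+1 c.+3).2).2) (compile p c.+1 c.+3).1.
    by apply: sub_all h2 => k; apply: cidx_le.
  nlia.
- have [h1 h2] := IHp c c.+1 (ltnSn _); split; first nlia; rewrite h2 andbT; nlia.
- have [h1 h2] := IHp c c.+1 (ltnSn _); split; first nlia; rewrite h2 andbT; nlia.
Qed.

Variables (A : finType) (rel : nat -> seq A -> bool).
Hypothesis A1 : (1 < #|A|)%N.
Notation T := {ffun 'I_M.+1 -> A}.
Let A0 : (0 < #|A|)%N := ltnW A1.

Definition csat (F : nat -> T -> R) (k : constr) : Prop :=
  match k with
  | CSum vs i j => forall t, msum vs (F i) t = msum vs (F j) t
  | CEqv phi i j => forall t, foval rel (gv t) phi \/ F i t = F j t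
  | CZero phi i => forall t, foval rel (gv t) phi \/ F i t = 0
  | CInd x i => forall t a, F i (ups t x a) = F i t
  | CDep xs y i => forall t t', F i t = 0 \/ F i t' = 0 \/
      map (gv t) xs <> map (gv t') xs \/ gv t y = gv t' y
  end.

Fixpoint csats (F : nat -> T -> R) (ks : seq constr) : Prop :=
  if ks is k :: ks' then csat F k /\ csats F ks' else True.

Lemma csats_cat F ks ks' : csats F (ks ++ ks') <-> csats F ks /\ csats F ks'.
Proof. by elim: ks => [|k ks IH] /=; [tauto | rewrite IH; tauto]. Qed.

Lemma csat_ext m F F' k : cidx m k -> (forall i, (i < m)%N -> F i = F' i) ->
  csat F k -> csat F' k.
Proof.
move=> h e; case: k h => [vs i j|phi i j|phi i|x i|xs y i] /=.
- by case/andP=> hi hj k t; rewrite -!e.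
- by case/andP=> hi hj k t; rewrite -!e.
- by move=> hi k t; rewrite -!e.
- by move=> hi k t a; rewrite -!e.
- by move=> hi k t t'; rewrite -!e.
Qed.

Lemma csats_ext m F F' ks : all (cidx m) ks -> (forall i, (i < m)%N -> F i = F' i) ->
  csats F ks -> csats F' ks.
Proof.
elim: ks => //= k ks IH /andP[h1 h2] e [c1 c2]; split; last exact: IH.
exact: csat_ext e c1.
Qed.

Hypotheses (NM : (N.+1 <= M)%N).

Fixpoint wid (p : tform) : nat :=
  match p with
  | TApprox xs _ => size xs
  | TAnd p q | TOr p q => maxn (wid p) (wid q)
  | TEx _ p | TAll _ p => wid p
  | _ => 0
  end.

Lemma map_iota_notin (t t' : T) a xs : eqoff a t t' -> all (fun x => (x <= M)%N && (x \notin a)) xs ->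
  map (gv t) xs = map (gv t') xs.
Proof.
move=> /eqoffP h /allP xa; apply/eq_in_map => x /xa /andP[xM xn]; exact: h.
Qed.

Lemma supp_sum (F : T -> R) (P Q : pred T) :
  (forall t, F t != 0 -> P t = Q t) -> \sum_(t | P t) F t = \sum_(t | Q t) F t.
Proof.
move=> h; rewrite big_mkcond [RHS]big_mkcond; apply: eq_bigr => t _.
by have [->|n] := eqVneq (F t) 0; [case: ifP; case: ifP | rewrite h].
Qed.

Let others (a : seq nat) := [seq x <- iota 0 M.+1 | x \notin a].

Lemma eqoff_others a (t t' : T) : all (fun x => (x <= M)%N) a ->
  eqoff (others a) t t' = (map (gv t) a == map (gv t') a).
Proof.
move=> aM; apply/eqoffP/eqP => [h|h].
  apply/eq_in_map => x xa; apply: h; first exact: (allP aM).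
  by rewrite mem_filter xa.
move=> x xM; rewrite mem_filter mem_iota /= add0n ltnS xM andbT negbK => xa.
by move/eq_in_map: h; apply.
Qed.

Lemma in_lt_all xs : all (mem (iota 0 N)) xs -> (forall k, all (fun x => (x <= M)%N && (x \notin iota N k)) xs).
Proof.
move=> h k; apply: sub_all h => x; rewrite inE /= !mem_iota /=; nlia.
Qed.

(** The constraints turn the weights of the family into the witnesses that the team semantics asks
    for. *)
Theorem compile_sound tau p j c F : tscope tau (iota 0 N) p -> (tmaxv p < N)%N ->
  (N + wid p <= M.+1)%N -> (forall i, nn (F i)) ->
  csats F (compile p j c).1 -> wsat rel p (F j).
Proof.
move=> + + + F0.
elim: p j c => [x y|x y|r xs|r xs|xs ys|xs y|p IHp q IHq|p IHp q IHq|x p IHp|x p IHp] j c sc mx wd /=.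
- by case=> h _ t; have [/eqP->|->] := h t; rewrite ?ltxx.
- by case=> h _ t; have [/eqP|->] := h t; rewrite ?ltxx.
- by case=> h _ t; have [|->] := h t; rewrite ?ltxx.
- by case=> h _ t; have [|->] := h t; rewrite ?ltxx.
- case/and3P: sc => /eqP sxy xsN ysN; set a := iota N _.
  have aM : all (fun x => (x <= M)%N) a.
    by apply/allP => x; rewrite mem_iota; move: wd => /=; nlia.
  move=> [s1 [z1 [s2 [z2 [s3 _]]]]] al sal.
  (* On the support of [F i] the spare coordinates repeat [zs], so an event about [zs] becomes an
     event about [a]; and [F j] and [F i] differ only in how mass is spread over the spare
     coordinates. *)
  have half i zs : all (mem (iota 0 N)) zs -> size zs = size xs ->
      (forall t, msum a (F j) t = msum a (F i) t) ->
      (forall t, foval rel (gv t) (eeqs a zs) \/ F i t = 0) ->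
      \sum_(t | map (gv t) zs == al) F j t = \sum_(t | map (gv t) a == al) F i t.
    move=> zN sz s z; rewrite (@msum_sum _ _ A0 a (F j) (F i)) //; last first.
      by move=> t t' o; rewrite (map_iota_notin o) // in_lt_all.
    apply: supp_sum => t Ft; have [|Fz] := z t; last by rewrite Fz eqxx in Ft.
    by rewrite foval_eeqs ?size_iota // => /eqP ->.
  rewrite (half c xs) // (half c.+1 ys) //.
  apply: (msum_sum A0 s3) => t t'; rewrite eqoff_others // => /eqP -> //.
- case=> h _ t t' Gt Gt' e; have := h t t'.
  case=> [z|[z|[ne|//]]]; last by [].
    by rewrite z ltxx in Gt.
  by rewrite z ltxx in Gt'.
- case/andP: sc => sp sq; move: mx wd => /=; rewrite gtn_max => /andP[mp mq] wd.
  rewrite csats_cat => -[h1 h2]; split; first by apply: IHp h1 => //; nlia.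
  by apply: IHq h2 => //; nlia.
- case/andP: (sc) => sp sq; move: (mx) (wd) => /=; rewrite gtn_max => /andP[mp mq] wd'.
  rewrite csats_cat => -[s [e1 [z1 [e2 [z2 [h1 h2]]]]]].
  have W1 : wsat rel p (F c.+1) by apply: IHp h1 => //; nlia.
  have W2 : wsat rel q (F c.+2) by apply: IHq h2 => //; nlia.
  (* The marked weight [F c] is split by comparing coordinates [N] and [N.+1]; locality then carries
     the disjunction back to [F j]. *)
  have : wsat rel (TOr p q) (F c).
    exists (F c.+1), (F c.+2); split=> // t.
    have [E|E] := eqVneq (gv t N) (gv t N.+1).
      case: (e1 t) (z2 t) => [/=|->]; first by rewrite E eqxx.
      by case=> [/=|->]; rewrite ?E ?eqxx // addr0.
    case: (e2 t) (z1 t) => [/=|->]; first by rewrite (negbTE E).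
    by case=> [/=|->]; rewrite ?(negbTE E) // add0r.
  apply: (wsat_local A0 sc) => //; first by move: mx NM => /=; nlia.
    by move=> x; rewrite mem_iota; move: NM; nlia.
  move=> P iP; apply: (msum_sum A0 (vs := [:: N; N.+1])) => [t|t t' o]; first by rewrite s.
  apply: iP => x; rewrite mem_iota => xN; move/eqoffP: o; apply; first by move: NM; nlia.
  by rewrite !inE; nlia.
- move: mx => /=; rewrite gtn_max => /andP[xN mp] [s h].
  have xM : (x <= M)%N by move: NM; nlia.
  exists (F c); split=> //; first by move=> t; rewrite -!msum1.
  by apply: IHp h => //; apply: tscope_iota sc.
- move: mx => /=; rewrite gtn_max => /andP[xN mp] [s [i h]].
  have xM : (x <= M)%N by move: NM; nlia.
  (* A weight that ignores [x] is determined by its marginal away from [x]. *)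
  have -> : dup x (F j) = F c.
    apply: functional_extensionality => t; rewrite /dup -msum1 // s msum1 // /mg.
    rewrite (eq_bigr (fun _ => F c t)); last by move=> a _; rewrite i.
    by rewrite big_const iter_addr addr0 -[F c t *+ _]mulr_natr mulfK // cardA_neq0.
  by apply: IHp h => //; apply: tscope_iota sc.
Qed.

Definition ovr (F : nat -> T -> R) (i : nat) (Y : T -> R) : nat -> T -> R :=
  fun k => if k == i then Y else F k.

Lemma ovr_eq F i Y : ovr F i Y i = Y.
Proof. by rewrite /ovr eqxx. Qed.

Lemma ovr_ne F i Y k : k != i -> ovr F i Y k = F k.
Proof. by rewrite /ovr => /negbTE ->. Qed.

Lemma ovr2E F c W Y (F1 := ovr (ovr F c W) c.+1 Y) :
  [/\ forall i, (i < c)%N -> F1 i = F i, F1 c = W & F1 c.+1 = Y].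
Proof.
rewrite /F1; split=> [i ic||]; last exact: ovr_eq.
  by rewrite !ovr_ne //; nlia.
by rewrite ovr_ne ?ovr_eq //; nlia.
Qed.

Lemma ovr3E F c W Y Z (F1 := ovr (ovr (ovr F c W) c.+1 Y) c.+2 Z) :
  [/\ forall i, (i < c)%N -> F1 i = F i, F1 c = W, F1 c.+1 = Y & F1 c.+2 = Z].
Proof.
rewrite /F1; have [h1 h2 h3] := ovr2E F c W Y.
by split=> [i ic|||]; rewrite ?ovr_eq // ovr_ne ?h2 ?h3 ?h1 //; nlia.
Qed.

(** Total mass at most 1 makes each single value an admissible value of a quantified function. All
    witnesses preserve mass or divide it, so the bound persists. *)
Definition bnd (F : nat -> T -> R) := forall i, nn (F i) /\ \sum_t F i t <= 1.

Lemma bnd_ovr F i Y : bnd F -> nn Y -> \sum_t Y t <= 1 -> bnd (ovr F i Y).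
Proof.
by move=> bF Y0 Y1 k; rewrite /ovr; case: ifP.
Qed.

Lemma mg_total x (Y G : T -> R) : mg x Y =1 mg x G -> \sum_t Y t = \sum_t G t.
Proof. exact: (@sum_mg_eq _ _ A0 x xpredT). Qed.

Definition setvs (vs : seq nat) (g : T -> nat -> A) (t : T) : T :=
  [ffun i : 'I_M.+1 => if (i : nat) \in vs then g t i else t i].

Lemma setvs_in vs g t x : (x <= M)%N -> x \in vs -> gv (setvs vs g t) x = g t x.
Proof. by move=> xM xv; rewrite /gv ffunE inordK ?ltnS // xv. Qed.

Lemma eqoff_setvs vs g t : eqoff vs t (setvs vs g t).
Proof.
by apply/eqoffP => x xM xv; rewrite /gv ffunE inordK ?ltnS // (negbTE xv).
Qed.

(** The witnesses of the team semantics are entered at indices from [c] on. Indices below [c] are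
    left alone, so constraints compiled earlier survive. *)
Theorem compile_complete tau p j c F : tscope tau (iota 0 N) p -> (tmaxv p < N)%N ->
  (N + wid p <= M.+1)%N -> (j < c)%N -> bnd F -> \sum_t F j t <= 1 ->
  wsat rel p (F j) ->
  exists F', [/\ (forall i, (i < c)%N -> F' i = F i), bnd F' & csats F' (compile p j c).1].
Proof.
have F0 K i : bnd K -> nn (K i) by move=> b; case: (b i).
have lit K phi i : bnd K -> (forall t, 0 < K i t -> foval rel (gv t) phi) ->
    csats K [:: CZero phi i].
  move=> bF h; split=> // t; have h0 := F0 K i bF t.
  by have [->|n] := eqVneq (K i t) 0; [right | left; apply: h; rewrite lt0r n].
elim: p j c F => [x y|x y|r xs|r xs|xs ys|xs y|p IHp q IHq|p IHp q IHq|x p IHp|x p IHp] j c F sc mx wd jc bF tot W.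
- by exists F; split=> //; apply: lit => // t /W /= /eqP.
- by exists F; split=> //; apply: lit => // t /W /= /eqP.
- by exists F; split=> //; apply: lit => // t /W.
- by exists F; split=> //; apply: lit => // t /W.
- case/and3P: sc => /eqP sxy xsN ysN; rewrite [compile _ _ _]/=; set a := iota N _.
  have aM : all (fun x => (x <= M)%N) a.
    by apply/allP => x; rewrite mem_iota; move: wd => /=; nlia.
  (* [th zs] overwrites the spare coordinates by the values of [zs]; [H zs] is the weight moved
     along it. *)
  pose th zs (t : T) : T := setvs a (fun t x => nth (gv t 0) (map (gv t) zs) (x - N)) t.
  pose H zs := pushT (th zs) (F j).
  pose F' := ovr (ovr F c (H xs)) c.+1 (H ys).
  have tHa zs t : size zs = size xs -> all (mem (iota 0 N)) zs ->
      map (gv (th zs t)) a = map (gv t) zs /\ map (gv (th zs t)) zs = map (gv t) zs.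
    move=> sz zN; split; last first.
      by apply/esym/(map_iota_notin (a := a)); rewrite ?eqoff_setvs // in_lt_all.
    apply: (@eq_from_nth _ (gv t 0)); rewrite !size_map ?size_iota // => i si.
    rewrite (nth_map 0%N) ?size_iota // nth_iota // setvs_in ?mem_iota; last by nlia.
      by rewrite addKn.
    by move: wd => /=; nlia.
  have H0 zs : nn (H zs) by apply: pushT_nn; apply: F0.
  have Ht zs : \sum_t H zs t <= 1 by rewrite (@sum_pushT _ _ (th zs) (F j) xpredT).
  have [F'j Fc Fc1] := ovr2E F c (H xs) (H ys); rewrite -/F' in F'j Fc Fc1.
  exists F'; split=> //.
  - by apply: bnd_ovr => //; apply: bnd_ovr.
  have Fj := F'j j jc.
  rewrite /= Fj Fc Fc1.
  have s zs t : msum a (F j) t = msum a (H zs) t.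
    by rewrite msum_pushT // => t'; rewrite eqoff_setvs.
  have z zs t : size zs = size xs -> all (mem (iota 0 N)) zs ->
      foval rel (gv t) (eeqs a zs) \/ H zs t = 0.
    move=> sz zN; have [e|ne] := boolP (foval rel (gv t) (eeqs a zs)); first by left.
    right; apply: pushT_eq0 => t'; apply: contraNneq ne => <-.
    by rewrite foval_eeqs ?size_iota //; have [-> ->] := tHa zs t' sz zN.
  do !split=> //; try by move=> t; apply: z.
  move=> t; rewrite /msum !(@sum_pushT _ _ _ (F j) (eqoff _ t)).
  have k zs : size zs = size xs -> all (mem (iota 0 N)) zs ->
     \sum_(t0 | eqoff (others a) t (th zs t0)) F j t0 = \sum_(t0 | map (gv t0) zs == map (gv t) a) F j t0.
    move=> sz zN; apply: eq_bigl => t0; rewrite eqoff_others //.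
    by have [-> _] := tHa zs t0 sz zN; rewrite eq_sym.
  by rewrite -!/(others a) !k //; apply: W; rewrite size_map size_iota.
- exists F; split=> //; split=> // t t'.
  have h0 := F0 F j bF t; have h0' := F0 F j bF t'.
  have [->|n] := eqVneq (F j t) 0; first by left.
  have [->|n'] := eqVneq (F j t') 0; first by right; left.
  right; right; have [e|ne] := eqVneq (map (gv t) xs) (map (gv t') xs); last by left; apply/eqP.
  by right; apply: W => //; rewrite lt0r ?n ?n'.
- case/andP: sc => sp sq; move: mx wd W => /=; rewrite gtn_max => /andP[mp mq] wd [wp wq].
  have [|F1 [e1 b1 c1]] := IHp j c F sp mp _ jc bF tot wp; first nlia.
  have [l1 l2] := compile_idx p jc.
  have [|||F2 [e2 b2 c2]] := IHq j (compile p j c).2 F1 sq mq _ (leq_trans jc l1) b1.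
  - nlia.
  - by rewrite e1.
  - by rewrite e1.
  exists F2; split=> //; first by move=> i ic; rewrite e2 ?e1 //; nlia.
  rewrite csats_cat; split=> //.
  by apply: csats_ext l2 _ c1 => i il; rewrite e2.
- case/andP: (sc) => sp sq; move: (mx) (wd) W => /=; rewrite gtn_max => /andP[mp mq] wd' [Y [Z [Y0 Z0 YZ WY WZ]]].
  have /card_gt1P[a0 [a1 [_ _ a01]]] := A1.
  (* The coordinates [N] and [N.+1] receive [a0] and [b]: the first part of the disjunction is
     marked with [b = a0], the second with [b = a1], which differs from [a0]. *)
  pose th b (t : T) := setvs [:: N; N.+1] (fun _ x => if x == N then a0 else b) t.
  have thN b t : gv (th b t) N = a0.
    by rewrite setvs_in ?inE ?eqxx //; move: NM; nlia.
  have thN1 b t : gv (th b t) N.+1 = b.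
    by rewrite setvs_in ?inE ?eqxx ?orbT // ifF //; apply/eqP; nlia.
  have tho b t : eqoff [:: N; N.+1] t (th b t) by apply: eqoff_setvs.
  clearbody th.
  have [Y' Y'E] : exists Y', Y' = pushT (th a0) Y by eexists.
  have [Z' Z'E] : exists Z', Z' = pushT (th a1) Z by eexists.
  have Y'0 : nn Y' by rewrite Y'E; apply: pushT_nn.
  have Z'0 : nn Z' by rewrite Z'E; apply: pushT_nn.
  have [W WE] : exists W, forall t : T, W t = Y' t + Z' t by exists (fun t => Y' t + Z' t).
  have YZt : \sum_t Y t + \sum_t Z t <= 1.
    by rewrite -big_split /=; under eq_bigr => t _ do rewrite -YZ.
  have Yt : \sum_t Y' t = \sum_t Y t by rewrite Y'E (@sum_pushT _ _ _ Y xpredT).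
  have Zt : \sum_t Z' t = \sum_t Z t by rewrite Z'E (@sum_pushT _ _ _ Z xpredT).
  have Ys : 0 <= \sum_t Y t by apply: sumr_ge0.
  have Zs : 0 <= \sum_t Z t by apply: sumr_ge0.
  have Wt : \sum_t W t <= 1 by under eq_bigr => t _ do rewrite WE; rewrite big_split /= Yt Zt.
  pose F1 := ovr (ovr (ovr F c W) c.+1 Y') c.+2 Z'.
  have [F1j F1c F1c1 F1c2] := ovr3E F c W Y' Z'; rewrite -/F1 in F1j F1c F1c1 F1c2.
  have b1 : bnd F1.
    apply: bnd_ovr => //; last by rewrite Zt; lra.
    apply: bnd_ovr => //; last by rewrite Yt; lra.
    by apply: bnd_ovr => // t; rewrite WE; apply: addr_ge0.
  clearbody F1.
  have loc r B b : tscope tau (iota 0 N) r -> (tmaxv r < N)%N -> nn B -> wsat rel r B -> wsat rel r (pushT (th b) B).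
    move=> sr mr B0; apply: (wsat_local A0 sr) => //; first by move: NM; nlia.
      by move=> x; rewrite mem_iota; move: NM; nlia.
      exact: pushT_nn.
    move=> P iP; rewrite sum_pushT; apply: eq_bigl => t; apply: iP => x; rewrite mem_iota => xN.
    by apply: (eqoffP _ _ _ (tho b t)); [move: NM; nlia | rewrite !inE; nlia].
  have [|||F2 [e2 b2 c2]] := IHp c.+1 c.+3 F1 sp mp _ (ltnW (ltnSn _)) b1.
  - nlia.
  - by rewrite F1c1 Yt; lra.
  - by rewrite F1c1 Y'E; apply: loc.
  have [l1 l2] := compile_idx p (ltnW (ltnSn c.+2) : c.+1 < c.+3)%N.
  have [||||F3 [e3 b3 c3]] := IHq c.+2 (compile p c.+1 c.+3).2 F2 sq mq _ _ b2.
  - nlia.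
  - nlia.
  - by rewrite e2 ?F1c2 ?Zt //; lra.
  - by rewrite e2 ?F1c2 ?Z'E //; apply: loc.
  have e31 i : (i < c.+3)%N -> F3 i = F1 i by move=> ic; rewrite e3 ?e2 //; nlia.
  exists F3; split=> //; first by move=> i ic; rewrite e31 ?F1j //; nlia.
  have cc : csats F3 ((compile p c.+1 c.+3).1 ++ (compile q c.+2 (compile p c.+1 c.+3).2).1).
    by rewrite csats_cat; split=> //; apply: csats_ext l2 _ c2 => i il; rewrite e3.
  have YN t : gv t N != gv t N.+1 -> Y' t = 0.
    by move=> ne; rewrite Y'E; apply: pushT_eq0 => t'; apply: contraNneq ne => <-; rewrite thN thN1.
  have ZN t : gv t N = gv t N.+1 -> Z' t = 0.
    by move=> ne; rewrite Z'E; apply: pushT_eq0 => t'; apply: contraNneq a01 => e; move: ne; rewrite -e thN thN1 => ->.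
  rewrite /= !e31 ?F1c ?F1c1 ?F1c2 ?F1j //; [|nlia..].
  split; [|split; [|split; [|split; [|split; last exact: cc]]]] => t.
  + have -> : msum [:: N; N.+1] W t = msum [:: N; N.+1] Y' t + msum [:: N; N.+1] Z' t.
      by rewrite /msum -big_split; apply: eq_bigr.
    rewrite Y'E Z'E !msum_pushT //.
    by rewrite -big_split; apply: eq_bigr => t' _; apply: YZ.
  + have [E|E] := eqVneq (gv t N) (gv t N.+1); last by left.
    by right; rewrite WE ZN // addr0.
  + by have [E|E] := eqVneq (gv t N) (gv t N.+1); [left | right; apply: YN].
  + have [E|E] := eqVneq (gv t N) (gv t N.+1); first by left.
    by right; rewrite WE YN // add0r.
  + by have [E|E] := eqVneq (gv t N) (gv t N.+1); [right; apply: ZN | left].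
- move: mx W => /=; rewrite gtn_max => /andP[xN mp] [Y [Y0 YG WY]].
  have xM : (x <= M)%N by move: NM; nlia.
  have Yt : \sum_t Y t <= 1 by rewrite (mg_total YG).
  have b1 : bnd (ovr F c Y) by apply: bnd_ovr.
  have [|||F2 [e2 b2 c2]] := IHp c c.+1 (ovr F c Y) _ mp wd (ltnSn c) b1; rewrite ?ovr_eq //.
    exact: tscope_iota sc.
  exists F2; split=> //; first by move=> i ic; rewrite e2 ?ovr_ne //; nlia.
  split=> //= t; rewrite !msum1 // (e2 j (ltnW jc)) (e2 c (ltnSn c)) ovr_eq ovr_ne ?YG //; nlia.
- move: mx W => /=; rewrite gtn_max => /andP[xN mp] WY.
  have xM : (x <= M)%N by move: NM; nlia.
  have Y0 : nn (dup x (F j)) by apply: dup_nn; apply: F0.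
  have YG : mg x (dup x (F j)) =1 mg x (F j) by apply: mg_dup.
  have Yt : \sum_t dup x (F j) t <= 1 by rewrite (mg_total YG).
  have b1 : bnd (ovr F c (dup x (F j))) by apply: bnd_ovr.
  have [|||F2 [e2 b2 c2]] := IHp c c.+1 (ovr F c (dup x (F j))) _ mp wd (ltnSn c) b1; rewrite ?ovr_eq //.
    exact: tscope_iota sc.
  exists F2; split=> //; first by move=> i ic; rewrite e2 ?ovr_ne //; nlia.
  split=> [|/=] .
    move=> /= t; rewrite !msum1 // (e2 j (ltnW jc)) (e2 c (ltnSn c)) ovr_eq ovr_ne ?YG //; nlia.
  split=> // t a; rewrite !e2 // ovr_eq; exact: dup_indep.
Qed.

End Compile.

Lemma all_iota xs k : all (mem (iota 0 k)) xs = all (fun x => (x < k)%N) xs.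
Proof. by apply: eq_all => x; rewrite -[LHS]/(x \in iota 0 k) mem_iota. Qed.

(** * Quantifier blocks in ESO *)

Definition eall (xs : seq nat) (p : eform) : eform := foldr EAll p xs.
Definition eexs (xs : seq nat) (p : eform) : eform := foldr EEx p xs.
Definition efex (js : seq nat) (k : nat) (p : eform) : eform := foldr (fun j => EFEx j k) p js.
Definition eneqs (xs ys : seq nat) : eform :=
  foldr EOr (ENeq 0 0) [seq ENeq p.1 p.2 | p <- zip xs ys].

Section ESOLemmas.
Variables (A : finType) (rel : nat -> seq A -> bool) (n : nat) (f : n.-tuple A -> R).

Lemma esat_eall fe s xs p :
  esat rel f fe s (eall xs p) <->
  (forall s', (forall v, v \notin xs -> s' v = s v) -> esat rel f fe s' p).
Proof.
elim: xs s => [|x xs IH] s /=.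
  split=> [h s' e|]; last by apply.
  by have -> : s' = s by apply: functional_extensionality => v; apply: e.
split=> [h s' e|h a].
  apply: (proj1 (IH _) (h (s' x))) => v vxs; rewrite /upd; case: eqP => [->//|/eqP vx].
  by apply: e; rewrite inE negb_or vx.
apply/IH => s' e; apply: h => v; rewrite inE negb_or => /andP[vx vxs].
by rewrite e // /upd (negbTE vx).
Qed.

Lemma esat_eexs fe s xs p :
  esat rel f fe s (eexs xs p) <->
  (exists s', (forall v, v \notin xs -> s' v = s v) /\ esat rel f fe s' p).
Proof.
elim: xs s => [|x xs IH] s /=.
  split=> [h|[s' [e h]]]; first by exists s.
  by have <- : s' = s by apply: functional_extensionality => v; apply: e.
split=> [[a /IH [s' [e h]]]|[s' [e h]]].
  exists s'; split=> // v; rewrite inE negb_or => /andP[vx vxs].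
  by rewrite e // /upd (negbTE vx).
exists (s' x); apply/IH; exists s'; split=> // v vxs; rewrite /upd; case: eqP => [->//|/eqP vx].
by apply: e; rewrite inE negb_or vx.
Qed.

Definition isfun (k : nat) (g : seq A -> R) :=
  exists h : k.-tuple A -> R, (forall t, 0 <= h t <= 1) /\ g = fext h.

Lemma esat_efex fe s js k p :
  esat rel f fe s (efex js k p) <->
  (exists fe', [/\ (forall j, j \in js -> isfun k (fe' j)), (forall j, j \notin js -> fe' j = fe j)
     & esat rel f fe' s p]).
Proof.
elim: js fe => [|j js IH] fe /=.
  split=> [h|[fe' [_ e h]]]; first by exists fe.
  by have <- : fe' = fe by apply: functional_extensionality => v; apply: e.
split=> [[h [hb /IH [fe' [b e sat]]]]|[fe' [b e sat]]].
  exists fe'; split=> // i; rewrite inE.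
    have [/b//|ijs] := boolP (i \in js); rewrite orbF => /eqP ij.
    by rewrite e // ij eqxx; exists h.
  by rewrite negb_or => /andP[ij ijs]; rewrite e // (negbTE ij).
have [h [hb hE]] : isfun k (fe' j) by apply: b; rewrite inE eqxx.
exists h; split=> //; apply/IH; exists fe'; split=> // [i ijs|i ijs].
  by apply: b; rewrite inE ijs orbT.
by case: eqP => [->//|/eqP ij]; apply: e; rewrite inE negb_or ij.
Qed.

Lemma foval_eneqs (s : nat -> A) xs ys : size xs = size ys ->
  foval rel s (eneqs xs ys) = (map s xs != map s ys).
Proof.
rewrite /eneqs; elim: xs ys => [|x xs IH] [|y ys] //=; first by rewrite !eqxx.
by move=> [e]; rewrite IH // eqseq_cons negb_and.
Qed.

Lemma foval_scope tau m fs vs (s s' : nat -> A) p : ewf tau m fs vs p ->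
  {in vs, s =1 s'} -> foval rel s p = foval rel s' p.
Proof.
move=> + e.
have em xs : all (mem vs) xs -> map s xs = map s' xs.
  by move=> /allP h; apply/eq_in_map => x /h; apply: e.
elim: p => //= [x y|x y|r xs|r xs|p IHp q IHq|p IHp q IHq].
- by case/andP=> *; rewrite !e.
- by case/andP=> *; rewrite !e.
- by case/and3P=> *; rewrite em.
- by case/and3P=> *; rewrite em.
- by case/andP=> *; rewrite IHp ?IHq.
- by case/andP=> *; rewrite IHp ?IHq.
Qed.

End ESOLemmas.

Lemma fo_eneqs xs ys : fo (eneqs xs ys).
Proof. by rewrite /eneqs /fo; elim: (zip xs ys) => //= p ps /andP[-> ->]. Qed.

Lemma fo_ewf tau m fs fs' vs vs' p : fo p -> {subset vs <= vs'} ->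
  ewf tau m fs vs p -> ewf tau m fs' vs' p.
Proof.
move=> + h.
have hs xs : all (mem vs) xs -> all (mem vs') xs by apply: sub_all.
rewrite /fo; elim: p => //= [x y|x y|r xs|r xs|p IHp q IHq|p IHp q IHq].
- by move=> _ /andP[/h -> /h ->].
- by move=> _ /andP[/h -> /h ->].
- by move=> _ /and3P[-> -> /hs ->].
- by move=> _ /and3P[-> -> /hs ->].
- by rewrite negb_or => /andP[/andP[p1 p2] /andP[p3 p4]] /andP[h1 h2]; rewrite IHp ?IHq ?p1 ?p2.
- by rewrite negb_or => /andP[/andP[p1 p2] /andP[p3 p4]] /andP[h1 h2]; rewrite IHp ?IHq ?p1 ?p2.
Qed.

Lemma ewf_eeqs tau m fs vs xs ys : 0%N \in vs -> all (mem vs) xs -> all (mem vs) ys ->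
  ewf tau m fs vs (eeqs xs ys).
Proof.
move=> v0; rewrite /eeqs; elim: xs ys => [|x xs IH] [|y ys] //=; rewrite ?v0 //.
by move=> /andP[-> hx] /andP[-> hy]; apply: IH.
Qed.

Lemma ewf_eneqs tau m fs vs xs ys : 0%N \in vs -> all (mem vs) xs -> all (mem vs) ys ->
  ewf tau m fs vs (eneqs xs ys).
Proof.
move=> v0; rewrite /eneqs; elim: xs ys => [|x xs IH] [|y ys] //=; rewrite ?v0 //.
by move=> /andP[-> hx] /andP[-> hy]; apply: IH.
Qed.

Lemma ewf_eall tau m fs vs xs p : ewf tau m fs (rev xs ++ vs) p -> ewf tau m fs vs (eall xs p).
Proof. by elim: xs vs => //= x xs IH vs; rewrite rev_cons cat_rcons => /IH. Qed.

Lemma ewf_eexs tau m fs vs xs p : ewf tau m fs (rev xs ++ vs) p -> ewf tau m fs vs (eexs xs p).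
Proof. by elim: xs vs => //= x xs IH vs; rewrite rev_cons cat_rcons => /IH. Qed.

Lemma ewf_efex tau m fs vs js k p :
  ewf tau m ([seq (j, k) | j <- rev js] ++ fs) vs p -> ewf tau m fs vs (efex js k p).
Proof.
by elim: js fs => //= j js IH fs; rewrite rev_cons map_rcons cat_rcons => /IH.
Qed.

Lemma flook_map js k j fs : j \in js -> flook ([seq (i, k) | i <- js] ++ fs) j = Some k.
Proof.
by elim: js => //= i js IH; rewrite inE eq_sym; case: eqP => //= _ /IH.
Qed.

(** * The weight of the input distribution *)

Section Initial.
Variables (A : finType) (M n : nat) (e : A) (f : n.-tuple A -> R).
Hypothesis nM : (n <= M.+1)%N.
Notation T := {ffun 'I_M.+1 -> A}.

(** The default of [nth] fills every coordinate from [n] on with [e]. Any filling represents the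
    same team; this one can be defined by equalities with a single parameter. *)
Definition emb (u : n.-tuple A) : T := [ffun i : 'I_M.+1 => nth e u i].
Definition initG (t : T) : R := \sum_(u | emb u == t) f u.

Lemma gv_emb u i : (i <= M)%N -> gv (emb u) i = nth e u i.
Proof. by move=> iM; rewrite /gv ffunE inordK. Qed.

Lemma map_emb u : map (gv (emb u)) (iota 0 n) = u.
Proof.
apply: (@eq_from_nth _ e); rewrite size_map size_iota ?size_tuple // => i iN.
by rewrite (nth_map 0%N) ?size_iota // nth_iota // add0n gv_emb //; lia.
Qed.

Lemma sum_initG (P : pred T) : \sum_(t | P t) initG t = \sum_(u | P (emb u)) f u.
Proof.
rewrite [RHS](partition_big emb P) //=; apply: eq_bigr => t Pt.
by apply: eq_bigl => u; case: eqP => [->|]; rewrite ?Pt ?andbF.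
Qed.

(** A pointwise description by cases, in the form that an ESO formula can state. *)
Lemma initGE t : initG t = if all (fun i => gv t i == e) (iota n (M.+1 - n))
  then fext f (map (gv t) (iota 0 n)) else 0.
Proof.
have embE u : emb u == t -> all (fun i => gv t i == e) (iota n (M.+1 - n)).
  move=> /eqP <-; apply/allP => i; rewrite mem_iota => iM; rewrite gv_emb; last by lia.
  by rewrite nth_default // size_tuple; lia.
case: ifP => [h|/negbT h]; last by rewrite /initG big1 // => u /embE; rewrite (negbTE h).
pose u0 : n.-tuple A := [tuple of map_tuple (gv t) (iota_tuple n 0)].
have u0E : map (gv t) (iota 0 n) = u0 by [].
rewrite u0E /fext valK /initG (big_pred1 u0) // => u /=.
apply/eqP/eqP => [ut|->]; first by apply: val_inj; rewrite /= -ut map_emb.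
apply/ffunP => i; rewrite ffunE -gv_ord.
have [iN|iN] := ltnP i n.
  by rewrite -u0E (nth_map 0%N) ?size_iota // nth_iota.
rewrite nth_default ?size_tuple //; apply/esym/eqP; apply: (allP h).
by rewrite mem_iota iN subnKC // ltn_ord.
Qed.

Hypothesis df : is_distr f.

Lemma initG_nn : nn initG.
Proof. by move=> t; apply: sumr_ge0 => u _; case: df. Qed.

Lemma initG_total : \sum_t initG t = 1.
Proof. by rewrite (sum_initG xpredT); case: df. Qed.

Lemma tok_initG N : (n <= N)%N -> (N <= M.+1)%N ->
  tok (iota 0 n) (team_of f : asg A N -> R) initG 1.
Proof.
move=> nN NM.
have pE s : push (dset N (iota 0 n)) initG s = team_of f s.
  rewrite /push (sum_initG (fun t => rst (dset N (iota 0 n)) t == s)) /team_of.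
  apply: eq_bigl => u.
  have dE : dset N (iota 0 n) = [set i : 'I_N | (i < n)%N].
    by apply/setP => i; rewrite !inE mem_iota.
  apply/eqP/andP => [<-|[/eqP ds /forallP h]].
    split; first by rewrite dom_rst dE.
    apply/forallP => i.
    rewrite vl_rst ?mem_iota //=; last exact: leq_trans (ltn_ord i) nN.
    by rewrite gv_emb ?(tnth_nth e) //; have := ltn_ord i; lia.
  apply/ffunP => i; rewrite ffunE inE mem_iota /= add0n.
  case: ifPn => iN; last first.
    have : i \notin dom s by rewrite ds inE.
    by rewrite inE negbK => /eqP ->.
  have := h (Ordinal iN); rewrite /vl /= (_ : insub (i : nat) = Some i); last exact: valK.
  by move=> /eqP ->; rewrite gv_emb ?(tnth_nth e) //; lia.
have -> : team_of f = (fun s => push (dset N (iota 0 n)) initG s / 1).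
  by apply: functional_extensionality => s; rewrite pE divr1.
split=> //; [|exact: initG_nn|by move=> s; rewrite divr1 mul1r].
by apply: pteam_push; rewrite ?initG_total //; [exact: initG_nn | right].
Qed.

End Initial.

Arguments initG {A} M {n} e f t.

(** * Constraints as ESO formulae *)

Section Emit.
Variables (M m : nat) (sume : seq nat -> nat -> nat -> eform).
Notation K := M.+1.

(* Individual variables: 0..M hold the assignment, K the parameter which serves as
   a constant, K+1 a fresh value, and K+2.. a second assignment. *)
Definition args := iota 0 K.+1.
Definition app (i : nat) := NVar i args.
Definition args2 := map (addn K.+2) (iota 0 K) ++ [:: K].
Definition app2 (i : nat) := NVar i args2.
Definition nvars := (K.+2 + K)%N.

(** [sume] is left abstract because the two target logics differ only there. Independence of [x] is
    stated by replacing the argument [x] by the fresh variable [K.+1], which is universally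
    quantified outside. *)
Definition emit (k : constr) : eform :=
  match k with
  | CSum vs i j => sume vs i j
  | CEqv phi i j => EOr phi (ECmp CEq (app i) (app j))
  | CZero phi i => EOr phi (ECmp CEq (app i) (NConst 0))
  | CInd x i => ECmp CEq (NVar i [seq if y == x then K.+1 else y | y <- args]) (app i)
  | CDep xs y i =>
      EOr (ECmp CEq (app i) (NConst 0)) (EOr (ECmp CEq (app2 i) (NConst 0))
        (EOr (eneqs xs (map (addn K.+2) xs)) (EEq y (K.+2 + y))))
  end.

Definition kok tau n (k : constr) : bool :=
  match k with
  | CSum vs _ _ => uniq vs && all (mem (iota 0 K)) vs
  | CEqv phi _ _ | CZero phi _ => fo phi && ewf tau n [::] (iota 0 K) phi
  | CInd x _ => x \in iota 0 K
  | CDep xs y _ => all (mem (iota 0 K)) xs && (y \in iota 0 K)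
  end.

Section Sem.
Variables (A : finType) (rel : nat -> seq A -> bool) (n : nat) (f : n.-tuple A -> R).
Notation T := {ffun 'I_M.+1 -> A}.

Definition tof (s : nat -> A) : T := [ffun i : 'I_M.+1 => s i].
(** A quantified function has arity [K.+1] and codes a family of weights, one for each value [e] of
    its last argument. *)
Definition Ffe (fe : nat -> seq A -> R) (e : A) (i : nat) (t : T) : R :=
  fe i (map (gv t) (iota 0 K) ++ [:: e]).

Lemma gv_tof s x : (x <= M)%N -> gv (tof s) x = s x.
Proof. by move=> xM; rewrite /gv ffunE inordK. Qed.

Lemma map_gv_tof s xs : all (mem (iota 0 K)) xs -> map (gv (tof s)) xs = map s xs.
Proof.
move=> /allP h; apply/eq_in_map => x /h; rewrite inE mem_iota /= add0n => xM.
by rewrite gv_tof.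
Qed.

Lemma map_args (B : Type) (s : nat -> B) : map s args = map s (iota 0 K) ++ [:: s K].
Proof. by rewrite /args -addn1 iotaD map_cat. Qed.

Lemma val_app (fe : nat -> seq A -> R) s i : fe i (map s args) = Ffe fe (s K) i (tof s).
Proof.
rewrite /Ffe map_gv_tof; last by apply/allP.
by rewrite -map_args.
Qed.

Lemma map_updl (s : nat -> A) vs a : uniq vs -> size a = size vs -> map (updl s vs a) vs = a.
Proof.
move=> u sa; apply: (@eq_from_nth _ (s 0%N)); first by rewrite size_map.
rewrite size_map => i iv; rewrite (nth_map 0%N) // /updl mem_nth // index_uniq //.
by apply: set_nth_default; rewrite sa.
Qed.

Lemma tof_updl s vs (a : (size vs).-tuple A) : uniq vs -> all (mem (iota 0 K)) vs ->
  eqoff vs (tof s) (tof (updl s vs a)) /\ map (gv (tof (updl s vs a))) vs = a.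
Proof.
move=> u /allP h; split.
  by apply/eqoffP => x xM xv; rewrite !gv_tof // /updl (negbTE xv).
by rewrite map_gv_tof ?map_updl ?size_tuple //; apply/allP.
Qed.

Lemma msum_tuple (F : T -> R) s vs : uniq vs -> all (mem (iota 0 K)) vs ->
  \sum_(a : (size vs).-tuple A) F (tof (updl s vs a)) = msum vs F (tof s).
Proof.
move=> u h; rewrite /msum.
pose back (t : T) : (size vs).-tuple A := [tuple of map_tuple (gv t) (in_tuple vs)].
rewrite (reindex_onto (fun a : (size vs).-tuple A => tof (updl s vs a)) back) /=.
  apply: eq_bigl => a; have [h1 h2] := tof_updl s a u h; rewrite h1 /=.
  by apply/esym/eqP/val_inj.
move=> t /eqoffP o; have [/eqoffP h1 h2] := tof_updl s (back t) u h.
apply/ffunP => i; rewrite -!gv_ord; have iM : (i <= M)%N by rewrite -ltnS.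
have [iv|iv] := boolP ((i : nat) \in vs); last by rewrite -h1 // o.
by move: h2 => /= /eq_in_map; apply.
Qed.

(** An instance of the universal block that realises freely chosen [t], [e], [a] and [t'] in the
    fixed layout of the variables. *)
Definition mks (t : T) (e a : A) (t' : T) (s : nat -> A) (v : nat) : A :=
  if (v < K)%N then gv t v else if v == K then e else if v == K.+1 then a
  else if (v < nvars)%N then gv t' (v - K.+2) else s v.

Lemma tof_mks t e a t' s : tof (mks t e a t' s) = t.
Proof.
by apply/ffunP => i; rewrite ffunE /mks ltn_ord gv_ord.
Qed.

Hypothesis sume_sound : forall fe s vs i j, (i < m)%N -> (j < m)%N -> uniq vs -> all (mem (iota 0 K)) vs ->
  esat rel f fe s (sume vs i j) ->
  msum vs (Ffe fe (s K) i) (tof s) = msum vs (Ffe fe (s K) j) (tof s).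

Lemma val_ind (fe : nat -> seq A -> R) s x i : x \in iota 0 K ->
  fe i (map s [seq if y == x then K.+1 else y | y <- args]) =
  Ffe fe (s K) i (ups (tof s) x (s K.+1)).
Proof.
rewrite mem_iota add0n => xK; transitivity (fe i (map (fun y => s (if y == x then K.+1 else y)) args)).
  by rewrite -map_comp.
rewrite map_args; congr (fe _ (_ ++ _)).
  apply/eq_in_map => y; rewrite mem_iota add0n => yK.
  by case: eqP => [->|/eqP yx]; rewrite ?gv_ups // gv_ups_ne // gv_tof.
by rewrite ifF //; apply/eqP; lia.
Qed.

Lemma val_app2 (fe : nat -> seq A -> R) s i :
  fe i (map s args2) = Ffe fe (s K) i (tof (fun x => s (K.+2 + x)%N)).
Proof.
rewrite /Ffe map_gv_tof; last by apply/allP.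
by rewrite map_cat -map_comp.
Qed.

Lemma emit_sound tau fe e s0 k : kok tau n k -> cidx m k ->
  (forall s, (forall v, (nvars <= v)%N -> s v = s0 v) -> s K = e -> esat rel f fe s (emit k)) ->
  csat rel (Ffe fe e) k.
Proof.
move=> ok ix h.
have {}h t a t' : esat rel f fe (mks t e a t' s0) (emit k).
  apply: h; last by rewrite /mks ltnn eqxx.
  by move=> v; rewrite /mks /nvars => vn; rewrite !ifF //; apply/negbTE; lia.
have sK t a t' : mks t e a t' s0 K = e by rewrite /mks ltnn eqxx.
have sK1 t a t' : mks t e a t' s0 K.+1 = a.
  have k1 : (K.+1 < K)%N = false by lia.
  have k2 : (K.+1 == K) = false by lia.
  by rewrite /mks k1 k2 eqxx.
have fE phi t a t' : ewf tau n [::] (iota 0 K) phi ->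
    foval rel (mks t e a t' s0) phi = foval rel (gv t) phi.
  move=> w; apply: (foval_scope rel w) => x; rewrite mem_iota /= add0n => xK.
  by rewrite /mks xK.
case: k ok ix h => [vs i j|phi i j|phi i|x i|xs y i] /=.
- move=> /andP[u v] /andP[im jm] h t; have := sume_sound im jm u v (h t e t).
  by rewrite sK tof_mks.
- move=> /andP[fp wp] _ h t; have [|] := h t e t.
    by move/(fo_esat _ _ _ _ fp); rewrite fE //; left.
  by rewrite !val_app sK tof_mks; right.
- move=> /andP[fp wp] _ h t; have [|] := h t e t.
    by move/(fo_esat _ _ _ _ fp); rewrite fE //; left.
  by rewrite !val_app sK tof_mks; right.
- move=> xK _ h t a; have := h t a t.
  by rewrite val_ind // val_app sK sK1 tof_mks.
- move=> /andP[xsK yK] _ h t t'.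
  have t'E : tof (fun x => mks t e e t' s0 (K.+2 + x)%N) = t'.
    apply/ffunP => i'; rewrite ffunE /mks -[RHS]gv_ord; have iK := ltn_ord i'.
    have k1 : (K.+2 + i' < K)%N = false by lia.
    have k2 : (K.+2 + i' == K)%N = false by lia.
    have k3 : (K.+2 + i' == K.+1)%N = false by lia.
    have k4 : (K.+2 + i' < nvars)%N by rewrite ltn_add2l.
    by rewrite k1 k2 k3 k4 addKn.
  have := h t e t'.
  rewrite !val_app val_app2 sK tof_mks t'E.
  have shE x : x \in iota 0 K -> mks t e e t' s0 (K.+2 + x)%N = gv t' x.
    rewrite mem_iota add0n /= => xK; rewrite -[in RHS]t'E gv_tof //.
  have tE x : x \in iota 0 K -> mks t e e t' s0 x = gv t x.
    by rewrite mem_iota add0n /= => xK; rewrite /mks xK.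
  case=> [->|[->|[|]]]; [by left | by right; left | | ].
    move/(fo_esat _ _ _ _ (fo_eneqs _ _)); rewrite foval_eneqs ?size_map // => /eqP ne.
    right; right; left => e'; apply: ne; rewrite -map_comp.
    transitivity (map (gv t) xs); first by apply/eq_in_map => x /(allP xsK) /tE.
    by rewrite e'; apply/esym/eq_in_map => x /(allP xsK) /shE.
  by rewrite /= shE // tE //; right; right; right.
Qed.

Hypothesis sume_complete : forall fe s vs i j, (i < m)%N -> (j < m)%N -> uniq vs -> all (mem (iota 0 K)) vs ->
  nn (Ffe fe (s K) i) -> nn (Ffe fe (s K) j) ->
  \sum_t Ffe fe (s K) i t <= 1 -> \sum_t Ffe fe (s K) j t <= 1 ->
  msum vs (Ffe fe (s K) i) (tof s) = msum vs (Ffe fe (s K) j) (tof s) ->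
  esat rel f fe s (sume vs i j).

Lemma emit_complete tau fe s k : kok tau n k -> cidx m k ->
  bnd (Ffe fe (s K)) -> csat rel (Ffe fe (s K)) k -> esat rel f fe s (emit k).
Proof.
move=> ok ix b.
have fE phi : ewf tau n [::] (iota 0 K) phi ->
    foval rel (gv (tof s)) phi -> foval rel s phi.
  move=> w; rewrite (foval_scope rel (s' := s) w) // => x.
  by rewrite mem_iota /= add0n => xK; rewrite gv_tof.
case: k ok ix => [vs i j|phi i j|phi i|x i|xs y i] /=.
- move=> /andP[u v] /andP[im jm] h; have [b1 b2] := b i; have [b3 b4] := b j.
  exact: sume_complete.
- move=> /andP[fp wp] _ h; have [/(fE _ wp) h'|h'] := h (tof s).
    by left; apply/(fo_esat _ _ _ _ fp).
  by right; rewrite !val_app.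
- move=> /andP[fp wp] _ h; have [/(fE _ wp) h'|h'] := h (tof s).
    by left; apply/(fo_esat _ _ _ _ fp).
  by right; rewrite !val_app.
- by move=> xK _ h; rewrite val_ind // val_app h.
- move=> /andP[xsK yK] _ /(_ (tof s) (tof (fun x => s (K.+2 + x)%N))).
  rewrite !val_app val_app2.
  have tE x : x \in iota 0 K -> gv (tof (fun x => s (K.+2 + x)%N)) x = s (K.+2 + x)%N.
    by rewrite mem_iota add0n /= => xK; rewrite gv_tof.
  case=> [->|[->|[ne|]]]; [by left | by right; left | | ].
    right; right; left; apply/(fo_esat _ _ _ _ (fo_eneqs _ _)).
    rewrite foval_eneqs ?size_map //; apply/eqP => e; apply: ne.
    rewrite !map_gv_tof // e -map_comp //.
  rewrite tE // gv_tof; first by right; right; right.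
  by have : y \in iota 0 K := yK; rewrite mem_iota.
Qed.

Lemma emits_sound tau fe e s0 ks : all (kok tau n) ks -> all (cidx m) ks ->
  (forall s, (forall v, (nvars <= v)%N -> s v = s0 v) -> s K = e ->
     esat rel f fe s (econj (map emit ks))) ->
  csats rel (Ffe fe e) ks.
Proof.
elim: ks => //= k ks IH /andP[k1 k2] /andP[i1 i2] h; split.
  by apply: (emit_sound k1 i1) => s e1 e2; case: (h s e1 e2).
by apply: IH => // s e1 e2; case: (h s e1 e2).
Qed.

Lemma emits_complete tau fe s ks : all (kok tau n) ks -> all (cidx m) ks ->
  bnd (Ffe fe (s K)) -> csats rel (Ffe fe (s K)) ks -> esat rel f fe s (econj (map emit ks)).
Proof.
move=> + + b; elim: ks => //= k ks IH /andP[k1 k2] /andP[i1 i2] [h1 h2]; split.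
  exact: (emit_complete k1 i1 b h1).
exact: IH.
Qed.

End Sem.

Lemma ewf_emit tau n fs vs k : kok tau n k -> cidx m k ->
  (forall j, (j < m)%N -> flook fs j = Some K.+1) ->
  (forall v, (v < nvars)%N -> v \in vs) ->
  (forall us i j, (i < m)%N -> (j < m)%N -> uniq us -> all (mem (iota 0 K)) us ->
     ewf tau n fs vs (sume us i j)) ->
  ewf tau n fs vs (emit k).
Proof.
move=> ok ix hf hv hs.
have nv : (K.+1 < nvars)%N by rewrite /nvars; lia.
have iK x : x \in iota 0 K -> x \in vs.
  by rewrite mem_iota => xK; apply: hv; rewrite /nvars; lia.
have aK xs : all (mem (iota 0 K)) xs -> all (mem vs) xs by apply: sub_all.
have sK xs : all (mem (iota 0 K)) xs -> all (mem vs) (map (addn K.+2) xs).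
  move=> /allP h; apply/allP => _ /mapP[x /h xK ->]; apply: hv; rewrite ltn_add2l.
  by move: xK; rewrite inE mem_iota.
have aargs : all (mem vs) args.
  by apply/allP => x; rewrite mem_iota => xK; apply: hv; rewrite /nvars; lia.
have wapp i : (i < m)%N -> ntwf n fs vs (app i).
  by move=> im; rewrite /app /ntwf hf // size_iota eqxx.
case: k ok ix => [us i j|phi i j|phi i|x i|xs y i].
- by move=> /andP[u v] /andP[im jm]; apply: hs.
- move=> /andP[fp wp] /andP[im jm]; apply/andP; split; first exact: fo_ewf wp.
  by apply/andP; split; apply: wapp.
- move=> /andP[fp wp] im; apply/andP; split; first exact: fo_ewf wp.
  by apply/andP; split; first exact: wapp.
- move=> xK im; apply/andP; split; last exact: wapp.
  rewrite /ntwf hf // size_map size_iota eqxx; apply/allP => _ /mapP[y yK ->].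
  case: eqP => _; first exact: hv.
  exact: (allP aargs).
- move=> /andP[xsK yK] im.
  have w2 : ntwf n fs vs (app2 i).
    rewrite /app2 /args2 /ntwf hf // size_cat size_map size_iota addn1 eqxx all_cat sK; last by apply/allP.
    by rewrite /= hv // (ltn_trans _ nv).
  apply/andP; split; first by apply/andP; split; first exact: wapp.
  apply/andP; split; first by apply/andP; split.
  apply/andP; split; first by apply: ewf_eneqs; [exact: hv | exact: aK | exact: sK].
  apply/andP; split; first exact: iK.
  by apply: hv; rewrite ltn_add2l; move: yK; rewrite mem_iota.
Qed.

End Emit.

Arguments Ffe M {A} fe e i t.

Section Classes.
Variables (oadd omul osum : bool).
Notation efin := (ef_in oadd omul osum onlyEq C01).

Lemma fo_class p : fo p -> [/\ loose p, efin p, almost_conj p & qfree p].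
Proof.
rewrite /fo; elim: p => //= p IHp q IHq; rewrite negb_or => /andP[/andP[p1 p2] /andP[p3 p4]].
  have [|a1 a2 a3 a4] := IHp; first by rewrite p1 p3.
  have [|b1 b2 b3 b4] := IHq; first by rewrite p2 p4.
  by rewrite a1 a3 a4 b1 b3 b4.
have [|a1 a2 a3 a4] := IHp; first by rewrite p1 p3.
have [|b1 b2 b3 b4] := IHq; first by rewrite p2 p4.
by rewrite a1 a3 a4 b1 b3 b4 p3.
Qed.

End Classes.

Lemma compile_kok tau n N M p j c : tscope tau (iota 0 N) p -> (tmaxv p < N)%N ->
  (N + wid p <= M.+1)%N -> (N.+1 <= M)%N ->
  all (kok M tau n) (compile N M p j c).1.
Proof.
move=> + + + NM.
have inK x : x \in iota 0 N -> x \in iota 0 M.+1 by rewrite !mem_iota; lia.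
have allK xs : all (mem (iota 0 N)) xs -> all (mem (iota 0 M.+1)) xs by apply: sub_all.
have NK : N \in iota 0 M.+1 by rewrite mem_iota; lia.
have N1K : N.+1 \in iota 0 M.+1 by rewrite mem_iota; lia.
have NN : N.+1 != N by lia.
have kz0 phi i : fo phi -> ewf tau n [::] (iota 0 M.+1) phi -> all (kok M tau n) [:: CZero phi i].
  by move=> h1 h2; apply/andP; split=> //; apply/andP.
elim: p j c => [x y|x y|r xs|r xs|xs ys|xs y|p IHp q IHq|p IHp q IHq|x p IHp|x p IHp] j c.
- by move=> /andP[/inK x1 /inK y1] _ _; apply: kz0 => //; apply/andP.
- by move=> /andP[/inK x1 /inK y1] _ _; apply: kz0 => //; apply/andP.
- by move=> /and3P[r1 s1 /allK a1] _ _; apply: kz0 => //; apply/and3P.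
- by move=> /and3P[r1 s1 /allK a1] _ _; apply: kz0 => //; apply/and3P.
- move=> /and3P[/eqP sxy /allK a1 /allK a2] _ wd.
  set a := iota N (size xs).
  have aa : all (mem (iota 0 M.+1)) a.
    by rewrite all_iota; apply/allP => x; rewrite mem_iota; move: wd => /=; lia.
  have ka : kok M tau n (CSum a j c) by apply/andP; split; [exact: iota_uniq | exact: aa].
  have kz zs i : all (mem (iota 0 M.+1)) zs -> kok M tau n (CZero (eeqs a zs) i).
    by move=> az; apply/andP; split; [exact: fo_eeqs | exact: ewf_eeqs].
  apply/and5P; split; [exact: ka | exact: kz | exact: ka | exact: kz | ].
  rewrite andbT; apply/andP; split; first by rewrite filter_uniq // iota_uniq.
  by apply/allP => x; rewrite mem_filter => /andP[].
- by move=> /andP[/allK a1 /inK y1] _ _; apply/andP; split=> //; apply/andP; split.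
- move=> /andP[sp sq]; rewrite /= gtn_max => /andP[mp mq] wd.
  by rewrite all_cat IHp ?IHq //; lia.
- move=> /andP[sp sq]; rewrite [tmaxv _]/= [wid _]/= gtn_max => /andP[mp mq] wd.
  have kp i d : all (kok M tau n) (compile N M p i d).1 by apply: IHp => //; lia.
  have kq i d : all (kok M tau n) (compile N M q i d).1 by apply: IHq => //; lia.
  have kk : all (kok M tau n) ((compile N M p c.+1 c.+3).1 ++
      (compile N M q c.+2 (compile N M p c.+1 c.+3).2).1) by rewrite all_cat kp kq.
  apply/and5P; split; last first.
    apply/andP; split; last exact: kk.
    by apply/andP; split=> //; apply/andP.
  - by apply/andP; split=> //; apply/andP.
  - by apply/andP; split=> //; apply/andP.
  - by apply/andP; split=> //; apply/andP.
  - apply/andP; split; first by rewrite /= inE eq_sym NN.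
    by apply/and3P; split.
- move=> sc; rewrite [tmaxv _]/= gtn_max => /andP[xN mp] wd.
  have xK : x \in iota 0 M.+1 by rewrite mem_iota; lia.
  apply/andP; split; last by apply: IHp => //; apply: tscope_iota sc.
  by apply/and3P; split.
- move=> sc; rewrite [tmaxv _]/= gtn_max => /andP[xN mp] wd.
  have xK : x \in iota 0 M.+1 by rewrite mem_iota; lia.
  apply/and3P; split; last by apply: IHp => //; apply: tscope_iota sc.
    by apply/and3P; split.
  exact: xK.
Qed.

Lemma tsat_struct_wsat tau n p M (A : finType) rel (f : n.-tuple A -> R) e :
  tscope tau (iota 0 n) p -> (tbound n p <= M.+1)%N -> (0 < #|A|)%N ->
  is_distr f -> tsat_struct rel f p <-> wsat rel p (initG M e f).
Proof.
move=> sc NM A0 df; rewrite /tsat_struct.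
have nN : (n <= tbound n p)%N by apply: leq_maxl.
have pN : (tmaxv p < tbound n p)%N by apply: leq_maxr.
have -> : [set i : 'I_(tbound n p) | (i < n)%N] = dset (tbound n p) (iota 0 n).
  by apply/setP => i; rewrite !inE mem_iota.
apply: (tsat_wsat rel NM A0 sc pN _ (tok_initG e (leq_trans nN NM) df nN NM)).
by move=> x; rewrite mem_iota; lia.
Qed.

(** * The ESO sentence of a team formula *)

Section TeamToESO.
Variable sume : nat -> nat -> seq nat -> nat -> nat -> eform.
Variables (tau : vocab) (n : nat) (p : tform).
Hypothesis sc : tscope tau (iota 0 n) p.

Let N := tbound n p.
(** The [maxn 1] guarantees the two coordinates [N] and [N.+1] that mark disjunctions; [wid p]
    covers the tuples copied for marginal identities. *)
Let M := (N + maxn 1 (wid p))%N.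
Notation K := M.+1.
Let cs := (compile N M p 0 1).1.
Let m := (compile N M p 0 1).2.

Definition tail := iota n (K - n).
Definition tailK := nseq (K - n) K.

(** Together with [ini1] a definition by cases of the initial weight. Each clause has a first-order
    disjunct and so remains almost conjunctive. *)
Definition ini0 := EOr (eneqs tail tailK) (ECmp CEq (app M 0) (NSym (iota 0 n))).
Definition ini1 := EOr (eeqs tail tailK) (ECmp CEq (app M 0) (NConst 0)).
Definition mat := EAnd ini0 (EAnd ini1 (econj (map (emit M (sume m M)) cs))).
Definition eso_of := efex (iota 0 m) K.+1 (eall (iota 0 (nvars M)) mat).

Let nN : (n <= N)%N. Proof. exact: leq_maxl. Qed.
Let pN : (tmaxv p < N)%N. Proof. exact: leq_maxr. Qed.
Let NM : (N.+1 <= M)%N. Proof. by rewrite /M; lia. Qed.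
Let wM : (N + wid p <= M.+1)%N. Proof. by rewrite /M; lia. Qed.
Let NK : (N <= K)%N. Proof. by move: NM; lia. Qed.
Let nK : (n <= K)%N. Proof. exact: leq_trans nN NK. Qed.
Let sc' : tscope tau (iota 0 N) p.
Proof. by apply: tscope_sub sc => x; rewrite !mem_iota; move: nN; lia. Qed.
Let m_gt0 : (0 < m)%N. Proof. by have [] := compile_idx N M p (ltnSn 0). Qed.
Let cs_idx : all (cidx m) cs. Proof. by have [] := compile_idx N M p (ltnSn 0). Qed.
Lemma eso_of_kok : all (kok M tau n) cs. Proof. exact: compile_kok. Qed.

Hypothesis sume_sound : forall (A : finType) rel (f : n.-tuple A -> R) fe s vs i j,
  (1 < #|A|)%N ->
  (i < m)%N -> (j < m)%N -> uniq vs -> all (mem (iota 0 K)) vs ->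
  esat rel f fe s (sume m M vs i j) ->
  msum vs (Ffe M fe (s K) i) (tof M s) = msum vs (Ffe M fe (s K) j) (tof M s).

Hypothesis sume_complete : forall (A : finType) rel (f : n.-tuple A -> R) fe s vs i j,
  (1 < #|A|)%N ->
  (i < m)%N -> (j < m)%N -> uniq vs -> all (mem (iota 0 K)) vs ->
  nn (Ffe M fe (s K) i) -> nn (Ffe M fe (s K) j) ->
  \sum_t Ffe M fe (s K) i t <= 1 -> \sum_t Ffe M fe (s K) j t <= 1 ->
  msum vs (Ffe M fe (s K) i) (tof M s) = msum vs (Ffe M fe (s K) j) (tof M s) ->
  esat rel f fe s (sume m M vs i j).

Lemma ini_sat (A : finType) rel (f : n.-tuple A -> R) fe s :
  esat rel f fe s ini0 /\ esat rel f fe s ini1 <->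
  Ffe M fe (s K) 0 (tof M s) = initG M (s K) f (tof M s).
Proof.
have st : size tail = size tailK by rewrite size_iota size_nseq.
rewrite (initGE _ _ nK) -(val_app M fe s).
have tE : all (fun i => gv (tof M s) i == s K) (iota n (K - n)) = (map s tail == map s tailK).
  rewrite /tailK map_nseq; apply/allP/eqP => [h|h x].
    apply: (@eq_from_nth _ (s K)); rewrite size_map size_iota ?size_nseq // => i iK.
    rewrite (nth_map 0%N) ?size_iota // nth_nseq iK nth_iota // -(gv_tof (M := M)); last by lia.
    by apply/eqP/h; rewrite mem_iota; lia.
  rewrite mem_iota => xK; rewrite gv_tof; last by lia.
  have : s x \in map s tail by apply: map_f; rewrite mem_iota.
  by rewrite h mem_nseq => /andP[_].
rewrite tE.
have fE : fext f [seq gv (tof M s) i | i <- iota 0 n] = fext f (map s (iota 0 n)).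
  by rewrite map_gv_tof //; rewrite all_iota; apply/allP => x; rewrite mem_iota; move: nK; lia.
rewrite fE; split.
  case=> o0 o1; case: (boolP (map s tail == _)) => e.
    case: o0 => [/(fo_esat _ _ _ _ (fo_eneqs _ _))|//].
    by rewrite foval_eneqs // e.
  case: o1 => [/(fo_esat _ _ _ _ (fo_eeqs _ _))|//].
  by rewrite foval_eeqs // (negbTE e).
case: ifP => e h; split.
- by right.
- by left; apply/(fo_esat _ _ _ _ (fo_eeqs _ _)); rewrite foval_eeqs // e.
- by left; apply/(fo_esat _ _ _ _ (fo_eneqs _ _)); rewrite foval_eneqs // e.
- by right.
Qed.

Lemma eso_of_correct : same_struc tau n p eso_of.
Proof.
move=> A rel f A1 _ df.
have A0 : (0 < #|A|)%N := ltnW A1.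
have /card_gt0P[a0 _] := A0.
split=> [sat s|sat].
  have w e : wsat rel p (initG M e f) by apply/(tsat_struct_wsat rel e sc NK A0 df).
  pose F0 e := ovr (fun _ _ => 0) 0 (initG M e f).
  have b0 e : bnd (F0 e).
    apply: bnd_ovr.
    - by move=> i; split=> // ; rewrite big1.
    - exact: initG_nn.
    - by rewrite initG_total.
  have ex e : exists F', [/\ (forall i, (i < 1)%N -> F' i = F0 e i), bnd F' & csats rel F' cs].
    apply: (compile_complete A1 NM sc' pN wM (ltnSn 0) (b0 e)); rewrite /F0 ovr_eq //.
    by rewrite initG_total.
  (* The matrix is universally quantified over the parameter, so a family of weights is chosen for
     every value of it. *)
  pose Fam e := proj1_sig (constructive_indefinite_description _ (ex e)).
  have famP e : [/\ (forall i, (i < 1)%N -> Fam e i = F0 e i), bnd (Fam e) & csats rel (Fam e) cs].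
    by rewrite /Fam; case: constructive_indefinite_description.
  (* The last argument selects the family and the first [K] arguments form the assignment. *)
  pose h i (t : K.+1.-tuple A) := Fam (last a0 t) i [ffun x : 'I_M.+1 => nth a0 t x].
  pose fe i : seq A -> R := if (i < m)%N then fext (h i) else fun _ => 0.
  have FE e i t : (i < m)%N -> Ffe M fe e i t = Fam e i t.
    move=> im; rewrite /Ffe /fe im /fext.
    have sz : size (map (gv t) (iota 0 K) ++ [:: e]) == K.+1.
      by rewrite size_cat size_map size_iota addn1.
    rewrite insubT /h; transitivity (Fam (last a0 (map (gv t) (iota 0 K) ++ [:: e])) i
        [ffun x : 'I_M.+1 => nth a0 (map (gv t) (iota 0 K) ++ [:: e]) x]); first by [].
    rewrite last_cat; congr (Fam e i _); apply/ffunP => x.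
    rewrite ffunE nth_cat size_map size_iota ltn_ord (nth_map 0%N) ?size_iota //.
    by rewrite nth_iota // gv_ord.
  apply/esat_efex; exists fe; split.
  - move=> j; rewrite mem_iota add0n /= => jm; rewrite /fe jm; exists (h j); split=> // t.
    have [_ b _] := famP (last a0 t); have [b1 b2] := b j.
    by rewrite b1 /=; apply: le_trans (sum_ge_term _ b1) b2.
  - by move=> j; rewrite mem_iota add0n /= /fe => /negbTE ->.
  apply/esat_eall => s' _.
  have [e0 b c] := famP (s' K).
  have [i0 i1] : esat rel f fe s' ini0 /\ esat rel f fe s' ini1.
    by apply/ini_sat; rewrite FE // e0 // /F0 ovr_eq.
  split=> //; split=> //.
  apply: (emits_complete _ eso_of_kok cs_idx).
  - by move=> *; apply: sume_complete.
  - move=> i; have [im|im] := ltnP i m.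
      have -> : Ffe M fe (s' K) i = Fam (s' K) i by apply: functional_extensionality => t; apply: FE.
      exact: b.
    have -> : Ffe M fe (s' K) i = fun _ => 0.
      by apply: functional_extensionality => t; rewrite /Ffe /fe ltnNge im.
    by split=> //; rewrite big1.
  - by apply: csats_ext cs_idx _ c => i im; apply: functional_extensionality => t; rewrite FE.
(* For this direction one value of the parameter is enough; [a0] is taken. *)
have /esat_efex[fe [b fz h]] := sat (fun _ => a0).
apply/(tsat_struct_wsat rel a0 sc NK A0 df).
have {}h s' : (forall v, (nvars M <= v)%N -> s' v = a0) -> esat rel f fe s' mat.
  by move=> e; apply: (proj1 (esat_eall _ _ _ _ _ _) h) => v; rewrite mem_iota add0n -leqNgt; apply: e.
have F0 i : nn (Ffe M fe a0 i).
  move=> t; rewrite /Ffe; have [im|im] := ltnP i m.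
    have [|g [gb ->]] := b i; first by rewrite mem_iota.
    by rewrite /fext; case: insubP => // u _ _; case/andP: (gb u).
  by rewrite fz // mem_iota add0n -leqNgt.
have -> : initG M a0 f = Ffe M fe a0 0.
  apply: functional_extensionality => t; apply/esym.
  pose s := mks t a0 a0 t (fun _ => a0).
  have [|i0 [i1 _]] := h s.
    by move=> v; rewrite /s /mks /nvars => vn; rewrite !ifF //; apply/negbTE; lia.
  have : Ffe M fe (s K) 0 (tof M s) = initG M (s K) f (tof M s).
    by apply: (proj1 (ini_sat rel f fe s)).
  by rewrite tof_mks /s /mks ltnn eqxx.
apply: (compile_sound A1 NM sc' pN wM F0 (c := 1)).
apply: (emits_sound (n := n) (f := f) (sume := sume m M) _ eso_of_kok cs_idx (s0 := fun _ => a0)).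
  by move=> *; apply: sume_sound; eassumption.
by move=> s e _; case: (h s e) => _ [].
Qed.

Hypothesis sume_ewf : forall fs vs us i j,
  (forall j, (j < m)%N -> flook fs j = Some K.+1) ->
  (forall v, (v < nvars M)%N -> v \in vs) ->
  (i < m)%N -> (j < m)%N -> uniq us -> all (mem (iota 0 K)) us ->
  ewf tau n fs vs (sume m M us i j).

Lemma eso_of_sentence : eso_sentence tau n eso_of.
Proof.
rewrite /eso_sentence; apply: ewf_efex; apply: ewf_eall; rewrite !cats0.
set fs := map _ _; set vs := rev _.
have hf j : (j < m)%N -> flook fs j = Some K.+1.
  move=> jm; rewrite /fs -[map _ _]cats0; apply: flook_map.
  by rewrite mem_rev mem_iota.
have hv v : (v < nvars M)%N -> v \in vs by move=> vn; rewrite mem_rev mem_iota.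
have v0 : 0%N \in vs by apply: hv.
have Kv : (K < nvars M)%N by rewrite /nvars; lia.
have at1 : all (mem vs) tail.
  by apply/allP => x; rewrite mem_iota => xK; apply: hv; rewrite /nvars; move: nK; lia.
have at2 : all (mem vs) tailK.
  by apply/allP => x; rewrite mem_nseq => /andP[_ /eqP ->]; apply: hv.
have wapp : ntwf n fs vs (app M 0).
  rewrite /app /ntwf hf // size_iota eqxx; apply/allP => x; rewrite mem_iota => xK.
  by apply: hv; rewrite /nvars; lia.
apply/and3P; split.
- apply/andP; split; first exact: ewf_eneqs.
  apply/andP; split=> //; rewrite /ntwf size_iota eqxx; apply/allP => x.
  by rewrite mem_iota => xn; apply: hv; rewrite /nvars; move: nK; lia.
- apply/andP; split; first exact: ewf_eeqs.
  by apply/andP; split.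
elim: cs eso_of_kok cs_idx => [|k ks IH] /=; first by rewrite v0.
move=> /andP[k1 k2] /andP[i1 i2]; rewrite IH // andbT.
by apply: (ewf_emit k1 i1 hf hv) => us i j *; apply: sume_ewf.
Qed.

End TeamToESO.

Definition sum_eq_sum (m M : nat) (vs : seq nat) (i j : nat) : eform :=
  ECmp CEq (NSum vs (app M i)) (NSum vs (app M j)).

Lemma updl_notin (A : finType) (s : nat -> A) (vs : seq nat) a v : v \notin vs -> updl s vs a v = s v.
Proof. by rewrite /updl => /negbTE ->. Qed.

Lemma nval_sum_app (A : finType) n (f : n.-tuple A -> R) M fe s vs i : uniq vs ->
  all (mem (iota 0 M.+1)) vs ->
  nval f fe s (NSum vs (app M i)) = msum vs (Ffe M fe (s M.+1) i) (tof M s).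
Proof.
move=> u v; rewrite -(msum_tuple _ _ u v); apply: eq_bigr => a _.
rewrite -[LHS]/(fe i (map (updl s vs a) (args M))) val_app updl_notin //.
by apply/negP => /(allP v); rewrite inE mem_iota; lia.
Qed.

(** [CDep] is the one constraint whose emitted formula has numerical atoms on both sides of a
    disjunction, and only dependence atoms produce it. *)
Lemma no_dep_compile N M p j c : no_dep p ->
  all (fun k => if k is CDep _ _ _ then false else true) (compile N M p j c).1.
Proof.
elim: p j c => //= [p IHp q IHq|p IHp q IHq|x p IHp|x p IHp] j c; last 2 first.
- exact: IHp.
- exact: IHp.
- by move=> /andP[np nq]; rewrite all_cat IHp // IHq.
- by move=> /andP[np nq]; rewrite all_cat IHp // IHq.
Qed.

Theorem approx_le_eso_sum : team_le_eso (fun p => no_dep p) LESO_eq_sum_01_acEA.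
Proof.
move=> tau n p sc np; exists (eso_of sum_eq_sum n p); split.
- apply: eso_of_sentence => // fs vs us i j hf hv im jm u v.
  have w k : (k < (compile (tbound n p) (tbound n p + maxn 1 (wid p)) p 0 1).2)%N ->
      ntwf n fs vs (NSum us (app (tbound n p + maxn 1 (wid p)) k)).
    move=> km; rewrite /app /ntwf u hf // size_iota eqxx; apply/allP => x.
    by rewrite mem_iota => xK; rewrite inE /= mem_cat hv ?orbT // /nvars; lia.
  by apply/andP; split; apply: w.
- have cE js k q : LESO_eq_sum_01_acEA q -> LESO_eq_sum_01_acEA (efex js k q).
    by elim: js => //= j js IH /IH[].
  pose Q q := [/\ loose q, ef_in false false true onlyEq C01 q, almost_conj q & qfree q].
  have cA xs q : Q q -> LESO_eq_sum_01_acEA (eall xs q).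
    move=> [h1 h2 h3 h4].
    suff [? ? ? h] : [/\ loose (eall xs q), ef_in false false true onlyEq C01 (eall xs q), almost_conj (eall xs q) & prefA (eall xs q)].
      by split=> //; move: h; case: (eall xs q).
    by elim: xs => /=; [split=> //; move: h4; case: (q) | move=> x xs []].
  have cN q r : Q q -> Q r -> Q (EAnd q r).
    by case=> [a1 a2 a3 a4] [b1 b2 b3 b4]; split; rewrite /= ?a1 ?a3 ?a4.
  have cO q r : fo q -> Q r -> Q (EOr q r).
    move=> fq [b1 b2 b3 b4]; have [a1 a2 a3 a4] := fo_class false false true fq.
    by case/andP: fq => _ nq; split; rewrite /= ?a1 ?a3 ?a4 ?nq.
  have C0 : C01 0 by left.
  apply: cE; apply: cA; apply: (cN); first by apply: (cO) => //; exact: fo_eneqs.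
  apply: (cN); first by apply: (cO) => //; exact: fo_eeqs.
  set cs := (compile _ _ _ _ _).1; set mm := (compile _ _ _ _ _).2.
  set M := (_ + _)%N.
  have : all (kok M tau n) cs := eso_of_kok sc.
  have : all (fun k => if k is CDep _ _ _ then false else true) cs by apply: no_dep_compile.
  elim: cs => [|k ks IH]; first by [].
  move=> /andP[k1 k2] /andP[o1 o2]; apply: (cN) (IH k2 o2).
  by case: k o1 k1 => //= [phi i j|phi i] /andP[fp _] _; apply: (cO).
- apply: eso_of_correct => //.
    move=> A rel f fe s vs i j _ _ _ u v.
    by rewrite -!(nval_sum_app f _ _ _ u v).
  move=> A rel f fe s vs i j _ _ _ u v _ _ _ _.
  by rewrite -!(nval_sum_app f _ _ _ u v).
Qed.

(** * Equality of sums without a summation operator *)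

Section Transport.
Variable I : finType.
Implicit Types F G H : I -> R.

(** An injection of a finite set into itself is a bijection, so the potential has equal sums on both
    sides and cancels. *)
Lemma transport_sum F G H (sg : I -> I) : injective sg ->
  (forall a, F a + H a = G a + H (sg a)) -> \sum_a F a = \sum_a G a.
Proof.
move=> inj e; apply: (addIr (\sum_a H a)).
rewrite [X in _ = _ + X](reindex_inj inj) -!big_split.
by apply: eq_bigr => a _; apply: e.
Qed.

(* Along a cyclic enumeration of I, the partial sums of F together with the tail sums
   of G form a potential for F - G. *)
Lemma sum_transport F G : (forall a, 0 <= F a) -> (forall a, 0 <= G a) ->
  \sum_a F a = \sum_a G a -> \sum_a F a <= 1 ->
  exists (sg : I -> I) H1 H2,
    [/\ injective sg, (forall a, 0 <= H1 a <= 1), (forall a, 0 <= H2 a <= 1) &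
     forall a, F a + (H1 a + H2 a) = G a + (H1 (sg a) + H2 (sg a))].
Proof.
move=> F0 G0 FG F1.
pose rk (a : I) : nat := enum_rank a.
have rk_lt a : (rk a < #|I|)%N by apply: ltn_ord.
have rk_inj : injective rk by move=> a b /val_inj/enum_rank_inj.
have c0 (a : I) : (0 < #|I|)%N by apply/card_gt0P; exists a.
(* The cyclic successor of the rank. *)
pose nx (a : I) : nat := if ((rk a).+1 < #|I|)%N then (rk a).+1 else 0%N.
have nx_lt a : (nx a < #|I|)%N by rewrite /nx; case: ifP => // _; apply: c0 a.
pose sg a := enum_val (Ordinal (nx_lt a)).
have rk_sg a : rk (sg a) = nx a by rewrite /rk /sg enum_valK.
(* Each of the two sums is at most 1, whereas their total can reach 2; this is why the potential
   consists of two functions. *)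
pose H1 a := \sum_(b | (rk b < rk a)%N) F b.
pose H2 a := \sum_(b | (rk a <= rk b)%N) G b.
have le_tot (K : I -> R) (P : pred I) : (forall a, 0 <= K a) -> \sum_(a | P a) K a <= \sum_a K a.
  by move=> K0; rewrite [leRHS](bigID P) /= lerDl sumr_ge0.
exists sg, H1, H2; split.
- move=> a b e; apply: rk_inj; have : nx a = nx b by rewrite -!rk_sg e.
  have := rk_lt a; have := rk_lt b; rewrite /nx.
  by case: ifP => h1; case: ifP => h2; move: h1 h2; clear; lia.
- by move=> a; rewrite sumr_ge0 //=; apply: le_trans F1; apply: le_tot.
- by move=> a; rewrite sumr_ge0 //=; apply: le_trans F1; rewrite FG; apply: le_tot.
move=> a.
have h1 : \sum_(b | (rk b < (rk a).+1)%N) F b = F a + H1 a.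
  rewrite (bigD1 a) //=; congr (_ + _); apply: eq_bigl => b.
  rewrite ltnS [in RHS]ltn_neqAle andbC; congr (_ && _).
  by rewrite (inj_eq rk_inj).
have h2 : H2 a = G a + \sum_(b | ((rk a).+1 <= rk b)%N) G b.
  rewrite /H2 (bigD1 a) //=; congr (_ + _); apply: eq_bigl => b.
  rewrite [in RHS]ltn_neqAle andbC; congr (_ && _).
  by rewrite (inj_eq rk_inj) eq_sym.
rewrite {2}/H1 {2}/H2 rk_sg /nx; case: ifP => h.
  by rewrite h1 h2; ring.
(* The last element is sent to rank 0, where [H1] is 0 and [H2] is the whole sum of [G]. Equality of
   the totals closes the cycle. *)
have t1 : \sum_(b | (rk b < (rk a).+1)%N) F b = \sum_b F b.
  by apply: eq_bigl => b; rewrite (leq_trans (rk_lt b)) // leqNgt h.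
have t2 : \sum_(b | ((rk a).+1 <= rk b)%N) G b = 0.
  by apply: big_pred0 => b; apply/negbTE; rewrite -ltnNge; apply: leq_trans (rk_lt b) _; rewrite leqNgt h.
rewrite h2 t2 addr0 [X in _ = _ + (X + _)]big_pred0 // add0r.
rewrite [X in _ = _ + X](_ : _ = \sum_b F b); last by rewrite FG; apply: eq_bigl.
by rewrite -t1 h1; ring.
Qed.

End Transport.

(** Function [m] is the indicator of a relation between tuples [vs] and [v]. The first conjunct says
    that a tuple [v] has at most one partner, the second that each [vs] has a partner satisfying the
    transport equation; functions [m.+1] and [m.+2] make up the potential. The function quantifiers
    stand below the universal block, so all three may vary with the remaining coordinates. *)
Definition sum_eq_add (m M : nat) (vs : seq nat) (i j : nat) : eform :=
  let k := size vs in
  let v := iota (nvars M) k in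
  let w := iota (nvars M + k) k in
  EFEx m (k + k) (EFEx m.+1 k (EFEx m.+2 k (EAnd
    (eall (w ++ (v ++ vs)) (EOr (ECmp CEq (NVar m (vs ++ v)) (NConst 0))
       (EOr (ECmp CEq (NVar m (w ++ v)) (NConst 0)) (eeqs vs w))))
    (eall vs (eexs v (EAnd (ECmp CEq (NVar m (vs ++ v)) (NConst 1))
       (ECmp CEq (NAdd (app M i) (NAdd (NVar m.+1 vs) (NVar m.+2 vs)))
                 (NAdd (app M j) (NAdd (NVar m.+1 v) (NVar m.+2 v)))))))))).

Section SumAdd.
Variables (A : finType) (rel : nat -> seq A -> bool) (n : nat) (f : n.-tuple A -> R).
Variables (M m : nat) (vs : seq nat).
Notation K := M.+1.
Let k := size vs.
Let v := iota (nvars M) k.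
Let w := iota (nvars M + k) k.
Hypotheses (uvs : uniq vs) (vsK : all (mem (iota 0 K)) vs).

Lemma vs_lt x : x \in vs -> (x < K)%N.
Proof. by move: vsK; rewrite all_iota => /allP; apply. Qed.

Lemma map_updl_disj (s : nat -> A) xs ys a : (forall x, x \in xs -> x \notin ys) ->
  map (updl s ys a) xs = map s xs.
Proof. by move=> d; apply/eq_in_map => x /d; apply: updl_notin. Qed.

Let disj_vs_v x : x \in vs -> x \notin v.
Proof. by move/vs_lt; rewrite mem_iota /nvars; lia. Qed.
Let disj_w_vs x : x \in w -> x \notin vs.
Proof. by move=> xw; apply/negP => /vs_lt; move: xw; rewrite mem_iota /nvars; lia. Qed.
Let disj_v_vs x : x \in v -> x \notin vs.
Proof. by move=> xw; apply/negP => /vs_lt; move: xw; rewrite mem_iota /nvars; lia. Qed.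
Let disj_w_v x : x \in w -> x \notin v.
Proof. by rewrite !mem_iota; lia. Qed.
Let disj_args_v x : x \in args M -> x \notin v.
Proof. by rewrite !mem_iota /nvars; lia. Qed.
Let KN : K \notin vs.
Proof. by apply/negP => /vs_lt; rewrite ltnn. Qed.

Lemma val_app_upd fe s (a : k.-tuple A) i :
  fe i (map (updl s vs a) (args M)) = Ffe M fe (s K) i (tof M (updl s vs a)).
Proof. by rewrite val_app updl_notin. Qed.

Lemma sum_eq_add_sound fe s i j : (i < m)%N -> (j < m)%N ->
  esat rel f fe s (sum_eq_add m M vs i j) ->
  msum vs (Ffe M fe (s K) i) (tof M s) = msum vs (Ffe M fe (s K) j) (tof M s).
Proof.
move=> im jm; rewrite /sum_eq_add -/k -/v -/w.
move=> [chi [_ [h1 [_ [h2 [_ [/esat_eall inj /esat_eall step]]]]]]].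
set fe3 := (fun g' => if g' == m.+2 then _ else _) in inj step.
have fe3i l : (l < m)%N -> fe3 l = fe l by move=> lm; rewrite /fe3 !ifF //; apply/eqP; lia.
rewrite -!msum_tuple //.
pose H (b : k.-tuple A) := fe3 m.+1 b + fe3 m.+2 b.
have ex (a : k.-tuple A) : exists b : k.-tuple A, fe3 m (a ++ b) = 1 /\
    Ffe M fe (s K) i (tof M (updl s vs a)) + H a = Ffe M fe (s K) j (tof M (updl s vs a)) + H b.
  have aE : map (updl s vs a) vs = a by rewrite map_updl // size_tuple.
  have /esat_eexs [s' [e [c1 c2]]] := step (updl s vs a) (fun x xv => updl_notin s a xv).
  have vE : map s' vs = a.
    by rewrite -[RHS]aE; apply/eq_in_map => x xv; apply: e; apply: disj_vs_v.
  have aps : map s' (args M) = map (updl s vs a) (args M).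
    by apply/eq_in_map => x xv; apply: e; apply: disj_args_v.
  have sz : size (map s' v) == k by rewrite size_map size_iota.
  have c1' : fe3 m (map s' (vs ++ v)) = 1 := c1.
  have c2' : fe3 i (map s' (args M)) + (fe3 m.+1 (map s' vs) + fe3 m.+2 (map s' vs)) =
      fe3 j (map s' (args M)) + (fe3 m.+1 (map s' v) + fe3 m.+2 (map s' v)) := c2.
  exists (Tuple sz); split; first by move: c1'; rewrite map_cat vE.
  by move: c2'; rewrite aps vE (fe3i i im) (fe3i j jm) (val_app_upd fe s a i) (val_app_upd fe s a j).
(* Choosing a partner for every tuple yields the map; its injectivity comes from the first
   conjunct. *)
pose sg a := proj1_sig (constructive_indefinite_description _ (ex a)).
have sgP (a : k.-tuple A) : fe3 m (a ++ sg a) = 1 /\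
    Ffe M fe (s K) i (tof M (updl s vs a)) + H a = Ffe M fe (s K) j (tof M (updl s vs a)) + H (sg a).
  by rewrite /sg; case: constructive_indefinite_description.
apply: (transport_sum (sg := sg) (H := H)); last by move=> a; case: (sgP a).
move=> a a' e.
(* The first conjunct is instantiated with [vs], [w] and [v] holding [a], [a'] and their common
   image. *)
pose s2 := updl (updl (updl s w a') v (sg a)) vs a; have := inj s2.
have out x : x \notin w ++ (v ++ vs) -> s2 x = s x.
  by rewrite !mem_cat !negb_or => /and3P[x1 x2 x3]; rewrite /s2 !updl_notin.
have E1 : map s2 vs = a by rewrite map_updl // size_tuple.
have E2 : map s2 v = sg a.
  by rewrite map_updl_disj // map_updl ?iota_uniq // size_tuple size_iota.
have E3 : map s2 w = a'.
  by rewrite map_updl_disj // map_updl_disj // map_updl ?iota_uniq // size_tuple size_iota.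
case/(_ out).
- rewrite /= map_cat E1 E2 (sgP a).1 => /eqP; rewrite oner_eq0 //.
case=> [|/(fo_esat _ _ _ _ (fo_eeqs _ _))].
- by rewrite /= map_cat E3 E2 e (sgP a').1 => /eqP; rewrite oner_eq0.
by rewrite foval_eeqs ?size_iota // E1 E3 => /eqP /val_inj.
Qed.

Lemma sum_eq_add_complete fe s i j : (i < m)%N -> (j < m)%N ->
  nn (Ffe M fe (s K) i) -> nn (Ffe M fe (s K) j) ->
  \sum_t Ffe M fe (s K) i t <= 1 ->
  msum vs (Ffe M fe (s K) i) (tof M s) = msum vs (Ffe M fe (s K) j) (tof M s) ->
  esat rel f fe s (sum_eq_add m M vs i j).
Proof.
move=> im jm i0 j0 i1 e; rewrite /sum_eq_add -/k -/v -/w.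
have [||||sg [H1 [H2 [inj b1 b2 H]]]] := @sum_transport _
  (fun a : k.-tuple A => Ffe M fe (s K) i (tof M (updl s vs a)))
  (fun a : k.-tuple A => Ffe M fe (s K) j (tof M (updl s vs a))); try by move=> a.
- by rewrite !msum_tuple.
- rewrite msum_tuple //; apply: le_trans i1; rewrite /msum big_mkcond /=.
  by apply: ler_sum => t _; case: ifP.
(* The indicator of the graph of [sg], read on concatenated tuples. *)
exists (fun t => ([exists a : k.-tuple A, tval t == a ++ sg a])%:R); split.
  by move=> t; case: existsP; rewrite ?lexx ?ler01.
exists H1; split=> //; exists H2; split=> //.
set fe3 := (fun g' => if g' == m.+2 then _ else _).
have fe3i l : (l < m)%N -> fe3 l = fe l by move=> lm; rewrite /fe3 !ifF //; apply/eqP; lia.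
have e02 : (m == m.+2) = false by lia.
have e01 : (m == m.+1) = false by lia.
have e12 : (m.+1 == m.+2) = false by lia.
have fe3m : fe3 m = fext (fun t : (k + k).-tuple A => ([exists a : k.-tuple A, tval t == a ++ sg a])%:R).
  by rewrite /fe3 e02 e01 eqxx.
have fe31 (b : k.-tuple A) : fe3 m.+1 b = H1 b by rewrite /fe3 e12 eqxx /fext valK.
have fe32 (b : k.-tuple A) : fe3 m.+2 b = H2 b by rewrite /fe3 eqxx /fext valK.
have fE (a b : seq A) : size a = k -> size b = k ->
    fe3 m (a ++ b) = ([exists c : k.-tuple A, (a == c) && (b == sg c)])%:R.
  move=> sa sb; rewrite fe3m /fext insubT; first by rewrite size_cat sa sb.
  move=> h /=; congr (_%:R); congr nat_of_bool; apply: eq_existsb => c.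
  by rewrite eqseq_cat // sa size_tuple.
split.
  apply/esat_eall => s' _.
  have sv : size (map s' v) = k by rewrite size_map size_iota.
  have sw : size (map s' w) = k by rewrite size_map size_iota.
  have svs : size (map s' vs) = k by rewrite size_map.
  rewrite /= !map_cat !fE //.
  case: existsP => [[c /andP[/eqP c1 /eqP c2]]|_]; last by left.
  case: existsP => [[c' /andP[/eqP c1' /eqP c2']]|_]; last by right; left.
  right; right; apply/(fo_esat _ _ _ _ (fo_eeqs _ _)); rewrite foval_eeqs ?size_iota //.
  rewrite c1 c1'; apply/eqP; congr tval; apply: inj; apply: val_inj.
  by rewrite -[RHS]c2' -[LHS]c2.
apply/esat_eall => s' es'.
pose a : k.-tuple A := [tuple of map_tuple s' (in_tuple vs)].
have s'E : s' = updl s vs a.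
  apply: functional_extensionality => x; have [xv|xv] := boolP (x \in vs).
    by have /eq_in_map -> : map s' vs = map (updl s vs a) vs by rewrite map_updl // size_tuple.
  by rewrite es' // updl_notin.
apply/esat_eexs; exists (updl s' v (sg a)); split=> [x xv|]; first exact: updl_notin.
have E1 : map (updl s' v (sg a)) v = sg a by rewrite map_updl ?iota_uniq // size_tuple size_iota.
have E2 : map (updl s' v (sg a)) vs = a by rewrite map_updl_disj.
have E3 : map (updl s' v (sg a)) (args M) = map (updl s vs a) (args M).
  by rewrite map_updl_disj // s'E.
set s2 := updl s' v (sg a) in E1 E2 E3 *; split.
  rewrite /= map_cat E1 E2 fE ?size_tuple //; case: existsP => // -[]; exists a.
  by rewrite !eqxx.
change (fe3 i (map s2 (args M)) + (fe3 m.+1 (map s2 vs) + fe3 m.+2 (map s2 vs)) =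
  fe3 j (map s2 (args M)) + (fe3 m.+1 (map s2 v) + fe3 m.+2 (map s2 v))).
rewrite E1 E2 E3 (fe3i i im) (fe3i j jm) (val_app_upd fe s a i) (val_app_upd fe s a j).
by rewrite !fe31 !fe32.
Qed.

End SumAdd.

Theorem approx_dep_le_eso_add : team_le_eso (fun _ => True) LESO_eq_add_01.
Proof.
move=> tau n p sc _; exists (eso_of sum_eq_add n p); split.
- apply: eso_of_sentence => // fs vs us i j hf hv im jm u v.
  set M := (tbound n p + maxn 1 (wid p))%N in hf hv v *.
  set m := (compile _ _ _ _ _).2 in hf im jm *.
  rewrite /sum_eq_add; set k := size us; set v' := iota (nvars M) k; set w := iota (nvars M + k) k.
  have sv : size v' = k by rewrite size_iota.
  have sw : size w = k by rewrite size_iota.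
  have f0 : (m.+2 == m) = false by lia.
  have f1 : (m.+1 == m) = false by lia.
  have f2 : (m.+2 == m.+1) = false by lia.
  have hf' l : (l < m)%N -> flook [:: (m.+2, k), (m.+1, k), (m, (k + k)%N) & fs] l = Some M.+2.
    move=> lm /=; have -> : (m.+2 == l) = false by lia.
    have -> : (m.+1 == l) = false by lia.
    have -> : (m == l) = false by lia.
    exact: hf.
  have sub1 (xs ys : seq nat) : {subset xs <= ys} -> all (mem ys) xs by move=> h; apply/allP.
  have v0 : 0%N \in vs by apply: hv.
  apply/andP; split.
    apply: ewf_eall.
    have [a1 a2 a3] : [/\ all (mem (rev (w ++ v' ++ us) ++ vs)) us,
        all (mem (rev (w ++ v' ++ us) ++ vs)) v' & all (mem (rev (w ++ v' ++ us) ++ vs)) w].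
      by split; apply: sub1 => x xu; rewrite mem_cat mem_rev !mem_cat xu ?orbT.
    apply/andP; split; first by rewrite /= f0 f1 eqxx !size_cat sv all_cat a1 a2 eqxx.
    apply/andP; split; first by rewrite /= f0 f1 eqxx !size_cat sv sw all_cat a3 a2 eqxx.
    by apply: ewf_eeqs => //; rewrite mem_cat v0 orbT.
  apply: ewf_eall; apply: ewf_eexs.
  set V := rev v' ++ _.
  have [a1 a2] : all (mem V) us /\ all (mem V) v'.
    by split; apply: sub1 => x xu; rewrite !mem_cat !mem_rev xu ?orbT.
  have ap l : (l < m)%N -> ntwf n [:: (m.+2, k), (m.+1, k), (m, (k + k)%N) & fs] V (app M l).
    move=> lm; rewrite /app /ntwf hf' // size_iota eqxx; apply/allP => x; rewrite mem_iota => xK.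
    by rewrite inE /= !mem_cat hv ?orbT // /nvars; lia.
  apply/andP; split; first by rewrite /= f0 f1 eqxx !size_cat sv all_cat a1 a2 eqxx.
  apply/andP; split; apply/andP; split; try exact: ap.
    by rewrite /= f2 !eqxx a1.
  by rewrite /= f2 !eqxx a2 sv eqxx.
- pose Q := LESO_eq_add_01; have C0 : C01 0 by left.
  have C1 : C01 1 by right.
  have cE js k q : Q q -> Q (efex js k q) by elim: js => //= j js IH /IH[].
  have cA xs q : Q q -> Q (eall xs q) by elim: xs => //= j js IH /IH[].
  have cX xs q : Q q -> Q (eexs xs q) by elim: xs => //= j js IH /IH[].
  have cO q r : Q q -> Q r -> Q (EOr q r).
    by move=> [h1 h2] [h3 h4]; split; rewrite /= ?h1.
  have cN q r : Q q -> Q r -> Q (EAnd q r).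
    by move=> [h1 h2] [h3 h4]; split; rewrite /= ?h1.
  have cF g k q : Q q -> Q (EFEx g k q) by [].
  have cf q : fo q -> Q q.
    by move=> /(fo_class true false false)[].
  apply: (cE); apply: (cA); apply: (cN); first by apply: (cO); [apply: (cf); exact: fo_eneqs | ].
  apply: (cN); first by apply: (cO); [apply: (cf); exact: fo_eeqs | ].
  set cs := (compile _ _ _ _ _).1; set mm := (compile _ _ _ _ _).2.
  set M := (_ + _)%N.
  have : all (kok M tau n) cs := eso_of_kok sc.
  elim: cs => [|k ks IH]; first by [].
  move=> /andP[k1 /IH h]; apply: (cN) => //.
  case: k k1 => [vs i j|phi i j|phi i|x i|xs y i] o1.
  + do 3 apply: (cF).
    apply: (cN); first by apply: (cA); apply: (cO) => //; apply: (cO) => //; apply: (cf); exact: fo_eeqs.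
    by apply: (cA); apply: (cX); apply: (cN).
  + by apply: (cO) => //; apply: (cf); case/andP: o1.
  + by apply: (cO) => //; apply: (cf); case/andP: o1.
  + by [].
  + by apply: (cO) => //; apply: (cO) => //; apply: (cO) => //; apply: (cf); exact: fo_eneqs.
- apply: eso_of_correct => //.
    by move=> A rel f fe s vs i j _ im jm u v; apply: sum_eq_add_sound.
  by move=> A rel f fe s vs i j _ im jm u v i0 j0 i1 j1; apply: sum_eq_add_complete.
Qed.

(** * From ESO to teams *)

Fixpoint tfo (p : tform) : bool :=
  match p with
  | TEq _ _ | TNeq _ _ | TRel _ _ | TNRel _ _ => true
  | TAnd p q | TOr p q => tfo p && tfo q
  | _ => false
  end.

Fixpoint tneg (p : tform) : tform :=
  match p with
  | TEq x y => TNeq x y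
  | TNeq x y => TEq x y
  | TRel r xs => TNRel r xs
  | TNRel r xs => TRel r xs
  | TAnd p q => TOr (tneg p) (tneg q)
  | TOr p q => TAnd (tneg p) (tneg q)
  | _ => p
  end.

Lemma tfo_tneg p : tfo p -> tfo (tneg p).
Proof. by elim: p => //= p IHp q IHq /andP[h1 h2]; rewrite IHp ?IHq. Qed.

Lemma tscope_tneg tau vs p : tscope tau vs p -> tscope tau vs (tneg p).
Proof. by elim: p => //= p IHp q IHq /andP[h1 h2]; rewrite IHp ?IHq. Qed.

Lemma no_dep_tneg p : no_dep p -> no_dep (tneg p).
Proof. by elim: p => //= p IHp q IHq /andP[h1 h2]; rewrite IHp ?IHq. Qed.

Lemma no_dep_tfo p : tfo p -> no_dep p.
Proof. by elim: p => //= p IHp q IHq /andP[h1 h2]; rewrite IHp ?IHq. Qed.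

Definition talls (ws : seq nat) (p : tform) : tform := foldr TAll p ws.

Lemma talls_bound ws p M : (tmaxv (talls ws p) <= M)%N ->
  all (fun x => (x <= M)%N) ws /\ (tmaxv p <= M)%N.
Proof.
by elim: ws => //= x ws IH; rewrite geq_max => /andP[-> /IH].
Qed.

Lemma tscope_talls tau vs ws p : tscope tau (rev ws ++ vs) p -> tscope tau vs (talls ws p).
Proof. by elim: ws vs => //= x ws IH vs; rewrite rev_cons cat_rcons => /IH. Qed.

Lemma no_dep_talls ws p : no_dep (talls ws p) = no_dep p.
Proof. by elim: ws. Qed.

Section FO.
Variables (A : finType) (rel : nat -> seq A -> bool).

Fixpoint tfval (v : nat -> A) (p : tform) : bool :=
  match p with
  | TEq x y => v x == v y
  | TNeq x y => v x != v y
  | TRel r xs => rel r (map v xs)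
  | TNRel r xs => ~~ rel r (map v xs)
  | TAnd p q => tfval v p && tfval v q
  | TOr p q => tfval v p || tfval v q
  | _ => false
  end.

Lemma tfval_tneg v p : tfo p -> tfval v (tneg p) = ~~ tfval v p.
Proof.
elim: p => //= [x y|r xs|p IHp q IHq|p IHp q IHq] => [_|_|/andP[h1 h2]|/andP[h1 h2]].
- by rewrite negbK.
- by rewrite negbK.
- by rewrite IHp ?IHq // negb_and.
- by rewrite IHp ?IHq // negb_or.
Qed.

Lemma tfval_scope tau vs v v' p : tscope tau vs p -> tfo p -> {in vs, v =1 v'} ->
  tfval v p = tfval v' p.
Proof.
move=> + + e.
have em xs : all (mem vs) xs -> map v xs = map v' xs.
  by move=> /allP h; apply/eq_in_map => x /h; apply: e.
elim: p => //= [x y|x y|r xs|r xs|p IHp q IHq|p IHp q IHq].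
- by case/andP=> *; rewrite !e.
- by case/andP=> *; rewrite !e.
- by case/and3P=> *; rewrite em.
- by case/and3P=> *; rewrite em.
- by case/andP=> ? ? /andP[? ?]; rewrite IHp ?IHq.
- by case/andP=> ? ? /andP[? ?]; rewrite IHp ?IHq.
Qed.

Variable M : nat.
Notation T := {ffun 'I_M.+1 -> A}.

Definition on (P : pred T) (G : T -> R) (t : T) : R := if P t then G t else 0.

Lemma on_nn P G : nn G -> nn (on P G).
Proof. by move=> G0 t; rewrite /on; case: ifP. Qed.

Lemma on_gt0 P G t : 0 < on P G t -> P t /\ 0 < G t.
Proof. by rewrite /on; case: ifP => // _; rewrite ltxx. Qed.

Lemma on_split P G t : G t = on P G t + on (predC P) G t.
Proof. by rewrite /on /=; case: (P t); rewrite ?addr0 ?add0r. Qed.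

(** Flatness of first-order formulae: for a disjunction the weight is split by the truth of the
    first disjunct. *)
Lemma wsat_fo p (G : T -> R) : tfo p -> nn G ->
  wsat rel p G <-> (forall t, 0 < G t -> tfval (gv t) p).
Proof.
elim: p G => //= [x y|x y|p IHp q IHq|p IHp q IHq] G fp G0.
- by split=> h t Gt; apply/eqP; apply: h.
- by split=> h t Gt; apply/eqP; apply: h.
- case/andP: fp => fp fq; rewrite IHp // IHq //; split.
    by case=> h1 h2 t Gt; rewrite h1 ?h2.
  by move=> h; split=> t /h /andP[].
- case/andP: fp => fp fq; split.
    case=> Y [Z [Y0 Z0 e /(IHp _ fp Y0) h1 /(IHq _ fq Z0) h2]] t; rewrite e => s0.
    have [Yt|Yt] := ltP 0 (Y t); first by rewrite h1.
    by rewrite h2 ?orbT //; apply: lt_le_trans s0 _; rewrite gerDr.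
  move=> h; exists (on (fun t => tfval (gv t) p) G), (on (predC (fun t => tfval (gv t) p)) G).
  split; try exact: on_nn.
  + by move=> t; apply: on_split.
  + by apply/IHp; [exact: fp | exact: on_nn | move=> t /on_gt0[]].
  + apply/IHq; [exact: fq | exact: on_nn | move=> t /on_gt0[/= np /h]].
    by rewrite (negbTE np).
Qed.

(** The second disjunct repeats the negation of [p], so the split of the weight is forced: the part
    for [q] is exactly the part where [p] fails. *)
Lemma wsat_guard p q (G : T -> R) : tfo p -> nn G ->
  wsat rel (TOr p (TAnd (tneg p) q)) G <->
  wsat rel q (on (fun t => ~~ tfval (gv t) p) G).
Proof.
move=> fp G0; split.
  case=> Y [Z [Y0 Z0 e /(wsat_fo fp Y0) h1 [/(wsat_fo (tfo_tneg fp) Z0) h2 h3]]].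
  apply: wsat_ext h3 => t; rewrite /on e.
  case: (boolP (tfval (gv t) p)) => pt /=.
    by apply/eqP; apply: contraTT pt => n; rewrite -tfval_tneg // h2 // lt0r n Z0.
  have -> : Y t = 0; last by rewrite add0r.
  by apply/eqP; apply: contraNT pt => n; rewrite h1 // lt0r n Y0.
move=> h; exists (on (fun t => tfval (gv t) p) G), (on (fun t => ~~ tfval (gv t) p) G).
split; try exact: on_nn.
- by move=> t; rewrite [LHS](on_split (fun t => tfval (gv t) p)).
- by apply/wsat_fo => //; [exact: on_nn | move=> t /on_gt0[]].
split=> //; apply/wsat_fo; [exact: tfo_tneg | exact: on_nn | move=> t /on_gt0[]].
by rewrite tfval_tneg.
Qed.

(** A weight concentrated on the graph of [h] has at most one charged point on each line in
    direction [y], hence is determined by its marginal. *)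
Lemma eq_of_mg y (h : T -> A) (Y Z : T -> R) : indep y h ->
  (forall t, gv t y != h t -> Y t = 0) -> (forall t, gv t y != h t -> Z t = 0) ->
  mg y Y =1 mg y Z -> Y =1 Z.
Proof.
move=> ih Y0 Z0 e t; have [E|E] := eqVneq (gv t y) (h t); last by rewrite Y0 ?Z0.
have aux (X : T -> R) : (forall t, gv t y != h t -> X t = 0) -> mg y X t = X t.
  move=> X0; rewrite /mg (bigD1 (h t)) //= big1 ?addr0; first by rewrite -E ups_id.
  by move=> a ah; rewrite X0 // gv_ups ih.
by have := e t; rewrite !aux.
Qed.

Lemma mg_pushT y (h : T -> A) (G : T -> R) : (y <= M)%N ->
  mg y (pushT (fun t => ups t y (h t)) G) =1 mg y G.
Proof.
move=> yM t; rewrite -!msum1 //; apply: msum_pushT => t'.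
by apply: eqoff_ups => //; rewrite inE.
Qed.

Lemma pushT_ups_eq0 y (h : T -> A) (G : T -> R) : indep y h ->
  forall t, gv t y != h t -> pushT (fun t => ups t y (h t)) G t = 0.
Proof.
move=> ih t n; apply: pushT_eq0 => t'; apply: contraNneq n => <-.
by rewrite gv_ups ih.
Qed.

(** An existential variable with an explicit first-order definition has a unique witness, the image
    of the weight under that definition. *)
Lemma wsat_def y (h : T -> A) d q (G : T -> R) : (y <= M)%N -> tfo d -> nn G -> indep y h ->
  (forall t, tfval (gv t) d = (gv t y == h t)) ->
  wsat rel (TEx y (TAnd d q)) G <-> wsat rel q (pushT (fun t => ups t y (h t)) G).
Proof.
move=> yM fd G0 ih dE; split.
  case=> Y [Y0 YG [/(wsat_fo fd Y0) h1 h2]]; apply: wsat_ext h2.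
  apply: (eq_of_mg ih); last by move=> t; rewrite YG mg_pushT.
  - move=> t n; apply/eqP; apply: contraNT n => n; rewrite -dE; apply: h1.
    by rewrite lt0r n Y0.
  - exact: pushT_ups_eq0.
move=> h'; exists (pushT (fun t => ups t y (h t)) G).
have P0 : nn (pushT (fun t => ups t y (h t)) G) by apply: pushT_nn.
split=> //; first exact: mg_pushT.
split=> //; apply/wsat_fo => // t; rewrite dE => Gt; apply: contraTT Gt => n.
by rewrite pushT_ups_eq0 // ltxx.
Qed.

End FO.

(** * Masses over fixed values of the context *)

Section Mass.
Variables (A : finType) (M : nat).
Hypothesis A0 : (0 < #|A|)%N.
Notation T := {ffun 'I_M.+1 -> A}.
Notation le_M := (all (fun x => (x <= M)%N)).

Definition agree (ctx : seq nat) (t0 t : T) : bool := all (fun x => gv t x == gv t0 x) ctx.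

Lemma agreeP ctx t0 t : reflect {in ctx, gv t =1 gv t0} (agree ctx t0 t).
Proof.
apply: (iffP allP) => h x xc; first exact/eqP/h.
exact/eqP/h.
Qed.

Lemma agree_refl ctx t : agree ctx t t.
Proof. exact/agreeP. Qed.

Lemma agree_sub ctx ctx' t0 t : {subset ctx <= ctx'} -> agree ctx' t0 t -> agree ctx t0 t.
Proof. by move=> s /agreeP h; apply/agreeP => x /s; apply: h. Qed.

Lemma agree_map ctx t0 t xs : agree ctx t0 t -> {subset xs <= ctx} ->
  map (gv t) xs = map (gv t0) xs.
Proof. by move=> /agreeP h s; apply/eq_in_map => x /s; apply: h. Qed.

Lemma agree_congr ctx t0 t1 t : agree ctx t0 t1 -> agree ctx t0 t = agree ctx t1 t.
Proof.
move=> /agreeP h; apply/agreeP/agreeP => h' x xc; first by rewrite h' // h.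
by rewrite h' // h.
Qed.

Lemma agree_sym ctx t0 t1 : agree ctx t0 t1 = agree ctx t1 t0.
Proof. by apply: eq_all => x; rewrite eq_sym. Qed.

Lemma agree_indep ctx x t0 : (x <= M)%N -> le_M ctx -> x \notin ctx -> indep x (agree ctx t0).
Proof.
move=> xM /allP cM xc t a; apply: eq_in_all => y yc; rewrite gv_ups_ne //; first exact: cM.
by apply: contraNneq xc => <-.
Qed.

Lemma agree_ups ctx x t0 a : (x <= M)%N -> le_M ctx -> x \notin ctx -> agree ctx t0 (ups t0 x a).
Proof. by move=> xM cM xc; rewrite agree_indep // agree_refl. Qed.

(** Divided by the mass of [xpredT] this is the conditional probability of [P] given the values of
    [t0] on [ctx]. Products with masses replace the quotients, so contexts of mass 0 need no
    separate convention. *)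
Definition mass (G : T -> R) ctx t0 (P : pred T) : R := \sum_(t | agree ctx t0 t && P t) G t.

Lemma mass_ge0 G ctx t0 P : nn G -> 0 <= mass G ctx t0 P.
Proof. by move=> G0; apply: sumr_ge0. Qed.

Lemma mass_eq0 G ctx t0 P : nn G -> ~~ (0 < mass G ctx t0 P) -> mass G ctx t0 P = 0.
Proof. by move=> G0; rewrite -leNgt => h; apply/eqP; rewrite eq_le h mass_ge0. Qed.

Lemma mass_le G ctx t0 (P Q : pred T) : nn G ->
  (forall t, agree ctx t0 t -> P t -> Q t) -> mass G ctx t0 P <= mass G ctx t0 Q.
Proof.
move=> G0 PQ; rewrite /mass big_mkcond [leRHS]big_mkcond; apply: ler_sum => t _.
case: (boolP (agree ctx t0 t)) => //= o; case: (boolP (P t)) => p; first by rewrite PQ.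
by case: ifP.
Qed.

Lemma mass_leT G ctx t0 P : nn G -> mass G ctx t0 P <= mass G ctx t0 xpredT.
Proof. by move=> G0; apply: mass_le. Qed.

Lemma mass0 G ctx t0 P : nn G -> mass G ctx t0 xpredT = 0 -> mass G ctx t0 P = 0.
Proof. by move=> G0 z; apply/eqP; rewrite eq_le mass_ge0 // -z mass_leT. Qed.

Lemma mass_eqP G ctx t0 (P Q : pred T) :
  (forall t, agree ctx t0 t -> P t = Q t) -> mass G ctx t0 P = mass G ctx t0 Q.
Proof.
move=> e; apply: eq_bigl => t; case: (boolP (agree ctx t0 t)) => //= o; exact: e.
Qed.

Lemma mass_split G ctx t0 (P : pred T) :
  mass G ctx t0 P + mass G ctx t0 (predC P) = mass G ctx t0 xpredT.
Proof.
by rewrite /mass [RHS](bigID P) /=; congr (_ + _); apply: eq_bigl => t; rewrite !andbT.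
Qed.

Lemma mass_congr G ctx t0 t1 P : agree ctx t0 t1 -> mass G ctx t0 P = mass G ctx t1 P.
Proof. by move=> o; apply: eq_bigl => t; rewrite (agree_congr t o). Qed.

Lemma mass_gt0 G ctx t0 (P : pred T) : nn G -> 0 < mass G ctx t0 P ->
  exists t, [/\ agree ctx t0 t, P t & 0 < G t].
Proof.
by move=> G0 /lt0r_neq0/eqP/(psumr_neq0P (fun t _ => G0 t)) [t /andP[/andP[o p] Gt]]; exists t.
Qed.

Lemma mass_gt0' G ctx t0 (P : pred T) t : nn G -> agree ctx t0 t -> P t -> 0 < G t ->
  0 < mass G ctx t0 P.
Proof.
move=> G0 o p Gt; rewrite /mass (bigD1 t) ?o ?p //=.
by apply: ltr_pwDl => //; apply: sumr_ge0.
Qed.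

Lemma mass_cons G ctx t0 x (P : pred T) :
  mass G (x :: ctx) t0 P = mass G ctx t0 (fun t => (gv t x == gv t0 x) && P t).
Proof. by apply: eq_bigl => t; rewrite /agree /= -andbA andbCA. Qed.

Lemma mass_dup x G ctx t0 (P : pred T) : (x <= M)%N -> le_M ctx -> x \notin ctx ->
  indep x P -> mass (dup x G) ctx t0 P = mass G ctx t0 P.
Proof.
move=> xM cM xc iP; apply: (sum_dup A0) => t a.
by rewrite iP agree_indep.
Qed.

Lemma mass_dup_at x G ctx t0 (P : pred T) : (x <= M)%N -> le_M ctx -> x \notin ctx ->
  indep x P -> mass (dup x G) (x :: ctx) t0 P = mass G ctx t0 P / #|A|%:R.
Proof.
move=> xM cM xc iP; rewrite -(sum_dup_at (x := x) _ (gv t0 x)); last first.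
  by move=> t a; rewrite iP agree_indep.
by apply: eq_bigl => t; rewrite /agree /= -andbA.
Qed.

Lemma mass_mg x Y G ctx t0 (P : pred T) : (x <= M)%N -> le_M ctx -> x \notin ctx ->
  indep x P -> mg x Y =1 mg x G -> mass Y ctx t0 P = mass G ctx t0 P.
Proof.
move=> xM cM xc iP e; apply: (sum_mg_eq A0) e => t a.
by rewrite iP agree_indep.
Qed.

Definition dups (ws : seq nat) (G : T -> R) : T -> R := foldl (fun G x => dup x G) G ws.

Lemma dups_nn ws G : nn G -> nn (dups ws G).
Proof. by elim: ws G => //= x ws IH G G0; apply: IH; apply: dup_nn. Qed.

Lemma dups_cat ws1 ws2 G : dups (ws1 ++ ws2) G = dups ws2 (dups ws1 G).
Proof. exact: foldl_cat. Qed.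

Lemma wsat_talls rel ws p G : wsat rel (talls ws p) G <-> wsat rel p (dups ws G).
Proof. by elim: ws G => //= x ws IH G; rewrite IH. Qed.

Lemma mass_dups ws G ctx t0 (P : pred T) : le_M ws -> le_M ctx ->
  (forall x, x \in ws -> x \notin ctx) -> (forall x, x \in ws -> indep x P) ->
  mass (dups ws G) ctx t0 P = mass G ctx t0 P.
Proof.
elim: ws G => //= x ws IH G /andP[xM wM] cM d iP.
have xw : x \in x :: ws by rewrite inE eqxx.
rewrite IH //; [apply: mass_dup => //; [exact: d | exact: iP] | |].
- by move=> y yw; apply: d; rewrite inE yw orbT.
- by move=> y yw; apply: iP; rewrite inE yw orbT.
Qed.

(** Fixing the values of fresh uniform variables divides the mass of an event that ignores them by
    [#|A|] for each variable. *)
Lemma mass_dups_at ws G ctx t0 (P : pred T) : uniq ws -> le_M ws -> le_M ctx ->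
  (forall x, x \in ws -> x \notin ctx) -> (forall x, x \in ws -> indep x P) ->
  mass (dups ws G) (ws ++ ctx) t0 P = mass G ctx t0 P / #|A|%:R ^+ size ws.
Proof.
elim: ws G ctx => [|x ws IH] G ctx /=; first by rewrite expr0 divr1.
move=> /andP[xws uws] /andP[xM wM] cM d iP.
have xc : x \notin ctx by apply: d; rewrite inE eqxx.
transitivity (mass (dups ws (dup x G)) (ws ++ x :: ctx) t0 P).
  apply: eq_bigl => t; congr (_ && _).
  by rewrite /agree /= !all_cat /= andbCA.
rewrite IH //= ?xM // ?mass_dup_at //.
- by rewrite exprS invfM mulrA.
- by apply: iP; rewrite inE eqxx.
- move=> y yw; rewrite inE negb_or d ?inE ?yw ?orbT // andbT.
  by apply: contraNneq xws => <-.
- by move=> y yw; apply: iP; rewrite inE yw orbT.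
Qed.

Definition upl (t : T) (zs : seq nat) (v : seq A) : T := tof M (updl (gv t) zs v).

Lemma map_upl t zs v : uniq zs -> le_M zs -> size v = size zs -> map (gv (upl t zs v)) zs = v.
Proof.
move=> u zM sv; rewrite /upl map_gv_tof ?map_updl //.
by rewrite all_iota; apply: sub_all zM.
Qed.

Lemma gv_upl t zs v x : (x <= M)%N -> gv (upl t zs v) x = updl (gv t) zs v x.
Proof. by move=> xM; rewrite /upl gv_tof. Qed.

Lemma agree_upl ctx t0 zs v : le_M ctx -> (forall x, x \in zs -> x \notin ctx) ->
  agree ctx t0 (upl t0 zs v).
Proof.
move=> /allP cM d; apply/agreeP => x xc; rewrite gv_upl; last exact: cM.
by rewrite updl_notin //; apply/negP => /d; rewrite xc.
Qed.

Lemma mass_upl G ctx t0 zs v (P : pred T) : uniq zs -> le_M zs -> le_M ctx ->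
  (forall x, x \in zs -> x \notin ctx) -> size v = size zs ->
  mass G (zs ++ ctx) (upl t0 zs v) P = mass G ctx t0 (fun t => (map (gv t) zs == v) && P t).
Proof.
move=> u zM cM d sv; apply: eq_bigl => t; rewrite andbA; congr (_ && _).
rewrite /agree all_cat andbC; congr (_ && _).
  rewrite -!/(agree _ _ _); apply/esym/agree_congr.
  exact: agree_upl.
rewrite -[X in _ == X](map_upl t0 u zM sv).
apply/allP/eqP => [h|/eq_in_map h]; last by move=> x xz; rewrite h.
by apply/eq_in_map => x /h /eqP.
Qed.

End Mass.

(* A block encodes a function g into the team: the conditional probability that the
   variables bvals take the value v and those of bflags are equal to the constant c is
   g(v) / |A|^bexp. *)
Record block := Block { bvals : seq nat; bflags : seq nat; bexp : nat }.

(** [rho] sends an ESO variable to the team variable that currently holds its value; bound variables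
    are redirected to fresh team variables. *)
Definition updr (rho : nat -> nat) (ys zs : seq nat) (y : nat) : nat :=
  if y \in ys then nth 0%N zs (index y ys) else rho y.

(** * The team formula of an ESO formula *)

Section Translate.
Variable n : nat.
Notation cv := n.
Notation dv := n.+1.

Definition ttrue := TEq cv cv.
Definition tfalse := TNeq cv cv.
Definition tconj (ps : seq tform) : tform := foldr TAnd ttrue ps.
Definition teqs (xs ys : seq nat) : tform := tconj [seq TEq p.1 p.2 | p <- zip xs ys].
Definition pads (ws : seq nat) : tform := tconj [seq TEq x cv | x <- ws].
Definition evB (b : block) (pat : seq nat) : tform := TAnd (teqs (bvals b) pat) (pads (bflags b)).
(** The initial team is itself the block of the free function: its variables take the value [v] with
    probability [f v], with no flag and no scaling. *)
Definition bfree : block := Block (iota 0 n) [::] 0.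

(** The least admissible exponent of [#|A|]. A quantified function of arity [k] is stored scaled by
    [#|A|] to the power [-k]; an addition spends one uniform variable as a selector between its
    summands; the bound variables of a [SUM] are uniform variables themselves. Surplus variables are
    absorbed by padding, that is, by requiring them to equal [cv]. *)
Fixpoint need (i : nterm) : nat :=
  match i with
  | NConst _ | NSym _ | NMul _ _ => 0%N
  | NVar g xs => size xs
  | NAdd i j => (maxn (need i) (need j)).+1
  | NSum ys i => (size ys + need i)%N
  end.

(* An event over fresh uniformly distributed variables w..w+L-1 which has conditional
   probability i / |A|^L. *)
Fixpoint evT (fenv : nat -> block) (i : nterm) (rho : nat -> nat) (L w : nat) : tform :=
  match i with
  | NConst c => if c == 1 then pads (iota w L) else tfalse
  | NSym xs => TAnd (pads (iota w L)) (evB bfree (map rho xs))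
  | NVar g xs => TAnd (pads (iota w (L - size xs))) (evB (fenv g) (map rho xs))
  | NAdd i j => TOr (TAnd (TEq w cv) (evT fenv i rho L.-1 w.+1))
                    (TAnd (TEq w dv) (evT fenv j rho L.-1 w.+1))
  | NMul _ _ => tfalse
  | NSum ys i => evT fenv i (updr rho ys (iota w (size ys))) (L - size ys) (w + size ys)
  end.

(** An explicit definition of [e]: it is [cv] on the event and [dv] off it. *)
Definition tflag (E : tform) (e : nat) : tform :=
  TOr (TAnd E (TEq e cv)) (TAnd (tneg E) (TEq e dv)).

(** [ctx] lists the two constants and the variables introduced for first-order quantifiers, and [w]
    is the first fresh variable. [TDep ctx w] keeps a choice from depending on blocks or other
    hidden values. A comparison appends [ctx] to both flags, so that the marginal identity is tested
    over each context separately. *)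
Fixpoint tr (q : eform) (rho : nat -> nat) (fenv : nat -> block) (ctx : seq nat) (w : nat) : tform :=
  match q with
  | EEq x y => TEq (rho x) (rho y)
  | ENeq x y => TNeq (rho x) (rho y)
  | ERel r xs => TRel r (map rho xs)
  | ENRel r xs => TNRel r (map rho xs)
  | ECmp _ i j =>
      let L := maxn (need i) (need j) in
      talls (iota w L)
        (TEx (w + L) (TAnd (tflag (evT fenv i rho L w) (w + L))
          (TEx (w + L).+1 (TAnd (tflag (evT fenv j rho L w) (w + L).+1)
             (TApprox (rcons ctx (w + L)%N) (rcons ctx (w + L).+1))))))
  | ENCmp _ _ _ => ttrue
  | EAnd p q => TAnd (tr p rho fenv ctx w) (tr q rho fenv ctx w)
  | EOr p q =>
      if fo p then TOr (tr p rho fenv ctx w) (TAnd (tneg (tr p rho fenv ctx w)) (tr q rho fenv ctx w))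
      else if fo q then TOr (tr q rho fenv ctx w) (TAnd (tneg (tr q rho fenv ctx w)) (tr p rho fenv ctx w))
      else TEx w (TAnd (TDep ctx w)
             (TOr (TAnd (TEq w cv) (tr p rho fenv ctx w.+1)) (TAnd (TNeq w cv) (tr q rho fenv ctx w.+1))))
  | EEx x p => TEx w (TAnd (TDep ctx w) (tr p (updr rho [:: x] [:: w]) fenv (w :: ctx) w.+1))
  | EAll x p => TAll w (tr p (updr rho [:: x] [:: w]) fenv (w :: ctx) w.+1)
  | EFEx g k p =>
      talls (iota w k) (TEx (w + k)
        (tr p rho (fun g' => if g' == g then Block (iota w k) [:: (w + k)%N] k else fenv g') ctx (w + k).+1))
  end.

Lemma tfo_tconj ps : all tfo ps -> tfo (tconj ps).
Proof. by elim: ps => //= p ps IH /andP[-> /IH]. Qed.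

Lemma tfo_teqs xs ys : tfo (teqs xs ys).
Proof. by apply: tfo_tconj; rewrite all_map; apply/allP. Qed.

Lemma tfo_pads ws : tfo (pads ws).
Proof. by apply: tfo_tconj; rewrite all_map; apply/allP. Qed.

Lemma tfo_evT fenv i rho L w : tfo (evT fenv i rho L w).
Proof.
elim: i rho L w => [c|xs|g xs|i IHi j IHj|i IHi j IHj|ys i IHi] rho L w //=;
  rewrite ?tfo_pads ?tfo_teqs ?IHi ?IHj //.
by case: ifP => // _; apply: tfo_pads.
Qed.

Lemma tfo_tflag E e : tfo E -> tfo (tflag E e).
Proof. by move=> h; rewrite /= h tfo_tneg. Qed.

Lemma tfo_tr p rho fenv ctx w : fo p -> tfo (tr p rho fenv ctx w).
Proof.
rewrite /fo; elim: p rho fenv ctx w => //= p IHp q IHq rho fenv ctx w;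
  rewrite negb_or => /andP[/andP[p1 p2] /andP[p3 p4]].
  by rewrite IHp ?IHq ?p1 ?p2.
by rewrite /fo p1 p3 /= tfo_tneg IHp ?IHq ?p1 ?p2.
Qed.

Section Scope.
Variable tau : vocab.

Lemma tscope_tconj vs ps : n \in vs -> all (tscope tau vs) ps -> tscope tau vs (tconj ps).
Proof. by move=> nv; elim: ps => [|p ps IH] /=; rewrite ?nv // => /andP[-> /IH]. Qed.

Lemma tscope_teqs vs xs ys : n \in vs -> {subset xs <= vs} -> {subset ys <= vs} ->
  tscope tau vs (teqs xs ys).
Proof.
move=> nv hx hy; apply: tscope_tconj => //; rewrite all_map; apply/allP => -[x y] xy /=.
have [h1 h2] : x \in xs /\ y \in ys.
  elim: xs ys xy {hx hy} => [|x' xs IH] [|y' ys] //=; rewrite !inE => /orP[/eqP[-> ->]|/IH[-> ->]].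
    by rewrite !eqxx.
  by rewrite !orbT.
by rewrite hx ?hy.
Qed.

Lemma tscope_pads vs ws : n \in vs -> {subset ws <= vs} -> tscope tau vs (pads ws).
Proof.
move=> nv h; apply: tscope_tconj => //; rewrite all_map; apply/allP => x /h /= ->.
by rewrite nv.
Qed.

Definition scoped (rho : nat -> nat) (fenv : nat -> block) (fs : seq (nat * nat)) (vs : seq nat) :=
  [/\ {subset iota 0 n.+2 <= vs}, (forall x, rho x \in vs) &
      forall g k, flook fs g = Some k ->
        {subset bvals (fenv g) <= vs} /\ {subset bflags (fenv g) <= vs}].

Lemma scoped_sub rho fenv fs vs vs' : {subset vs <= vs'} -> scoped rho fenv fs vs ->
  scoped rho fenv fs vs'.
Proof.
move=> s [h1 h2 h3]; split=> [x /h1 /s //|x|g k /h3[a b]]; first exact/s/h2.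
by split=> x; [move/a | move/b]; apply: s.
Qed.

Lemma scoped_updr rho fenv fs vs xs zs : size xs = size zs -> scoped rho fenv fs vs ->
  {subset zs <= vs} -> scoped (updr rho xs zs) fenv fs vs.
Proof.
move=> sz [h1 h2 h3] h; split=> // x; rewrite /updr; case: ifP => // xx.
by apply: h; rewrite mem_nth // -sz index_mem.
Qed.

Lemma iota_split (a b c : nat) : (a + b <= c)%N -> {subset iota a b <= iota 0 c}.
Proof. by move=> abc x; rewrite !mem_iota; lia. Qed.

Lemma tscope_evT fs vsE fenv i rho L w vs : ntwf n fs vsE i -> scoped rho fenv fs vs ->
  (need i <= L)%N -> {subset iota w L <= vs} -> tscope tau vs (evT fenv i rho L w).
Proof.
move=> wf sc; have [h1 _ h3] := sc; have nv : n \in vs by apply: h1; rewrite mem_iota; lia.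
elim: i vsE rho L w wf sc => [c|xs|g xs|i IHi j IHj|i IHi j IHj|ys i IHi] vsE rho L w wf sc nL sw /=;
  have [_ h2 _] := sc.
- by case: ifP => _; [exact: tscope_pads | rewrite /= nv].
- apply/andP; split; first exact: tscope_pads.
  apply/andP; split; last by rewrite /= nv.
  apply: tscope_teqs => //; last by move=> _ /mapP[x _ ->].
  by move=> x; rewrite /= mem_iota => xn; apply: h1; rewrite mem_iota; lia.
- case/andP: wf => /eqP /h3[b1 b2] _.
  apply/andP; split.
    by apply: tscope_pads => // x; rewrite mem_iota => xn; apply: sw; rewrite mem_iota; lia.
  apply/andP; split; last exact: tscope_pads.
  by apply: tscope_teqs => // _ /mapP[x _ ->].
- have nv1 : n.+1 \in vs by apply: h1; rewrite mem_iota; lia.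
  case/andP: wf => w1 w2; move: nL => /=; rewrite gtn_max => /andP[n1 n2].
  have sw' : {subset iota w.+1 L.-1 <= vs}.
    by move=> x; rewrite mem_iota => xn; apply: sw; rewrite mem_iota; lia.
  have wv : w \in vs by apply: sw; rewrite mem_iota; lia.
  by rewrite nv nv1 wv (IHi vsE) ?(IHj vsE) //; lia.
- by rewrite nv.
- case/andP: wf => u w1; apply: (IHi (ys ++ vsE)) => //.
  + apply: scoped_updr => //; first by rewrite size_iota.
    by move=> x; rewrite mem_iota => xn; apply: sw; rewrite mem_iota; move: nL => /=; lia.
  + by move: nL => /=; lia.
  by move=> x; rewrite mem_iota => xn; apply: sw; rewrite mem_iota; move: nL => /=; lia.
Qed.

Lemma tscope_tr q fs vsE rho fenv ctx w vs : ewf tau n fs vsE q -> scoped rho fenv fs vs ->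
  {subset ctx <= vs} -> tscope tau vs (tr q rho fenv ctx w).
Proof.
have bind x w' rho' fenv' fs' ctx' vs' : scoped rho' fenv' fs' vs' -> {subset ctx' <= vs'} ->
    scoped (updr rho' [:: x] [:: w']) fenv' fs' (w' :: vs') /\ {subset w' :: ctx' <= w' :: vs'}.
  move=> sc sctx; split; last by move=> y; rewrite !inE => /orP[->//|/sctx ->]; rewrite orbT.
  apply: scoped_updr => //; last by move=> y; rewrite !inE => ->.
  by apply: scoped_sub sc => y xv; rewrite inE xv orbT.
elim: q fs vsE rho fenv ctx w vs => [x y|x y|e i j|e i j|r xs|r xs|p IHp q IHq|p IHp q IHq|x p IHp|x p IHp|g k p IHp]
  fs vsE rho fenv ctx w vs wf sc sctx /=.
- by have [_ h _] := sc; rewrite !h.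
- by have [_ h _] := sc; rewrite !h.
- case/andP: wf => w1 w2; set L := maxn _ _; apply: tscope_talls => /=.
  set V := rev _ ++ vs.
  have sV : {subset vs <= V} by move=> x xv; rewrite mem_cat xv orbT.
  have sL : {subset iota w L <= V} by move=> x xv; rewrite mem_cat mem_rev xv.
  have sc1 : scoped rho fenv fs ((w + L)%N :: V).
    by apply: scoped_sub sc => x /sV xv; rewrite inE xv orbT.
  have sc2 : scoped rho fenv fs [:: (w + L).+1, (w + L)%N & V].
    by apply: scoped_sub sc1 => x xv; rewrite inE xv orbT.
  have t1 : tscope tau ((w + L)%N :: V) (evT fenv i rho L w).
    apply: (tscope_evT w1 sc1); first exact: leq_maxl.
    by move=> x /sL xv; rewrite inE xv orbT.
  have t2 : tscope tau [:: (w + L).+1, (w + L)%N & V] (evT fenv j rho L w).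
    apply: (tscope_evT w2 sc2); first exact: leq_maxr.
    by move=> x /sL xv; rewrite !inE xv !orbT.
  have [h1 _ _] := sc.
  have nv : n \in V by apply/sV/h1; rewrite mem_iota; lia.
  have nv1 : n.+1 \in V by apply/sV/h1; rewrite mem_iota; lia.
  rewrite t1 (tscope_tneg t1) t2 (tscope_tneg t2) !inE nv nv1 !eqxx !orbT !size_rcons eqxx /=.
  rewrite !all_rcons /= !inE !eqxx !orbT /=.
  by apply/andP; split; apply/allP => x /sctx /sV xv; rewrite -[mem _ _]/(x \in _) !inE xv !orbT.
- have [h1 _ _] := sc; have nv : n \in vs by apply: h1; rewrite mem_iota; lia.
  by rewrite nv.
- have [_ h _] := sc; case/and3P: wf => -> /eqP s1 _; rewrite size_map s1 eqxx /=.
  by apply/allP => _ /mapP[x _ ->]; exact: h.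
- have [_ h _] := sc; case/and3P: wf => -> /eqP s1 _; rewrite size_map s1 eqxx /=.
  by apply/allP => _ /mapP[x _ ->]; exact: h.
- by case/andP: wf => w1 w2; rewrite (IHp fs vsE) ?(IHq fs vsE).
- case/andP: wf => w1 w2.
  case: ifP => _; first by rewrite /= tscope_tneg (IHp fs vsE) ?(IHq fs vsE).
  case: ifP => _; first by rewrite /= tscope_tneg (IHq fs vsE) ?(IHp fs vsE).
  have sc' : scoped rho fenv fs (w :: vs) by apply: scoped_sub sc => x xv; rewrite inE xv orbT.
  have sctx' : {subset ctx <= w :: vs} by move=> x /sctx xv; rewrite inE xv orbT.
  have [h1 _ _] := sc; have nv : n \in vs by apply: h1; rewrite mem_iota; lia.
  rewrite /= (IHp fs vsE) ?(IHq fs vsE) // !inE eqxx nv !orbT /= !andbT.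
  by apply/allP => x /sctx'.
- have [sc' sctx'] := bind x w _ _ _ _ _ sc sctx; rewrite (IHp fs (x :: vsE)) // inE eqxx /= !andbT.
  by apply/allP => y yc; apply: sctx'; rewrite inE yc orbT.
- by have [sc' sctx'] := bind x w _ _ _ _ _ sc sctx; rewrite (IHp fs (x :: vsE)).
- apply: tscope_talls => /=; apply: (IHp ((g, k) :: fs) vsE) => //; last first.
    by move=> x /sctx xv; rewrite !inE mem_cat xv !orbT.
  have [h1 h2 h3] : scoped rho fenv fs ((w + k)%N :: rev (iota w k) ++ vs).
    by apply: scoped_sub sc => x xv; rewrite inE mem_cat xv !orbT.
  split=> // g' k' /=; rewrite [g == _]eq_sym; case: eqP => _; last exact: h3.
  by move=> _ /=; split=> x; rewrite !inE ?mem_cat ?mem_rev => ->; rewrite ?orbT.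
Qed.

End Scope.

(** In an almost conjunctive formula each disjunction has a first-order side, so one of the guarded
    clauses applies and the clause with [TDep] is never reached. *)
Lemma no_dep_tr_qf q rho fenv ctx w : qfree q -> almost_conj q -> no_dep (tr q rho fenv ctx w).
Proof.
elim: q rho fenv ctx w => [x y|x y|e i j|e i j|r xs|r xs|p IHp q IHq|p IHp q IHq|x p IHp|x p IHp|g k p IHp]
  rho fenv ctx w //=.
- move=> _ _; rewrite no_dep_talls /=.
  have e1 i' L u : no_dep (evT fenv i' rho L u) by apply/no_dep_tfo/tfo_evT.
  by rewrite !no_dep_tneg ?e1.
- by move=> /andP[q1 q2] /andP[a1 a2]; rewrite IHp ?IHq.
- move=> /andP[q1 q2] /and3P[a0 a1 a2]; rewrite /fo q1 q2 /=.
  case/orP: a0 => a0; first by rewrite a0 /= no_dep_tneg IHp ?IHq.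
  by case: ifP => _; rewrite ?a0 /= no_dep_tneg ?IHp ?IHq.
Qed.

Lemma no_dep_tr q rho fenv ctx w : prefFA q -> almost_conj q -> no_dep (tr q rho fenv ctx w).
Proof.
have pA p r f c u : prefA p -> almost_conj p -> no_dep (tr p r f c u).
  elim: p r f c u => [x y|x y|e i j|e i j|b xs|b xs|p _ p' _|p _ p' _|x p _|x p IHp|g k p _] r f c u;
    try exact: no_dep_tr_qf.
  exact: IHp.
elim: q rho fenv ctx w => [x y|x y|e i j|e i j|b xs|b xs|p _ p' _|p _ p' _|x p _|x p _|g k p IHp] rho fenv ctx w;
  try exact: pA.
by move=> p1 p2; rewrite /= no_dep_talls; apply: IHp.
Qed.

End Translate.

(** * Events have the probabilities of numerical terms *)

Section Correct.
Variables (A : finType) (rel : nat -> seq A -> bool) (M n : nat) (f : n.-tuple A -> R).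
Variable tau : vocab.
Hypothesis A1 : (1 < #|A|)%N.
Notation T := {ffun 'I_M.+1 -> A}.
Notation cv := n.
Notation dv := n.+1.
Notation le_M := (all (fun x => (x <= M)%N)).
Let A0 : (0 < #|A|)%N := ltnW A1.
Let cA : #|A|%:R != 0 :> R := cardA_neq0 A0.
Let cAX k : #|A|%:R ^+ k != 0 :> R. Proof. by rewrite expf_neq0. Qed.

Lemma tfval_tconj v ps : tfval rel v (tconj n ps) = all (tfval rel v) ps.
Proof. by elim: ps => [|p ps IH] /=; rewrite ?eqxx // IH. Qed.

Lemma tfval_pads v ws : tfval rel v (pads n ws) = all (fun x => v x == v cv) ws.
Proof. by rewrite tfval_tconj all_map. Qed.

Lemma tfval_teqs v xs ys : size xs = size ys -> tfval rel v (teqs n xs ys) = (map v xs == map v ys).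
Proof.
rewrite tfval_tconj all_map; elim: xs ys => [|x xs IH] [|y ys] //= [e].
by rewrite IH // eqseq_cons.
Qed.

Definition bev (b : block) (v : seq A) (t : T) : bool :=
  (map (gv t) (bvals b) == v) && all (fun x => gv t x == gv t cv) (bflags b).

Lemma tfval_evB b pat t : size pat = size (bvals b) ->
  tfval rel (gv t) (evB n b pat) = bev b (map (gv t) pat) t.
Proof. by move=> e; rewrite /= tfval_teqs // tfval_pads. Qed.

(** [phi] takes an assignment as argument because a function quantified below first-order
    quantifiers varies with their values. *)
Definition bok (w : nat) (b : block) (G : T -> R) (ctx : seq nat) (phi : T -> seq A -> R) :=
  [/\ (forall x, x \in bvals b -> (x < w)%N), (forall x, x \in bflags b -> (x < w)%N) &
   forall t0 v, size v = size (bvals b) ->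
     mass G ctx t0 (bev b v) = mass G ctx t0 xpredT * phi t0 v / #|A|%:R ^+ bexp b].

Lemma bev_indep b v x w : (forall x, x \in bvals b -> (x < w)%N) ->
  (forall x, x \in bflags b -> (x < w)%N) -> (cv < w)%N -> (w <= x)%N -> (x <= M)%N ->
  indep x (bev b v).
Proof.
move=> h1 h2 h3 wx xM t a; rewrite /bev; congr (_ && _).
  rewrite map_ups //; first by apply/allP => y /h1; nlia.
  by apply/negP => /h1; nlia.
apply: eq_in_all => y /h2 yw; rewrite !gv_ups_ne //; nlia.
Qed.

(** [fe t] is the function environment attached to the context of [t]. Blocks are constrained only
    through their separate conditional distributions given the context; nothing is said about their
    joint distribution. *)
Record team_inv (rho : nat -> nat) (fenv : nat -> block) (fs : seq (nat * nat)) (ctx : seq nat)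
  (w : nat) (G : T -> R) (fe : T -> nat -> seq A -> R) : Prop := TeamInv {
  inv_nn : nn G;
  inv_w : (w <= M.+1)%N;
  inv_lt : forall x, x \in ctx -> (x < w)%N;
  inv_c : cv \in ctx;
  inv_d : dv \in ctx;
  inv_cd : forall t, 0 < G t -> gv t cv != gv t dv;
  inv_rho : forall x, rho x \in ctx;
  inv_fe : forall t t', agree ctx t t' -> fe t = fe t';
  inv_f : bok w (bfree n) G ctx (fun _ => fext f);
  inv_g : forall g k, flook fs g = Some k ->
    [/\ bexp (fenv g) = k, size (bvals (fenv g)) = k & bok w (fenv g) G ctx (fun t => fe t g)] }.

Section InvFacts.
Variables (rho : nat -> nat) (fenv : nat -> block) (fs : seq (nat * nat)) (ctx : seq nat).
Variables (w : nat) (G : T -> R) (fe : T -> nat -> seq A -> R).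
Hypothesis I : team_inv rho fenv fs ctx w G fe.

Lemma inv_leM : le_M ctx.
Proof. by apply/allP => x /(inv_lt I); have := inv_w I; nlia. Qed.

Lemma inv_fresh x : (w <= x)%N -> x \notin ctx.
Proof. by move=> wx; apply/negP => /(inv_lt I); nlia. Qed.

Lemma inv_mass_cd t0 : 0 < mass G ctx t0 xpredT -> gv t0 cv != gv t0 dv.
Proof.
move=> /(mass_gt0 (inv_nn I)) [t [/agreeP o _ /(inv_cd I)]].
by rewrite !o ?(inv_c I) ?(inv_d I).
Qed.

Lemma inv_gvrho (t t' : T) : agree ctx t t' -> (fun x => gv t (rho x)) = (fun x => gv t' (rho x)).
Proof.
move=> /agreeP o; apply: functional_extensionality => x; apply/esym/o; exact: inv_rho I x.
Qed.

Lemma bok_transfer G' ctx' w' b phi (la : T -> R) : bok w b G ctx phi -> (w <= w')%N ->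
  (forall t0 (P : pred T), (forall x, (w <= x)%N -> (x <= M)%N -> indep x P) ->
     mass G' ctx' t0 P = la t0 * mass G ctx t0 P) ->
  bok w' b G' ctx' phi.
Proof.
case=> h1 h2 h3 ww h; split.
- by move=> x /h1; nlia.
- by move=> x /h2; nlia.
move=> t0 v sv; rewrite !h //; first by rewrite h3 // !mulrA.
move=> x wx xM; apply: bev_indep h1 h2 _ wx xM; exact: (inv_lt I (inv_c I)).
Qed.

(** Multiplying all masses over a context by one factor, here [la t0], leaves the conditional
    probabilities of old events unchanged. Every change of the weight below is treated by a suitable
    [la]: a power of [#|A|] or an indicator. *)
Lemma inv_transfer rho' G' ctx' w' (la : T -> R) : nn G' -> (w <= w')%N -> (w' <= M.+1)%N ->
  {subset ctx <= ctx'} -> (forall x, x \in ctx' -> (x < w')%N) -> (forall x, rho' x \in ctx') ->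
  (forall t0 (P : pred T), (forall x, (w <= x)%N -> (x <= M)%N -> indep x P) ->
     mass G' ctx' t0 P = la t0 * mass G ctx t0 P) ->
  team_inv rho' fenv fs ctx' w' G' fe.
Proof.
move=> G'0 ww w'M s lt r h; split=> //.
- exact/s/(inv_c I).
- exact/s/(inv_d I).
- move=> t Gt; apply/negP => /eqP e.
  have cw := inv_lt I (inv_c I); have dw := inv_lt I (inv_d I).
  have : 0 < mass G' ctx' t (fun t => gv t cv == gv t dv).
    by apply: (mass_gt0' (t := t)) => //; [exact: agree_refl | exact/eqP].
  rewrite h; last first.
    by move=> x wx xM t' a; rewrite !gv_ups_ne //; nlia.
  rewrite /mass big1 ?mulr0 ?ltxx // => t' /andP[_ /eqP e'].
  by apply: (nn_eq0 (inv_nn I)) => /(inv_cd I); rewrite e' eqxx.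
- by move=> t t' /(agree_sub s) /(inv_fe I).
- exact: bok_transfer (inv_f I) ww h.
- move=> g k /(inv_g I) [e1 e2 e3]; split=> //; exact: bok_transfer e3 ww h.
Qed.

Lemma iota_fresh j k x : (w <= j)%N -> x \in iota j k -> x \notin ctx.
Proof. by move=> wj; rewrite mem_iota => xj; apply: inv_fresh; nlia. Qed.

Lemma iota_leM j k : (j + k <= M.+1)%N -> le_M (iota j k).
Proof. by move=> h; apply/allP => x; rewrite mem_iota; nlia. Qed.

Lemma mass_dups_eq k v t0 (P : pred T) : (w + k <= M.+1)%N -> size v = k ->
  (forall x, (w <= x)%N -> (x <= M)%N -> indep x P) ->
  mass (dups (iota w k) G) ctx t0 (fun t => (map (gv t) (iota w k) == v) && P t) =
  mass G ctx t0 P / #|A|%:R ^+ k.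
Proof.
move=> wk sv iP; have zM := iota_leM wk; have cM := inv_leM.
have d x : x \in iota w k -> x \notin ctx by apply: iota_fresh.
rewrite -mass_upl ?iota_uniq ?size_iota // mass_dups_at ?iota_uniq ?size_iota //.
  by congr (_ / _); apply/esym/mass_congr/agree_upl.
by move=> x; rewrite mem_iota => xw; apply: iP; nlia.
Qed.

Lemma inv_dups0 k : (w + k <= M.+1)%N -> team_inv rho fenv fs ctx (w + k) (dups (iota w k) G) fe.
Proof.
move=> wk; apply: (inv_transfer (la := fun _ => 1)) => //.
- exact/dups_nn/(inv_nn I).
- by nlia.
- by move=> x /(inv_lt I); nlia.
- exact: inv_rho I.
move=> t0 P iP; rewrite mul1r mass_dups //.
- exact: iota_leM.
- exact: inv_leM.
- by move=> x; apply: iota_fresh.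
- by move=> x; rewrite mem_iota => xw; apply: iP; nlia.
Qed.

Lemma inv_dups k rho' : (w + k <= M.+1)%N -> (forall x, rho' x \in iota w k ++ ctx) ->
  team_inv rho' fenv fs (iota w k ++ ctx) (w + k) (dups (iota w k) G) fe.
Proof.
move=> wk r; apply: (inv_transfer (la := fun _ => (#|A|%:R ^+ k)^-1)) => //.
- exact/dups_nn/(inv_nn I).
- by nlia.
- by move=> x xc; rewrite mem_cat xc orbT.
- by move=> x; rewrite mem_cat mem_iota => /orP[|/(inv_lt I)]; nlia.
move=> t0 P iP; rewrite mulrC mass_dups_at ?size_iota ?iota_uniq //.
- exact: iota_leM.
- exact: inv_leM.
- by move=> x; apply: iota_fresh.
- by move=> x; rewrite mem_iota => xw; apply: iP; nlia.
Qed.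

Lemma gv_upl_updr ys k v (t0 : T) x : (w + k <= M.+1)%N -> size ys = k -> size v = k ->
  gv (upl t0 (iota w k) v) (updr rho ys (iota w k) x) = updl (fun x => gv t0 (rho x)) ys v x.
Proof.
move=> wk sy sv; rewrite /updr [RHS]/updl; case: (boolP (x \in ys)) => xy.
  have ix : (index x ys < k)%N by rewrite -sy index_mem.
  rewrite nth_iota // gv_upl; last by nlia.
  rewrite /updl mem_iota ifT; last by nlia.
  have -> : index (w + index x ys)%N (iota w k) = index x ys.
    by rewrite -{1}(nth_iota 0%N w ix) index_uniq ?size_iota ?iota_uniq.
  by apply: set_nth_default; rewrite sv.
have rc := inv_rho I x; rewrite gv_upl ?updl_notin //; last exact: (allP inv_leM).
by apply/negP => /(iota_fresh (leqnn w)); rewrite rc.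
Qed.

Lemma pads_mass k t0 (P : pred T) : (w + k <= M.+1)%N ->
  (forall x, (w <= x)%N -> (x <= M)%N -> indep x P) ->
  mass (dups (iota w k) G) ctx t0 (fun t => tfval rel (gv t) (pads n (iota w k)) && P t) =
  mass G ctx t0 P / #|A|%:R ^+ k.
Proof.
move=> wk iP; rewrite -(mass_dups_eq (v := nseq k (gv t0 cv)) t0 wk _ iP) ?size_nseq //.
apply: mass_eqP => t /agreeP o; rewrite tfval_pads -(o _ (inv_c I)); congr (_ && _).
apply/allP/eqP => [h|h x xi].
  apply: (@eq_from_nth _ (gv t cv)); rewrite size_map size_iota ?size_nseq // => i ik.
  by rewrite (nth_map 0%N) ?size_iota // nth_nseq ik; apply/eqP/h/mem_nth; rewrite size_iota.
have : gv t x \in map (gv t) (iota w k) by apply: map_f.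
by rewrite h mem_nseq => /andP[].
Qed.

(** The padding contributes [L - bexp b] factors and the scaling of the block the remaining
    [bexp b]; the last [bexp b] uniform variables are left free. *)
Lemma evB_mass b phi xs L t0 : bok w b G ctx phi -> size (bvals b) = size xs ->
  (bexp b <= L)%N -> (w + L <= M.+1)%N ->
  mass (dups (iota w L) G) ctx t0
    (fun t => tfval rel (gv t) (TAnd (pads n (iota w (L - bexp b))) (evB n b (map rho xs)))) =
  mass G ctx t0 xpredT * phi t0 (map (fun x => gv t0 (rho x)) xs) / #|A|%:R ^+ L.
Proof.
move=> [b1 b2 bE] sb bL wL; set k := (L - bexp b)%N.
have Lk : L = (k + bexp b)%N by rewrite /k subnK.
have cw := inv_lt I (inv_c I).
rewrite {1}Lk iotaD dups_cat.
pose P := bev b (map (fun x => gv t0 (rho x)) xs).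
have iP x : (w <= x)%N -> (x <= M)%N -> indep x P by apply: bev_indep.
have wk : (w + k <= M.+1)%N by nlia.
transitivity (mass (dups (iota (w + k) (bexp b)) (dups (iota w k) G)) ctx t0
   (fun t => tfval rel (gv t) (pads n (iota w k)) && P t)).
  apply: mass_eqP => t o; rewrite [LHS]/= -[tfval _ _ (teqs _ _ _) && _]/(tfval rel (gv t) (evB n b (map rho xs))).
  rewrite tfval_evB ?size_map // /P -map_comp; congr (_ && bev b _ t).
  by apply: eq_map => x; apply: (agreeP _ _ _ o); apply: inv_rho I x.
rewrite mass_dups //.
- rewrite pads_mass // /P bE ?size_map // Lk exprD -/k.
  by rewrite -[RHS]mulrA [in RHS]invfM -!mulrA; congr (_ * (_ * _)); rewrite mulrC.
- by apply: iota_leM; nlia.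
- exact: inv_leM.
- by move=> x; apply: iota_fresh; nlia.
move=> x; rewrite mem_iota => xw t a; rewrite iP; [|nlia|nlia].
congr (_ && _); rewrite !tfval_pads; apply: eq_in_all => y; rewrite mem_iota => yw.
by rewrite !gv_ups_ne //; nlia.
Qed.

End InvFacts.

Lemma tfval_evT_scope fs vsE fenv i rho L w ctx G fe (t t' : T) :
  team_inv rho fenv fs ctx w G fe -> ntwf n fs vsE i -> (need i <= L)%N ->
  (forall x, (x < w + L)%N -> gv t x = gv t' x) ->
  tfval rel (gv t) (evT n fenv i rho L w) = tfval rel (gv t') (evT n fenv i rho L w).
Proof.
move=> I wf nL h; have cw := inv_lt I (inv_d I).
apply: (tfval_scope _ (vs := iota 0 (w + L)) (tau := tau)); [|exact: tfo_evT|]; last first.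
  by move=> x; rewrite mem_iota => xw; apply: h; nlia.
apply: tscope_evT wf _ nL _; last by apply: iota_split; nlia.
split; first by apply: iota_split; nlia.
  by move=> x; have := inv_lt I (inv_rho I x); rewrite mem_iota; nlia.
move=> g k /(inv_g I) [_ _ [h1 h2 _]]; split=> x; rewrite mem_iota.
  by move=> /h1; nlia.
by move=> /h2; nlia.
Qed.

(** By induction on the term: the selector variable of an addition takes each of the values of [cv]
    and [dv] with conditional probability [1 / #|A|], and a [SUM] is the partition of its event by
    the values of the uniform variables standing for the bound ones. *)
Lemma evT_mass i fs vsE fenv rho L w ctx G fe t0 :
  team_inv rho fenv fs ctx w G fe -> ntwf n fs vsE i -> nt_in true false true C01 i ->
  (need i <= L)%N -> (w + L <= M.+1)%N ->
  mass (dups (iota w L) G) ctx t0 (fun t => tfval rel (gv t) (evT n fenv i rho L w)) =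
  mass G ctx t0 xpredT * nval f (fe t0) (fun x => gv t0 (rho x)) i / #|A|%:R ^+ L.
Proof.
elim: i vsE rho L w ctx G t0 => [c|xs|g xs|i IHi j IHj|i IHi j IHj|ys i IHi] vsE rho L w ctx G t0 I wf cl nL wL.
- rewrite [nval _ _ _ _]/= [evT _ _ _ _ _ _]/=; case: cl => ->.
    rewrite eq_sym oner_eq0 mulr0 mul0r /mass big_pred0 // => t.
    by rewrite /= eqxx andbF.
  rewrite eqxx mulr1 -(pads_mass I t0 wL (P := xpredT)) //.
  by apply: mass_eqP => t _; rewrite andbT.
- have [/eqP sx _] := andP wf; have b := inv_f I.
  rewrite /= -[X in _ * X / _]/(fext f (map (fun x => gv t0 (rho x)) xs)).
  rewrite -(evB_mass I t0 (xs := xs) b) // ?size_iota ?sx //.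
  by rewrite subn0.
- have [/eqP fl _] := andP wf; have [e1 e2 b] := inv_g I fl.
  by rewrite /= -(evB_mass I t0 b) ?e1 ?e2.
- have [w1 w2] := andP wf; case: cl => _ [c1 c2]; have L0 : (0 < L)%N by move: nL => /=; nlia.
  have wM : (w <= M)%N by nlia.
  have wc := inv_fresh I (leqnn w).
  have cM := inv_leM I.
  pose G1 := dup w G.
  have ->  : dups (iota w L) G = dups (iota w.+1 L.-1) G1 by case: (L) L0.
  (* Over a context of mass 0 both sides vanish; otherwise the two constants differ there, and the
     alternatives of the sum are disjoint. *)
  have [z|m0] := boolP (0 < mass G ctx t0 xpredT); last first.
    have z := mass_eq0 (inv_nn I) m0.
    rewrite z !mul0r; apply: mass0; first by apply/dups_nn/dup_nn/(inv_nn I).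
    rewrite -z mass_dups //; first by apply: mass_dup.
      by apply: iota_leM; nlia.
    by move=> x; apply: (iota_fresh I); nlia.
  have cd := inv_mass_cd I z.
  have I1 : team_inv rho fenv fs (w :: ctx) w.+1 G1 fe.
    have := @inv_dups _ _ _ _ _ _ _ I 1 rho; rewrite addn1 /= => h; apply: h => // x.
    by rewrite inE (inv_rho I) orbT.
  have key k x (t1 := ups t0 w (gv t0 x)) :
      mass (dups (iota w.+1 L.-1) G1) (w :: ctx) t1 (fun t => tfval rel (gv t) (evT n fenv k rho L.-1 w.+1)) =
      mass G1 (w :: ctx) t1 xpredT * nval f (fe t1) (fun y => gv t1 (rho y)) k / #|A|%:R ^+ L.-1 ->
      x \in ctx ->
      mass (dups (iota w.+1 L.-1) G1) ctx t0 (fun t => (gv t w == gv t x) && tfval rel (gv t) (evT n fenv k rho L.-1 w.+1)) =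
      mass G ctx t0 xpredT * nval f (fe t0) (fun x => gv t0 (rho x)) k / #|A|%:R ^+ L.
    move=> IH xc; have o1 : agree ctx t0 t1 by apply: agree_ups.
    transitivity (mass (dups (iota w.+1 L.-1) G1) (w :: ctx) t1 (fun t => tfval rel (gv t) (evT n fenv k rho L.-1 w.+1))).
      rewrite mass_cons gv_ups -(mass_congr _ _ o1).
      by apply: mass_eqP => t /agreeP o; rewrite (o x).
    rewrite IH mass_dup_at // -(mass_congr _ _ o1) -(inv_fe I o1).
    have -> : (fun y => gv t1 (rho y)) = (fun y => gv t0 (rho y)) by rewrite (inv_gvrho I o1).
    by rewrite -[in RHS](prednK L0) exprS invfM mulrACA mulrA; congr (_ / _); rewrite mulrAC.
  have /andP[n1 n2] : (need i <= L.-1)%N && (need j <= L.-1)%N.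
    by rewrite -geq_max -ltnS prednK.
  have wL1 : (w.+1 + L.-1 <= M.+1)%N by rewrite addSnnS prednK.
  have K1 := key i cv (IHi _ _ _ _ _ _ _ I1 w1 c1 n1 wL1) (inv_c I).
  have K2 := key j dv (IHj _ _ _ _ _ _ _ I1 w2 c2 n2 wL1) (inv_d I).
  transitivity (mass (dups (iota w.+1 L.-1) G1) ctx t0 (fun t => (gv t w == gv t cv) && tfval rel (gv t) (evT n fenv i rho L.-1 w.+1)) +
     mass (dups (iota w.+1 L.-1) G1) ctx t0 (fun t => (gv t w == gv t dv) && tfval rel (gv t) (evT n fenv j rho L.-1 w.+1))).
    rewrite /mass [LHS](bigID (fun t : T => gv t w == gv t cv)) /=; congr (_ + _); apply: eq_bigl => t.
      case: (boolP (agree ctx t0 t)) => //= /agreeP o; rewrite (o cv (inv_c I)) (o dv (inv_d I)).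
      have [->|] := eqVneq (gv t w) (gv t0 cv); last by rewrite andbF.
      by rewrite (negbTE cd) /= orbF andbT.
    case: (boolP (agree ctx t0 t)) => //= /agreeP o; rewrite (o cv (inv_c I)) (o dv (inv_d I)).
    have [->|] := eqVneq (gv t w) (gv t0 cv); last by rewrite andbT.
    by rewrite (negbTE cd) /= andbF.
  by rewrite K1 K2 -mulrDl -mulrDr.
- by case: cl.
- have [u w1] := andP wf; case: cl => _ c1; set k := size ys.
  have kL : (k <= L)%N by move: nL => /=; rewrite -/k; nlia.
  have wk : (w + k <= M.+1)%N by nlia.
  have zM := iota_leM wk; have cM := inv_leM I.
  have d x : x \in iota w k -> x \notin ctx by apply: (iota_fresh I).
  rewrite -{1}(subnKC kL) iotaD dups_cat.
  set G1 := dups (iota w k) G; set X := dups _ G1; set E := (fun t : T => _).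
  have rc x : updr rho ys (iota w k) x \in iota w k ++ ctx.
    rewrite /updr mem_cat; case: ifP => xy; last by rewrite (inv_rho I) orbT.
    by rewrite mem_nth // size_iota index_mem.
  have I1 := inv_dups I wk rc.
  pose val (t : T) : k.-tuple A := [tuple of map_tuple (gv t) (iota_tuple k w)].
  (* Each cell of the partition is a context enlarged by the uniform variables, where the induction
     hypothesis applies to the summand. *)
  rewrite /mass (partition_big val xpredT) //=.
  transitivity (\sum_(v : k.-tuple A) mass G ctx t0 xpredT *
     nval f (fe t0) (updl (fun x => gv t0 (rho x)) ys v) i / #|A|%:R ^+ L); last first.
    by rewrite -mulr_suml -mulr_sumr.
  apply: eq_bigr => v _.
  have o1 : agree ctx t0 (upl t0 (iota w k) v) by apply: agree_upl.
  transitivity (mass X (iota w k ++ ctx) (upl t0 (iota w k) v) E).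
    rewrite mass_upl ?iota_uniq ?size_tuple ?size_iota //; apply: eq_bigl => t.
    by rewrite -andbA [E t && _]andbC -val_eqE.
  rewrite /X /E (IHi (ys ++ vsE)) //; [|by move: nL => /=; rewrite -/k; nlia|by nlia].
  rewrite mass_dups_at ?iota_uniq // size_iota -(mass_congr _ _ o1) -(inv_fe I o1).
  have -> : (fun x => gv (upl t0 (iota w k) v) (updr rho ys (iota w k) x)) =
     updl (fun x => gv t0 (rho x)) ys v.
    by apply: functional_extensionality => x; apply: (gv_upl_updr I); rewrite ?size_tuple.
  rewrite -[in RHS](subnKC kL) exprD invfM mulrACA mulrA; congr (_ / _).
Qed.

End Correct.

Lemma tfval_tr_fo (A : finType) rel (v : nat -> A) n p rho fenv ctx w : fo p ->
  tfval rel v (tr n p rho fenv ctx w) = foval rel (fun x => v (rho x)) p.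
Proof.
rewrite /fo; elim: p => //= [r xs|r xs|p IHp q IHq|p IHp q IHq].
- by rewrite -map_comp.
- by rewrite -map_comp.
- by rewrite negb_or => /andP[/andP[p1 p2] /andP[p3 p4]]; rewrite IHp ?IHq ?p1 ?p2.
rewrite negb_or => /andP[/andP[p1 p2] /andP[p3 p4]].
rewrite {1}/fo p1 p3 /= tfval_tneg ?tfo_tr /fo ?p1 // IHp ?IHq ?p1 ?p2 //.
by case: (foval _ _ p).
Qed.

Lemma agree_mapE (A : finType) M ctx (t0 t : {ffun 'I_M.+1 -> A}) :
  agree ctx t0 t = (map (gv t) ctx == map (gv t0) ctx).
Proof.
apply/agreeP/eqP => [h|/eq_in_map h]; last by move=> x xc; rewrite h.
by apply/eq_in_map => x xc; rewrite h.
Qed.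

(** * Preservation of the invariant *)

Section TrCorrect.
Variables (A : finType) (rel : nat -> seq A -> bool) (M n : nat) (f : n.-tuple A -> R).
Variable tau : vocab.
Hypothesis A1 : (1 < #|A|)%N.
Notation T := {ffun 'I_M.+1 -> A}.
Notation cv := n.
Notation dv := n.+1.
Let A0 : (0 < #|A|)%N := ltnW A1.
Let cA : #|A|%:R != 0 :> R := cardA_neq0 A0.
Let cAX k : #|A|%:R ^+ k != 0 :> R. Proof. by rewrite expf_neq0. Qed.

Lemma updr1 rho x w (t : T) a (ctx : seq nat) : (w <= M)%N -> (forall y, rho y \in ctx) ->
  (forall y, y \in ctx -> (y < w)%N) ->
  (fun y => gv (ups t w a) (updr rho [:: x] [:: w] y)) = upd (fun y => gv t (rho y)) x a.
Proof.
move=> wM r lt; apply: functional_extensionality => y; rewrite /updr /upd inE.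
case: eqP => [->|_]; first by rewrite /= eqxx gv_ups.
by rewrite gv_ups_ne //; have := lt _ (r y); nlia.
Qed.

Lemma updr1_in rho x w (ctx : seq nat) y : (forall y, rho y \in ctx) -> updr rho [:: x] [:: w] y \in w :: ctx.
Proof.
move=> r; rewrite /updr [y \in _]inE; case: ifP => [/eqP ->|_]; first by rewrite /= eqxx mem_head.
by rewrite inE r orbT.
Qed.

Section Steps.
Variables (rho : nat -> nat) (fenv : nat -> block) (fs : seq (nat * nat)) (ctx : seq nat).
Variables (w : nat) (G : T -> R) (fe : T -> nat -> seq A -> R).
Hypothesis I : team_inv f rho fenv fs ctx w G fe.

(** A context has positive mass exactly when some charged assignment agrees with it. *)
Lemma lit_iff (Q : T -> Prop) : (forall t0 t, agree ctx t0 t -> Q t -> Q t0) ->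
  (forall t, 0 < G t -> Q t) <-> (forall t0, 0 < mass G ctx t0 xpredT -> Q t0).
Proof.
move=> h; split=> H t0.
  by move=> /(mass_gt0 (inv_nn I)) [t [o _ /H]]; apply: h.
by move=> Gt; apply: H; apply: (mass_gt0' (inv_nn I)) Gt => //; apply: agree_refl.
Qed.

(** By the dependence, [w] has at most one charged value over each old context. That value inherits
    the whole mass and the others none, so the factor is an indicator. *)
Lemma ex_transfer x (Y : T -> R) : (w <= M)%N -> nn Y -> mg w Y =1 mg w G ->
  (forall t t', 0 < Y t -> 0 < Y t' -> map (gv t) ctx = map (gv t') ctx -> gv t w = gv t' w) ->
  team_inv f (updr rho [:: x] [:: w]) fenv fs (w :: ctx) w.+1 Y fe.
Proof.
move=> wM Y0 YG dep; have cM := inv_leM I; have wc := inv_fresh I (leqnn w).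
apply: (inv_transfer (la := fun t0 => (0 < mass Y (w :: ctx) t0 xpredT)%R%:R) I) => //.
- by move=> y yc; rewrite inE yc orbT.
- by move=> y; rewrite inE => /orP[/eqP->|/(inv_lt I)] //; nlia.
- by move=> y; apply: updr1_in; apply: inv_rho I.
move=> t0 P iP; case: (boolP (0 < _)) => h; last first.
  by rewrite mul0r; apply: mass0 => //; apply: mass_eq0.
rewrite mul1r; have [t1 [o1 _ Y1]] := mass_gt0 Y0 h.
rewrite -(mass_mg A0 t0 wM cM wc (iP w (leqnn w) wM) YG).
rewrite mass_cons /mass [RHS]big_mkcond [LHS]big_mkcond; apply: eq_bigr => t _.
case: (boolP (agree ctx t0 t)) => //= o; case: (boolP (P t)) => _; last by rewrite andbF.
rewrite andbT; case: eqP => // ne; apply/esym/nn_eq0 => // Yt.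
have o1' : agree ctx t0 t1 by apply: agree_sub o1 => y yc; rewrite inE yc orbT.
apply: ne; rewrite (dep t t1) //; first by apply: (agreeP _ _ _ o1); rewrite inE eqxx.
by rewrite (agree_map o (xs := ctx)) ?(agree_map o1' (xs := ctx)).
Qed.

(** The dependence of [w] on the context makes each branch keep or drop the mass over a context as a
    whole, so conditional probabilities survive the split. *)
Lemma or_transfer b (Y : T -> R) : (w <= M)%N -> nn Y -> mg w Y =1 mg w G ->
  (forall t t', 0 < Y t -> 0 < Y t' -> map (gv t) ctx = map (gv t') ctx -> gv t w = gv t' w) ->
  team_inv f rho fenv fs ctx w.+1 (on (fun t => (gv t w == gv t cv) == b) Y) fe.
Proof.
move=> wM Y0 YG dep; have cM := inv_leM I; have wc := inv_fresh I (leqnn w).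
set Yb := on _ Y; have Yb0 : nn Yb by apply: on_nn.
apply: (inv_transfer (la := fun t0 => (0 < mass Yb ctx t0 xpredT)%R%:R) I) => //.
- by move=> y /(inv_lt I); nlia.
- exact: inv_rho I.
move=> t0 P iP; case: (boolP (0 < _)) => h; last first.
  by rewrite mul0r; apply: mass0 => //; apply: mass_eq0.
rewrite mul1r; have [t1 [o1 _ /on_gt0[/eqP b1 Y1]]] := mass_gt0 Yb0 h.
rewrite -(mass_mg A0 t0 wM cM wc (iP w (leqnn w) wM) YG).
apply: eq_bigr => t /andP[o _]; rewrite /Yb /on; case: eqP => // ne.
apply/esym/nn_eq0 => // Yt.
apply: ne; rewrite -b1 (dep t t1) //.
  by rewrite (agreeP _ _ _ o cv (inv_c I)) (agreeP _ _ _ o1 cv (inv_c I)).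
by rewrite (agree_map o (xs := ctx)) ?(agree_map o1 (xs := ctx)).
Qed.

Lemma choose_transfer (h : T -> A) : (w <= M)%N -> (forall t t', agree ctx t t' -> h t = h t') ->
  exists Y, [/\ nn Y, mg w Y =1 mg w G,
    forall t t', 0 < Y t -> 0 < Y t' -> map (gv t) ctx = map (gv t') ctx -> gv t w = gv t' w &
    forall t, 0 < Y t -> exists t', [/\ agree ctx t t', gv t w = h t' & 0 < G t']].
Proof.
move=> wM hE; have cM := inv_leM I; have wc := inv_fresh I (leqnn w).
have Yh t : 0 < pushT (fun t => ups t w (h t)) G t -> exists t', [/\ agree ctx t t', gv t w = h t' & 0 < G t'].
  move=> /(pushT_gt0 (inv_nn I)) [t' <- Gt']; exists t'; split=> //; last by rewrite gv_ups.
  by rewrite agree_sym agree_ups.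
exists (pushT (fun t => ups t w (h t)) G); split=> //; first exact/pushT_nn/(inv_nn I).
  exact: mg_pushT.
move=> t t' /Yh[u [o1 -> _]] /Yh[u' [o2 -> _]] e; apply: hE.
rewrite -(agree_congr _ o1) (agree_congr (t1 := t')) ?o2 //.
by rewrite agree_mapE e.
Qed.

Lemma fo_transfer (P : T -> bool) : (forall t t', agree ctx t t' -> P t = P t') ->
  team_inv f rho fenv fs ctx w (on P G) fe.
Proof.
move=> h; apply: (inv_transfer (la := fun t0 => (P t0)%:R) I) => //.
- exact/on_nn/(inv_nn I).
- exact: inv_w I.
- exact: inv_lt I.
- exact: inv_rho I.
move=> t0 Q _; rewrite /mass mulr_sumr; apply: eq_bigr => t /andP[o _].
by rewrite /on -(h _ _ o); case: (P t0); rewrite ?mul1r ?mul0r.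
Qed.

Lemma fo_mass (P : T -> bool) t0 : (forall t t', agree ctx t t' -> P t = P t') ->
  0 < mass (on P G) ctx t0 xpredT <-> P t0 /\ 0 < mass G ctx t0 xpredT.
Proof.
move=> h; have G0 := inv_nn I; split.
  move=> /(mass_gt0 (on_nn P G0)) [t [o _ /on_gt0[Pt Gt]]]; rewrite (h _ _ o); split=> //.
  exact: (mass_gt0' G0 o).
move=> [Pt /(mass_gt0 G0) [t [o _ Gt]]]; apply: (mass_gt0' (on_nn P G0) o) => //.
by rewrite /on -(h _ _ o) Pt.
Qed.

(** Over a context of positive mass the flags equal [cv] with probabilities proportional to the two
    terms, with the same scale. Comparing these masses gives one direction; in the other, [dv] is
    the complementary event and no other value is charged. *)
Lemma cmp_correct vsE i j : ntwf n fs vsE i -> ntwf n fs vsE j ->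
  nt_in true false true C01 i -> nt_in true false true C01 j ->
  (tmaxv (tr n (ECmp CEq i j) rho fenv ctx w) <= M)%N ->
  wsat rel (tr n (ECmp CEq i j) rho fenv ctx w) G <->
  (forall t0, 0 < mass G ctx t0 xpredT ->
    nval f (fe t0) (fun x => gv t0 (rho x)) i = nval f (fe t0) (fun x => gv t0 (rho x)) j).
Proof.
move=> wi wj ci cj; rewrite [tr _ _ _ _ _ _]/=.
set L := maxn _ _; set e1 := (w + L)%N; set e2 := e1.+1.
set E1 := evT _ _ i _ _ _; set E2 := evT _ _ j _ _ _.
move=> /talls_bound [wM bM].
have e2M : (e2 <= M)%N.
  apply: leq_trans bM; rewrite -/e1 -/e2 [leqRHS]/=.
  by rewrite leq_max; apply/orP; right; rewrite leq_max; apply/orP; right; apply: leq_maxl.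
have e1M : (e1 <= M)%N by rewrite ltnW.
have wL : (w + L <= M.+1)%N by rewrite -/e1; nlia.
have ni : (need i <= L)%N by apply: leq_maxl.
have nj : (need j <= L)%N by apply: leq_maxr.
rewrite wsat_talls; set G1 := dups _ G.
have I1 : team_inv f rho fenv fs ctx e1 G1 fe by apply: (inv_dups0 A1 I wL).
have G10 := inv_nn I1.
have cM := inv_leM I.
pose h (E : tform) (t : T) := if tfval rel (gv t) E then gv t cv else gv t dv.
have cw := inv_lt I1 (inv_c I); have dw := inv_lt I1 (inv_d I).
have ih k e : ntwf n fs vsE k -> (need k <= L)%N -> (e1 <= e)%N -> (e <= M)%N ->
    indep e (h (evT n fenv k rho L w)).
  move=> wk nk ee eM t a; rewrite /h !gv_ups_ne //; try nlia.
  by rewrite (tfval_evT_scope rel tau (t' := t) I wk nk) // => x xw; rewrite gv_ups_ne //; nlia.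
have dE E e t : tfo E -> tfval rel (gv t) (tflag n E e) = (gv t e == h E t).
  by move=> fE; rewrite /= tfval_tneg // /h; case: (tfval rel (gv t) E); rewrite /= ?orbF.
have fE1 : tfo E1 by apply: tfo_evT.
have fE2 : tfo E2 by apply: tfo_evT.
rewrite (wsat_def _ e1M (tfo_tflag _ _ fE1) G10 (ih _ _ wi ni (leqnn _) e1M)); last first.
  by move=> t; apply: dE.
have P0 : nn (pushT (fun t => ups t e1 (h E1 t)) G1) by apply: pushT_nn.
rewrite (wsat_def _ e2M (tfo_tflag _ _ fE2) P0 (ih _ _ wj nj (leqnSn _) e2M)); last first.
  by move=> t; apply: dE.
(* Neither event reads its flag variables, so both flags can be computed from the original
   assignment. *)
pose th t := ups (ups t e1 (h E1 t)) e2 (h E2 t).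
have thE t : ups (ups t e1 (h E1 t)) e2 (h E2 (ups t e1 (h E1 t))) = th t.
  by rewrite /th (ih j e1).
have ctxE t : map (gv (th t)) ctx = map (gv t) ctx.
  rewrite /th !map_ups //; apply/negP => /(inv_lt I1); nlia.
pose S k a be := \sum_(t | (map (gv t) ctx == a) && (h (evT n fenv k rho L w) t == be)) G1 t.
have s1 a be : \sum_(t | map (gv (th t)) (rcons ctx e1) == rcons a be) G1 t =
    S i a be.
  apply: eq_bigl => t; rewrite map_rcons eqseq_rcons ctxE /th gv_ups_ne ?gv_ups //.
  by rewrite neq_ltn ltnSn.
have s2 a be : \sum_(t | map (gv (th t)) (rcons ctx e2) == rcons a be) G1 t =
    S j a be.
  by apply: eq_bigl => t; rewrite map_rcons eqseq_rcons ctxE /th gv_ups.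
have pE (P : pred T) : \sum_(t | P t) pushT (fun t => ups t e2 (h E2 t)) (pushT (fun t => ups t e1 (h E1 t)) G1) t =
    \sum_(t | P (th t)) G1 t.
  rewrite sum_pushT (sum_pushT _ _ (fun t => P (ups t e2 (h E2 t)))).
  by apply: eq_bigl => t; rewrite thE.
have mE t0 : mass G1 ctx t0 xpredT = mass G ctx t0 xpredT.
  by apply: mass_dups => // x; apply: (iota_fresh I).
have mh t0 k : 0 < mass G ctx t0 xpredT -> ntwf n fs vsE k -> nt_in true false true C01 k -> (need k <= L)%N ->
    S k (map (gv t0) ctx) (gv t0 cv) = mass G ctx t0 xpredT * nval f (fe t0) (fun x => gv t0 (rho x)) k / #|A|%:R ^+ L.
  move=> m0 wk ck nk; rewrite /S -(evT_mass rel A1 (vsE := vsE) t0 I wk ck nk wL).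
  apply: eq_bigl => t; rewrite -agree_mapE; case: (boolP (agree ctx t0 t)) => //= /agreeP o.
  rewrite /h (o cv (inv_c I)) (o dv (inv_d I)); case: ifP => _; rewrite ?eqxx //.
  by rewrite eq_sym (negbTE (inv_mass_cd I m0)).
split.
  move=> H t0 m0; have := H (rcons (map (gv t0) ctx) (gv t0 cv)).
  rewrite !size_rcons size_map => /(_ erefl); rewrite !pE s1 s2 !mh //.
  by move/(mulIf (invr_neq0 (cAX L)))/(mulfI (lt0r_neq0 m0)).
move=> H a sa; rewrite !pE; case/lastP: a sa => [|a be]; first by rewrite size_rcons.
rewrite !size_rcons => -[sa]; rewrite s1 s2.
(* A tuple that no assignment realises on [ctx] gives empty sums on both sides. *)
have [|no] := boolP [exists t0 : T, map (gv t0) ctx == a]; last first.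
  rewrite /S !big_pred0 // => t; apply: contraNF no => /andP[/eqP ta _]; apply/existsP; exists t; exact/eqP.
case/existsP => t0 /eqP <-.
have [m0|m0] := boolP (0 < mass G ctx t0 xpredT); last first.
  have z := mass_eq0 (inv_nn I) m0.
  have zz (P : pred T) : \sum_(t | (map (gv t) ctx == map (gv t0) ctx) && P t) G1 t = 0.
    transitivity (mass G1 ctx t0 P); last by apply: mass0 => //; rewrite mE.
    by apply: eq_bigl => t; rewrite -agree_mapE.
  by rewrite /S !zz.
have cd := inv_mass_cd I m0.
have [->|bc] := eqVneq be (gv t0 cv); first by rewrite !mh // H.
have [->|bd] := eqVneq be (gv t0 dv).
  have comp k : ntwf n fs vsE k -> nt_in true false true C01 k -> (need k <= L)%N ->
     S k (map (gv t0) ctx) (gv t0 dv) =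
     mass G ctx t0 xpredT - mass G ctx t0 xpredT * nval f (fe t0) (fun x => gv t0 (rho x)) k / #|A|%:R ^+ L.
    move=> wk ck nk; rewrite -(mh t0 k) // -mE -(mass_split G1 ctx t0 (fun t => h (evT n fenv k rho L w) t == gv t0 cv)).
    rewrite [X in _ = X + _ - _](_ : _ = S k (map (gv t0) ctx) (gv t0 cv)); last first.
      by apply: eq_bigl => t; rewrite agree_mapE.
    rewrite addrAC subrr add0r; apply: eq_bigl => t; rewrite -agree_mapE.
    case: (boolP (agree ctx t0 t)) => //= /agreeP o.
    rewrite /h (o cv (inv_c I)) (o dv (inv_d I)); case: ifP => _; rewrite eqxx ?(negbTE cd) //.
    by rewrite eq_sym cd.
  by rewrite !comp // H.
rewrite /S !big_pred0 // => t; rewrite -agree_mapE; apply/negP => /andP[/agreeP o].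
  rewrite /h (o cv (inv_c I)) (o dv (inv_d I)); case: ifP => _ /eqP e; move: bc bd; rewrite e eqxx //.
rewrite /h (o cv (inv_c I)) (o dv (inv_d I)); case: ifP => _ /eqP e; move: bc bd; rewrite e eqxx //.
Qed.

End Steps.

End TrCorrect.

Section Main.
Variables (A : finType) (rel : nat -> seq A -> bool) (M n : nat) (f : n.-tuple A -> R).
Variable tau : vocab.
Hypothesis A1 : (1 < #|A|)%N.
Notation T := {ffun 'I_M.+1 -> A}.
Notation cv := n.
Notation dv := n.+1.
Let A0 : (0 < #|A|)%N := ltnW A1.
Let cA : #|A|%:R != 0 :> R := cardA_neq0 A0.
Let cAX k : #|A|%:R ^+ k != 0 :> R. Proof. by rewrite expf_neq0. Qed.

(** * Function quantifiers as blocks *)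

Section FunStep.
Variables (rho : nat -> nat) (fenv : nat -> block) (fs : seq (nat * nat)) (ctx : seq nat).
Variables (w k : nat) (G : T -> R) (fe : T -> nat -> seq A -> R) (g : nat).
Hypothesis I : team_inv f rho fenv fs ctx w G fe.
Hypothesis wM : (w + k <= M)%N.
Let zs := iota w k.
Let b := (w + k)%N.
Let blk := Block zs [:: b] k.
Let fenv' := fun g' => if g' == g then blk else fenv g'.
Let G1 := dups zs G.
Let wk : (w + k <= M.+1)%N. Proof. exact: leqW. Qed.

Definition fupd (H : T -> k.-tuple A -> R) : T -> nat -> seq A -> R :=
  fun t g' => if g' == g then fext (H t) else fe t g'.

Lemma vals_mass t0 v : size v = k ->
  mass G1 ctx t0 (fun t => map (gv t) zs == v) = mass G ctx t0 xpredT / #|A|%:R ^+ k.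
Proof.
move=> sv; rewrite -(mass_dups_eq I (P := xpredT) t0 wk sv) //.
by apply: mass_eqP => t _; rewrite andbT.
Qed.

(** The flag [b] is fresh, so older blocks keep their masses, and the new block encodes [H] by
    assumption. *)
Lemma fun_transfer (Y : T -> R) (H : T -> k.-tuple A -> R) : nn Y -> mg b Y =1 mg b G1 ->
  (forall t t', agree ctx t t' -> H t = H t') ->
  (forall t0 (v : k.-tuple A), mass Y ctx t0 (bev n blk v) =
     mass G ctx t0 xpredT * H t0 v / #|A|%:R ^+ k) ->
  team_inv f rho fenv' ((g, k) :: fs) ctx b.+1 Y (fupd H) /\
  (forall t0, mass Y ctx t0 xpredT = mass G ctx t0 xpredT).
Proof.
move=> Y0 YG hH hY; have I1 := inv_dups0 A1 I wk.
have cM := inv_leM I; have bc := inv_fresh I1 (leqnn b).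
have mE t0 (P : pred T) : indep b P -> mass Y ctx t0 P = mass G1 ctx t0 P.
  by move=> iP; apply: (mass_mg A0 t0 wM cM bc iP YG).
have I2 : team_inv f rho fenv fs ctx b.+1 Y fe.
  apply: (inv_transfer (la := fun _ => 1) I1) => //.
  - by move=> x /(inv_lt I); rewrite /b; nlia.
  - exact: inv_rho I.
  by move=> t0 P iP; rewrite mul1r mE //; apply: iP.
split; last first.
  move=> t0; rewrite mE // /G1 mass_dups //; first exact: (iota_leM wk).
  by move=> x; apply: (iota_fresh I).
split; try by case: I2.
- by move=> t t' o; rewrite /fupd (inv_fe I2 o) (hH _ _ o).
move=> g' k' /=; rewrite [g == g']eq_sym /fenv' /fupd; case: eqP => [_ [<-]|_ /(inv_g I2)] //.
rewrite /= size_iota; split=> //; split.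
- by move=> x; rewrite /= mem_iota /b; nlia.
- by move=> x; rewrite /= inE => /eqP->.
move=> t0 v; rewrite /= size_iota => sv.
have sv' : size v == k by apply/eqP.
rewrite -[v]/(tval (Tuple sv')) hY /fext valK.
have -> // : mass Y ctx t0 xpredT = mass G ctx t0 xpredT.
rewrite mE // /G1 mass_dups //; first exact: (iota_leM wk).
by move=> x; apply: (iota_fresh I).
Qed.

(** The conditional distribution of the flag may involve hidden variables; its average over a
    context and a value of [zs] is taken as the function. It is at most 1 because the flag event is
    contained in the event that [zs] has this value. *)
Lemma fun_extract (Y : T -> R) : nn Y -> mg b Y =1 mg b G1 ->
  exists H : T -> k.-tuple A -> R, [/\ (forall t v, 0 <= H t v <= 1),
    (forall t t', agree ctx t t' -> H t = H t') &
    (forall t0 (v : k.-tuple A), mass Y ctx t0 (bev n blk v) =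
     mass G ctx t0 xpredT * H t0 v / #|A|%:R ^+ k)].
Proof.
move=> Y0 YG; have I1 := inv_dups0 A1 I wk; have G0 := inv_nn I.
have cM := inv_leM I; have bc := inv_fresh I1 (leqnn b).
pose m t0 := mass G ctx t0 xpredT.
have le t0 (v : k.-tuple A) : mass Y ctx t0 (bev n blk v) <= m t0 / #|A|%:R ^+ k.
  rewrite -(vals_mass t0 (size_tuple v)) -(mass_mg A0 t0 wM cM bc _ YG).
    by apply: mass_le => // t _ /andP[].
  move=> t a; rewrite map_ups //; first exact: (iota_leM wk).
  by rewrite mem_iota /b; nlia.
have p0 : 0 < #|A|%:R ^+ k :> R by rewrite exprn_gt0 // ltr0n.
exists (fun t0 v => mass Y ctx t0 (bev n blk v) / (m t0 / #|A|%:R ^+ k)); split.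
- move=> t0 v; have m0 : 0 <= m t0 by apply: mass_ge0.
  have q0 : 0 <= m t0 / #|A|%:R ^+ k by rewrite divr_ge0 // ltW.
  rewrite divr_ge0 ?mass_ge0 //=.
  have [->|ne] := eqVneq (m t0 / #|A|%:R ^+ k) 0; first by rewrite invr0 mulr0 ler01.
  by rewrite ler_pdivrMr ?mul1r // lt0r ne.
- move=> t t' o; apply: functional_extensionality => v.
  by rewrite /m !(mass_congr _ _ o).
move=> t0 v; rewrite -/(m t0).
have [z|ne] := eqVneq (m t0) 0; last by field; rewrite ne cAX.
rewrite z !mul0r; apply/eqP; rewrite eq_le mass_ge0 // andbT.
by apply: le_trans (le t0 v) _; rewrite z mul0r.
Qed.

(** Given the context and the values of [zs], the flag is drawn afresh: [cv] with the prescribed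
    probability and [dv] with the rest. *)
Lemma fun_build (H : T -> k.-tuple A -> R) : (forall t v, 0 <= H t v <= 1) ->
  (forall t t', agree ctx t t' -> H t = H t') ->
  exists Y, [/\ nn Y, mg b Y =1 mg b G1 & forall t0 (v : k.-tuple A),
    mass Y ctx t0 (bev n blk v) = mass G ctx t0 xpredT * H t0 v / #|A|%:R ^+ k].
Proof.
move=> Hb hH; have I1 := inv_dups0 A1 I wk; have G0 := inv_nn I.
have G10 := inv_nn I1.
have cM := inv_leM I; have bc := inv_fresh I1 (leqnn b).
have cb := inv_lt I1 (inv_c I1); have db := inv_lt I1 (inv_d I1).
have zM := iota_leM wk.
have bz : b \notin zs by rewrite mem_iota /b; nlia.
have aH t v : 0 <= fext (H t) v <= 1.
  by rewrite /fext; case: insubP => // *; rewrite lexx ler01.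
pose q (t : T) := fext (H t) (map (gv t) zs).
(* The value [dv] absorbs the remaining probability, so the factors add up to 1 wherever the two
   constants differ; elsewhere there is no mass. *)
pose r (t : T) := if gv t b == gv t cv then q t else if gv t b == gv t dv then 1 - q t else 0.
have r0 t : 0 <= r t.
  have /andP[q0 q1] := aH t (map (gv t) zs); rewrite /r; case: ifP => // _; case: ifP => // _.
  by rewrite subr_ge0.
have iq : indep b q.
  by move=> t a; rewrite /q map_ups // -(hH t) // agree_ups.
exists (fun t => mg b G1 t * r t); split.
- by move=> t; rewrite mulr_ge0 ?mg_nn.
- move=> t; rewrite {1}/mg; under eq_bigr => a _ do rewrite mg_ups.
  rewrite -mulr_sumr; have [z|nz] := eqVneq (mg b G1 t) 0; first by rewrite z mul0r.
  have cd : gv t cv != gv t dv.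
    have [a Ga] : exists a, 0 < G1 (ups t b a).
      by have /eqP/(psumr_neq0P (fun a _ => G10 _)) [a /= Ga] := nz; exists a.
    by have := inv_cd I1 Ga; rewrite !gv_ups_ne //; nlia.
  rewrite (bigD1 (gv t cv)) //= (bigD1 (gv t dv)) 1?eq_sym //= big1 ?addr0; last first.
    move=> a /andP[ac ad]; rewrite /r gv_ups !gv_ups_ne //; try nlia.
    by rewrite (negbTE ac) (negbTE ad).
  rewrite /r !gv_ups !gv_ups_ne //; try nlia.
  by rewrite !eqxx [gv t dv == _]eq_sym (negbTE cd) !iq subrKC mulr1.
move=> t0 v; rewrite mulrAC -(vals_mass t0 (size_tuple v)).
transitivity (\sum_(t | (gv t b == gv t0 cv) && (agree ctx t0 t && (map (gv t) zs == v))) mg b G1 t * H t0 v).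
  rewrite /mass; transitivity (\sum_(t | (gv t b == gv t0 cv) && (agree ctx t0 t && (map (gv t) zs == v))) mg b G1 t * r t).
    apply: eq_bigl => t; rewrite /bev /= andbT; case: (boolP (agree ctx t0 t)) => [/agreeP o|_]; last by rewrite andbF.
    by rewrite (o cv (inv_c I)) /= andbC.
  apply: eq_bigr => t /and3P[/eqP tb o /eqP tz]; congr (_ * _).
  rewrite /r tb (agreeP _ _ _ o cv (inv_c I)) eqxx /q tz -(hH _ _ o).
  by rewrite /fext valK.
rewrite -mulr_suml sum_mg_at //.
move=> t a; rewrite map_ups // agree_indep //.
Qed.

End FunStep.

(** The truth of an ESO formula depends on the context alone, so a team satisfies its translation
    exactly when the formula holds at every context of positive mass. *)
Theorem tr_correct q rho fenv fs vsE ctx w (G : T -> R) fe : ewf tau n fs vsE q -> loose q ->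
  ef_in true false true onlyEq C01 q -> team_inv f rho fenv fs ctx w G fe ->
  (tmaxv (tr n q rho fenv ctx w) <= M)%N ->
  wsat rel (tr n q rho fenv ctx w) G <->
  (forall t0, 0 < mass G ctx t0 xpredT -> esat rel f (fe t0) (fun x => gv t0 (rho x)) q).
Proof.
elim: q rho fenv fs vsE ctx w G fe => [x y|x y|e i j|e i j|r xs|r xs|p IHp q IHq|p IHp q IHq|x p IHp|x p IHp|g k p IHp]
  rho fenv fs vsE ctx w G fe wf lo cl I bM.
- apply: (lit_iff I (Q := fun t => gv t (rho x) = gv t (rho y))) => t0 t /agreeP o.
  by rewrite !o ?(inv_rho I).
- apply: (lit_iff I (Q := fun t => gv t (rho x) <> gv t (rho y))) => t0 t /agreeP o.
  by rewrite !o ?(inv_rho I).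
- case: e wf lo cl bM => wf lo [] // _ [c1 c2] bM; have [w1 w2] := andP wf.
  exact: (cmp_correct rel tau A1 I w1 w2 c1 c2 bM).
- by [].
- apply: iff_trans (lit_iff I (Q := fun t => rel r (map (fun x => gv t (rho x)) xs)) _).
    by split=> h t /h; rewrite /= -map_comp.
  by move=> t0 t o; rewrite (inv_gvrho I o).
- apply: iff_trans (lit_iff I (Q := fun t => ~~ rel r (map (fun x => gv t (rho x)) xs)) _).
    by split=> h t /h; rewrite /= -map_comp.
  by move=> t0 t o; rewrite (inv_gvrho I o).
- have [w1 w2] := andP wf; have [l1 l2] := andP lo; case: cl => c1 c2.
  move: bM; rewrite /= geq_max => /andP[b1 b2].
  rewrite (IHp _ _ _ _ _ _ _ _ w1 l1 c1 I b1) (IHq _ _ _ _ _ _ _ _ w2 l2 c2 I b2).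
  by split=> [[h1 h2] t0 m0|h]; [split; [exact: h1 | exact: h2] | split=> t0 /h[]].
- have [w1 w2] := andP wf; have [l1 l2] := andP lo; case: cl => c1 c2.
  pose no q (t : T) := ~~ tfval rel (gv t) (tr n q rho fenv ctx w).
  pose sp q (t : T) := esat rel f (fe t) (fun x => gv t (rho x)) q.
  have foc p' : fo p' -> forall t t' : T, agree ctx t t' -> no p' t = no p' t'.
    by move=> fp t t' o; rewrite /no !tfval_tr_fo // (inv_gvrho I o).
  have guard p' q' : fo p' ->
      (wsat rel (tr n q' rho fenv ctx w) (on (no p') G) <->
        (forall t0, 0 < mass (on (no p') G) ctx t0 xpredT -> sp q' t0)) ->
      wsat rel (TOr (tr n p' rho fenv ctx w) (TAnd (tneg (tr n p' rho fenv ctx w)) (tr n q' rho fenv ctx w))) G <->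
      (forall t0, 0 < mass G ctx t0 xpredT -> sp p' t0 \/ sp q' t0).
    move=> fp IH; rewrite wsat_guard ?tfo_tr //; last exact: inv_nn I.
    rewrite IH; split=> h t0.
      move=> m0; case: (boolP (foval rel (fun x => gv t0 (rho x)) p')) => fv.
        by left; apply/fo_esat.
      right; apply: h; apply/(fo_mass I _ (foc p' fp)); split=> //.
      by rewrite /no tfval_tr_fo.
    move=> /(fo_mass I _ (foc p' fp)) [np /h[/(fo_esat rel f _ _ fp) fv|//]].
    by rewrite /no tfval_tr_fo // fv in np.
  move: bM; rewrite [tr _ _ _ _ _ _]/=; case: ifP => fp.
    rewrite [tmaxv _]/= !geq_max => /and3P[b1 _ b2]; apply: guard => //.
    exact: (IHq _ _ _ _ _ _ _ _ w2 l2 c2 (fo_transfer I (foc p fp)) b2).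
  case: ifP => fq.
    rewrite [tmaxv _]/= !geq_max => /and3P[b1 _ b2].
    apply: iff_trans (guard q p fq _) _; first exact: (IHp _ _ _ _ _ _ _ _ w1 l1 c1 (fo_transfer I (foc q fq)) b2).
    by split=> h t0 /h[]; [right | left | right | left].
  rewrite [tmaxv _]/= !geq_max => /and4P[wM _ /andP[_ b1] /andP[_ b2]].
  have wc := inv_fresh I (leqnn w); have cM := inv_leM I.
  split.
    case=> Y [Y0 YG [dep [Y1 [Y2 [Y10 Y20 YE [h1 s1] [h2 s2]]]]]] t0 m0.
    (* The literals on [w] force the split: the two parts are the restrictions of [Y] to [w = cv]
       and to its complement. *)
    have E1 : Y1 = on (fun t => (gv t w == gv t cv) == true) Y.
      apply: functional_extensionality => t; rewrite /on YE eqb_id.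
      case: eqP => tw.
        have -> : Y2 t = 0; last by rewrite addr0.
        by apply: nn_eq0 => // /h2.
      by apply: nn_eq0 => // /h1.
    have E2 : Y2 = on (fun t => (gv t w == gv t cv) == false) Y.
      apply: functional_extensionality => t; rewrite /on YE eqbF_neg.
      case: eqP => tw /=.
        by apply: nn_eq0 => // /h2.
      have -> : Y1 t = 0; last by rewrite add0r.
      by apply: nn_eq0 => // /h1.
    have I1 := or_transfer A1 I true wM Y0 YG dep.
    have I2 := or_transfer A1 I false wM Y0 YG dep.
    rewrite -E1 in I1; rewrite -E2 in I2.
    have := mass_mg A0 t0 wM cM wc (P := xpredT) (fun _ _ => erefl) YG => mY.
    rewrite -mY in m0; have [t [o _ Yt]] := mass_gt0 Y0 m0.
    have [Y1t|Y1t] := ltP 0 (Y1 t).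
      left; apply: (proj1 (IHp _ _ _ _ _ _ _ _ w1 l1 c1 I1 b1) s1).
      exact: (mass_gt0' Y10 o).
    right; apply: (proj1 (IHq _ _ _ _ _ _ _ _ w2 l2 c2 I2 b2) s2).
    apply: (mass_gt0' Y20 o) => //; apply: lt_le_trans Yt _.
    by rewrite YE gerDr.
  move=> H.
  (* The first disjunct is chosen whenever it holds. This is a function of the context, as the
     dependence atom demands. *)
  pose h (t : T) := if excluded_middle_informative (sp p t) then gv t cv else gv t dv.
  have spE t t' : agree ctx t t' -> sp p t = sp p t'.
    by move=> o; rewrite /sp (inv_fe I o) (inv_gvrho I o).
  have hE t t' : agree ctx t t' -> h t = h t'.
    by move=> o; rewrite /h (spE _ _ o) (agreeP _ _ _ o cv (inv_c I)) (agreeP _ _ _ o dv (inv_d I)).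
  have G0 := inv_nn I; have [Y [Y0 YG dep Yh]] := choose_transfer I wM hE.
  exists Y; split=> //; split=> //.
  exists (on (fun t => (gv t w == gv t cv) == true) Y), (on (fun t => (gv t w == gv t cv) == false) Y).
  split; try exact: on_nn.
  + by move=> t; rewrite /on; case: (gv t w == gv t cv); rewrite ?addr0 ?add0r.
  + split; first by move=> t /on_gt0[/eqP/eqP].
    apply: (proj2 (IHp _ _ _ _ _ _ _ _ w1 l1 c1 (or_transfer A1 I true wM Y0 YG dep) b1)) => t0.
    move=> /(mass_gt0 (on_nn _ Y0)) [t [o _ /on_gt0[/eqP/eqP tw /Yh[t' [o' e Gt']]]]].
    have ot : agree ctx t0 t' by rewrite (agree_congr _ o).
    rewrite -[esat _ _ _ _ _]/(sp p t0) (spE _ _ ot).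
    rewrite tw /h in e; case: (excluded_middle_informative (sp p t')) e => //= ns e.
    by have := inv_cd I Gt'; rewrite -e (agreeP _ _ _ o' cv (inv_c I)) eqxx.
  + split; first by move=> t /on_gt0[]; rewrite eqbF_neg => /eqP.
    apply: (proj2 (IHq _ _ _ _ _ _ _ _ w2 l2 c2 (or_transfer A1 I false wM Y0 YG dep) b2)) => t0.
    move=> /(mass_gt0 (on_nn _ Y0)) [t [o _ /on_gt0[]]]; rewrite eqbF_neg => tw /Yh[t' [o' e Gt']].
    have ot : agree ctx t0 t' by rewrite (agree_congr _ o).
    case: (H t0 (mass_gt0' (P := xpredT) G0 ot isT Gt')) => // st0.
    have st' : sp p t' by rewrite -(spE _ _ ot).
    rewrite e /h in tw; case: (excluded_middle_informative (sp p t')) tw => //= _.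
    by rewrite (agreeP _ _ _ o' cv (inv_c I)) eqxx.
- move: bM; rewrite [tr _ _ _ _ _ _]/= [tmaxv _]/= !geq_max => /and3P[wM _ b1].
  have wc := inv_fresh I (leqnn w); have cM := inv_leM I; have G0 := inv_nn I.
  have lt := inv_lt I; have rI := inv_rho I.
  split.
    case=> Y [Y0 YG [dep s]] t0.
    have I1 := ex_transfer A1 I x wM Y0 YG dep.
    rewrite -(mass_mg A0 t0 wM cM wc (P := xpredT) (fun _ _ => erefl) YG).
    (* The witness is the value of [w] at a charged assignment over the context. *)
    move=> /(mass_gt0 Y0) [t [o _ Yt]]; exists (gv t w).
    have o1 : agree ctx t0 (ups t0 w (gv t w)) by apply: agree_ups.
    have := proj1 (IHp _ _ _ _ _ _ _ _ wf lo cl I1 b1) s (ups t0 w (gv t w)).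
    rewrite (updr1 _ _ _ wM rI lt) -(inv_fe I o1); apply.
    apply: (mass_gt0' Y0 _ _ Yt) => //; rewrite /agree /= gv_ups eqxx /= -/(agree _ _ _).
    by rewrite -(agree_congr _ o1).
  move=> H; have /card_gt0P[a0 _] := A0.
  (* Assignments with equal contexts give the same predicate, hence the same chosen value. *)
  pose h (t : T) := epsilon (inhabits a0) (fun a => esat rel f (fe t) (upd (fun y => gv t (rho y)) x a) p).
  have hE t t' : agree ctx t t' -> h t = h t'.
    by move=> o; rewrite /h (inv_fe I o) (inv_gvrho I o).
  have [Y [Y0 YG dep Yh]] := choose_transfer I wM hE.
  exists Y; split=> //; split=> //.
  apply: (proj2 (IHp _ _ _ _ _ _ _ _ wf lo cl (ex_transfer A1 I x wM Y0 YG dep) b1)) => t0.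
  move=> /(mass_gt0 Y0) [t [o _ /Yh[t' [o' e Gt']]]].
  have oc : agree ctx t0 t by apply: agree_sub o => y yc; rewrite inE yc orbT.
  have ot : agree ctx t0 t' by rewrite (agree_congr _ oc).
  have tw : gv t0 w = h t0.
    by rewrite -(agreeP _ _ _ o) ?mem_head // e (hE _ _ ot).
  have ex := H t0 (mass_gt0' G0 ot isT Gt').
  have := epsilon_spec (inhabits a0) _ ex; rewrite -/(h t0) -tw -(updr1 _ _ _ wM rI lt).
  by rewrite ups_id.
- move: bM; rewrite [tr _ _ _ _ _ _]/= [tmaxv _]/= !geq_max => /andP[wM b1].
  have wc := inv_fresh I (leqnn w); have cM := inv_leM I; have G0 := inv_nn I.
  have lt := inv_lt I; have rI := inv_rho I.
  have w1M : (w + 1 <= M.+1)%N by rewrite addn1.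
  have I1 : team_inv f (updr rho [:: x] [:: w]) fenv fs (w :: ctx) w.+1 (dup w G) fe.
    have := inv_dups I w1M; rewrite addn1; apply => y; exact: updr1_in.
  have mE t : mass (dup w G) (w :: ctx) t xpredT = mass G ctx t xpredT / #|A|%:R.
    by apply: mass_dup_at.
  have pos t : (0 < mass (dup w G) (w :: ctx) t xpredT) = (0 < mass G ctx t xpredT).
    by rewrite mE pmulr_lgt0 // invr_gt0 ltr0n.
  rewrite -[wsat _ _ _]/(wsat rel (tr n p (updr rho [:: x] [:: w]) fenv (w :: ctx) w.+1) (dup w G)).
  rewrite (IHp _ _ _ _ _ _ _ _ wf lo cl I1 b1); split=> H t0.
    move=> m0 a; have o1 : agree ctx t0 (ups t0 w a) by apply: agree_ups.
    have := H (ups t0 w a); rewrite pos -(mass_congr _ _ o1) (updr1 _ _ _ wM rI lt) -(inv_fe I o1).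
    exact.
  by rewrite pos => /H /(_ (gv t0 w)); rewrite -(updr1 _ _ _ wM rI lt) ups_id.
- move: bM; rewrite [tr _ _ _ _ _ _]/= => /talls_bound[zM]; rewrite [tmaxv _]/= geq_max => /andP[wM b1].
  have G0 := inv_nn I.
  rewrite wsat_talls; split.
    case=> Y [Y0 YG s] t0 m0.
    have [H [Hb hH HY]] := fun_extract I wM Y0 YG.
    have [I2 mE] := fun_transfer g I wM Y0 YG hH HY.
    exists (H t0); split=> //.
    by apply: (proj1 (IHp _ _ _ _ _ _ _ _ wf lo cl I2 b1) s t0); rewrite mE.
  move=> S.
  pose good (t : T) (h : k.-tuple A -> R) := (forall u, 0 <= h u <= 1) /\
    esat rel f (fun g' => if g' == g then fext h else fe t g') (fun x => gv t (rho x)) p.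
  (* At contexts without mass the function is 0, so that the bounds hold at every context. *)
  pose H (t : T) := if 0 < mass G ctx t xpredT then epsilon (inhabits (fun _ => 0)) (good t) else fun _ => 0.
  have gP t : 0 < mass G ctx t xpredT -> good t (H t).
    by move=> m0; rewrite /H m0; apply: epsilon_spec; apply: S.
  have Hb t v : 0 <= H t v <= 1.
    case: (boolP (0 < mass G ctx t xpredT)) => [/gP[]//|m0].
    by rewrite /H (negbTE m0) lexx ler01.
  have hH t t' : agree ctx t t' -> H t = H t'.
    by move=> o; rewrite /H (mass_congr _ _ o) /good (inv_fe I o) (inv_gvrho I o).
  have [Y [Y0 YG HY]] := fun_build I wM Hb hH.
  have [I2 mE] := fun_transfer g I wM Y0 YG hH HY.
  exists Y; split=> //.
  apply: (proj2 (IHp _ _ _ _ _ _ _ _ wf lo cl I2 b1)) => t0; rewrite mE => m0.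
  by have [] := gP t0 m0.
Qed.

End Main.

(** * The two equivalences *)

Lemma esat_scope (A : finType) rel n (f : n.-tuple A -> R) tau fs vs fe s s' q :
  ewf tau n fs vs q -> {in vs, s =1 s'} -> esat rel f fe s q -> esat rel f fe s' q.
Proof.
have em (us : seq nat) (v v' : nat -> A) xs : {in us, v =1 v'} -> all (mem us) xs -> map v xs = map v' xs.
  by move=> e /allP h; apply/eq_in_map => x /h; apply: e.
have nvE gs i us e (v v' : nat -> A) : ntwf n gs us i -> {in us, v =1 v'} -> nval f e v i = nval f e v' i.
  elim: i us v v' => [c|xs|g xs|i IHi j IHj|i IHi j IHj|ys i IHi] us v v' //=.
  - by move=> /andP[_ h] vv; rewrite (em _ _ _ _ vv h).
  - by move=> /andP[_ h] vv; rewrite (em _ _ _ _ vv h).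
  - by move=> /andP[h1 h2] vv; rewrite (IHi us v v') ?(IHj us v v').
  - by move=> /andP[h1 h2] vv; rewrite (IHi us v v') ?(IHj us v v').
  move=> /andP[_ h] vv; apply: eq_bigr => a _; apply: (IHi (ys ++ us)) => // x.
  rewrite mem_cat /updl; case: ifPn => [xy _|_ /= /vv //].
  by apply: set_nth_default; rewrite size_tuple index_mem.
have cons us (v v' : nat -> A) x a : {in us, v =1 v'} -> {in x :: us, upd v x a =1 upd v' x a}.
  by move=> vv y; rewrite inE /upd; case: eqP => //= _ /vv.
elim: q fs vs fe s s' => [x y|x y|e i j|e i j|r xs|r xs|p IHp q IHq|p IHp q IHq|x p IHp|x p IHp|g k p IHp]
  fs vs fe s s' /= wf ss.
- by case/andP: wf => h1 h2; rewrite !ss.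
- by case/andP: wf => h1 h2; rewrite !ss.
- by case/andP: wf => h1 h2; rewrite (nvE _ _ _ _ _ _ h1 ss) (nvE _ _ _ _ _ _ h2 ss).
- by case/andP: wf => h1 h2; rewrite (nvE _ _ _ _ _ _ h1 ss) (nvE _ _ _ _ _ _ h2 ss).
- by case/and3P: wf => _ _ h; rewrite (em _ _ _ _ ss h).
- by case/and3P: wf => _ _ h; rewrite (em _ _ _ _ ss h).
- by case/andP: wf => h1 h2 [/(IHp _ _ _ _ _ h1 ss) ? /(IHq _ _ _ _ _ h2 ss)].
- by case/andP: wf => h1 h2 [/(IHp _ _ _ _ _ h1 ss)|/(IHq _ _ _ _ _ h2 ss)]; [left|right].
- by move=> [a h]; exists a; apply: IHp wf _ h; apply: cons.
- by move=> h a; apply: IHp wf _ (h a); apply: cons.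
- by move=> [h [hb hs]]; exists h; split=> //; apply: IHp wf ss hs.
Qed.

(** Both ESO logics lie in the one that has [+] and [SUM], so a single translation into teams serves
    for both equivalences. *)
Lemma ef_in_mono (a b c a' b' c' : bool) E C p : a ==> a' -> b ==> b' -> c ==> c' ->
  ef_in a b c E C p -> ef_in a' b' c' E C p.
Proof.
move=> /implyP ha /implyP hb /implyP hc.
have nt i : nt_in a b c C i -> nt_in a' b' c' C i.
  elim: i => //= [i IHi j IHj|i IHi j IHj|ys i IHi].
  - by move=> [/ha ? [/IHi ? /IHj]].
  - by move=> [/hb ? [/IHi ? /IHj]].
  - by move=> [/hc ? /IHi].
elim: p => //= [e i j|e i j|p IHp q IHq|p IHp q IHq].
- by move=> [? [/nt ? /nt]].
- by move=> [? [/nt ? /nt]].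
- by move=> [/IHp ? /IHq].
- by move=> [/IHp ? /IHq].
Qed.

Section Top.
Variables (tau : vocab) (n : nat) (q : eform).
Hypothesis (wf : eso_sentence tau n q).

(* The two distinct values of the variables n and n+1 serve as constants. *)
Definition team_of_eso : tform :=
  TAll n (TAll n.+1 (TOr (TEq n n.+1) (TAnd (TNeq n n.+1)
    (tr n q (fun _ => n) (fun _ => bfree n) [:: n.+1; n] n.+2)))).

Lemma team_of_eso_scope : tscope tau (iota 0 n) team_of_eso.
Proof.
rewrite /= !inE !eqxx !orbT /=; apply: (tscope_tr _ wf); last first.
  by move=> x; rewrite !inE => /orP[->|->]; rewrite ?orbT.
split=> // [x|x]; last by rewrite !inE eqxx orbT.
by rewrite !inE !mem_iota; lia.
Qed.

Lemma team_of_eso_no_dep : prefFA q -> almost_conj q -> no_dep team_of_eso.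
Proof. by move=> h1 h2; rewrite /= no_dep_tr. Qed.

(** After the two universal quantifiers and the guard, each context with distinct constants carries
    a copy of the input distribution, scaled by one common factor; this is the invariant at the
    root. *)
Lemma team_of_eso_correct : loose q -> ef_in true false true onlyEq C01 q ->
  same_struc tau n team_of_eso q.
Proof.
move=> lo cl A rel f A1 _ df.
have A0 : (0 < #|A|)%N := ltnW A1.
have /card_gt1P[a0 [a1 [_ _ a01]]] := A1.
pose M := tbound n team_of_eso.
have tM : (tmaxv team_of_eso < M)%N by apply: leq_maxr.
have nM : (n <= M.+1)%N by apply: leqW; apply: leq_maxl.
have [n1M bM] : (n.+1 <= M)%N /\ (tmaxv (tr n q (fun _ => n) (fun _ => bfree n) [:: n.+1; n] n.+2) <= M)%N.
  by move: (ltnW tM) => /=; split; nlia.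
have n0M : (n <= M)%N by apply: ltnW.
rewrite (tsat_struct_wsat rel a0 team_of_eso_scope (leqnSn M) A0 df).
pose G0 := initG M a0 f; have G00 : nn G0 by apply: initG_nn.
pose G2 := dup n.+1 (dup n G0).
have G20 : nn G2 by apply/dup_nn/dup_nn.
rewrite -[wsat _ _ _]/(wsat rel (TOr (TEq n n.+1) (TAnd (tneg (TEq n n.+1))
    (tr n q (fun _ => n) (fun _ => bfree n) [:: n.+1; n] n.+2))) G2) wsat_guard //.
set G3 := on _ G2; have G30 : nn G3 by apply: on_nn.
(* Each pair of distinct constants has mass [#|A|] to the power -2; equal pairs are removed by the
   guard. *)
pose la (t0 : {ffun 'I_M.+1 -> A}) : R := (gv t0 n != gv t0 n.+1)%:R / #|A|%:R / #|A|%:R.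
have mE t0 (P : pred {ffun 'I_M.+1 -> A}) : indep n P -> indep n.+1 P ->
    mass G3 [:: n.+1; n] t0 P = la t0 * \sum_(t | P t) G0 t.
  move=> i0 i1; transitivity ((gv t0 n != gv t0 n.+1)%:R * mass G2 [:: n.+1; n] t0 P).
    rewrite /mass mulr_sumr; apply: eq_bigr => t /andP[/agreeP o _].
    rewrite /G3 /on /= !o ?inE ?eqxx ?orbT //.
    by case: (_ != _); rewrite ?mul1r ?mul0r.
  rewrite /G2 mass_dup_at //; [|by rewrite /= n0M|by rewrite inE; lia].
  rewrite mass_dup_at // /mass /la -!mulrA; congr (_ * _).
  by rewrite mulrC -mulrA mulrCA.
have tot : \sum_t G0 t = 1 by apply: initG_total.
have mT t0 : mass G3 [:: n.+1; n] t0 xpredT = la t0 by rewrite mE // tot mulr1.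
have I : team_inv f (fun _ => n) (fun _ => bfree n) [::] [:: n.+1; n] n.+2 G3 (fun _ _ _ => 0).
  split=> //.
  - by move=> x; rewrite !inE => /orP[]/eqP->.
  - by rewrite !inE eqxx orbT.
  - by rewrite !inE eqxx.
  - by move=> t /on_gt0[].
  - by move=> _; rewrite !inE eqxx orbT.
  split=> //; first by move=> x; rewrite mem_iota /=; lia.
  move=> t0 v /=; rewrite size_iota expr0 divr1 => sv.
  have ib x : (n <= x)%N -> (x <= M)%N -> indep x (bev n (bfree n) v : pred {ffun 'I_M.+1 -> A}).
    move=> nx xM t a; have aM : all (fun y => (y <= M)%N) (iota 0 n).
      by apply/allP => y; rewrite mem_iota; nlia.
    by rewrite /bev /= !andbT map_ups // mem_iota; nlia.
  rewrite mE ?mT; [|exact: ib|by apply: ib => //; lia]; congr (_ * _).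
  rewrite (sum_initG _ _ (bev n (bfree n) v)).
  have sv' : size v == n by apply/eqP.
  rewrite -[v]/(tval (Tuple sv')) /fext valK (big_pred1 (Tuple sv')) // => u /=.
  by rewrite /bev /= andbT map_emb.
rewrite (tr_correct rel A1 wf lo cl I bM); split=> [H s|H t0 _]; last exact: H.
(* A context with distinct constants, hence of positive mass; as a sentence, [q] does not read the
   assignment. *)
pose t0 : {ffun 'I_M.+1 -> A} := ups (ups [ffun _ => a0] n a0) n.+1 a1.
apply: (esat_scope (vs := [::]) wf (s := fun _ => gv t0 n)) => //.
apply: H; rewrite mT /la.
have -> : gv t0 n.+1 = a1 by rewrite gv_ups.
have -> : gv t0 n = a0 by rewrite gv_ups_ne ?gv_ups //; lia.
by rewrite a01 !divr_gt0 // ltr0n.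
Qed.

End Top.

Theorem mainTheorem6 :
  equiv_logics (fun _ => True) LESO_eq_add_01 /\
  equiv_logics (fun p => no_dep p) LESO_eq_sum_01_acEA.
Proof.
split; split.
- exact: approx_dep_le_eso_add.
- move=> tau n q wf [lo cl]; exists (team_of_eso n q); split=> //.
    exact: team_of_eso_scope.
  by apply: team_of_eso_correct => //; apply: ef_in_mono cl.
- exact: approx_le_eso_sum.
move=> tau n q wf [lo cl ac pf]; exists (team_of_eso n q); split.
- exact: team_of_eso_scope.
- exact: team_of_eso_no_dep.
- by apply: team_of_eso_correct => //; apply: ef_in_mono cl.
Qed.
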